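(* Let $g:[0,\infty)\to[0,1]$ be a non-increasing function with $0<C:=\int_{\mathbb{R}^2}g(\|\boldsymbol{x}\|)\,d\boldsymbol{x}<\infty$ and $g(x)=o\left(\frac{1}{x^2\log^2 x}\right)$ as $x\to\infty$. Let $b=b(\rho)$ be a real-valued function of $\rho$ with $\log\rho+b(\rho)>0$ for all sufficiently large $\rho$, put $r_\rho=\sqrt{\frac{\log\rho+b(\rho)}{C\rho}}$, and let $\mathcal{G}(\mathcal{X}_\rho,g_\rho)$ be the random connection network on the unit square with density $\rho$ in which two nodes at Euclidean distance $x$ are directly connected with probability $g(x/r_\rho)$. (i) If $b(\rho)\to\infty$ as $\rho\to\infty$, then asymptotically almost surely there is no isolated node in $\mathcal{G}(\mathcal{X}_\rho,g_\rho)$. (ii) If $b(\rho)\to-\infty$ as $\rho\to\infty$, then asymptotically almost surely $\mathcal{G}(\mathcal{X}_\rho,g_\rho)$ has at least one isolated node.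
   Context: The network $\mathcal{G}(\mathcal{X}_\rho,g_\rho)$: the nodes form a homogeneous Poisson point process $\mathcal{X}_\rho$ of density $\rho$ on the unit square $\left[-\frac12,\frac12\right)^2$. Given the node positions, each pair of nodes separated by Euclidean distance $x$ is directly connected (joined by an edge) with probability $g(x/r_\rho)$, independently of all other pairs. A node is isolated if it is not directly connected to any other node. An event depending on $\rho$ occurs asymptotically almost surely if its probability tends to $1$ as $\rho\to\infty$. $\|\cdot\|$ is the Euclidean norm. *)

(* Defs.v *)
From HB Require Import structures.
From mathcomp Require Export all_boot all_order all_algebra.
From mathcomp Require Export all_classical all_reals all_analysis.

Set Implicit Arguments.
Unset Strict Implicit.
Unset Printing Implicit Defensive.

Import Order.TTheory GRing.Theory Num.Theory.
Export numFieldNormedType.Exports.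

Local Open Scope classical_set_scope.
Local Open Scope ring_scope.

(* Landau notations need a canonical filter; the library declares none for +oo. *)
Canonical pinfty_filter_on (R : realType) := FilterType (@pinfty_nbhs R) _.

(* The carriers [measurableTypeR R] are [R] with its Borel sigma-algebra, in the
   form on which the library defines [lebesgue_measure]. *)
Notation plane R := (measurableTypeR R * measurableTypeR R)%type.

Section Plane.
Context {R : realType}.

Definition leb2 : {measure set (plane R) -> \bar R} :=
  (@lebesgue_measure R \x @lebesgue_measure R)%E.

(* The library norm on [R * R] is the sup norm. *)
Definition norm2 (z : plane R) : R :=
  Num.sqrt ((z.1 : R) ^+ 2 + (z.2 : R) ^+ 2).

Definition dist2 (x y : plane R) : R :=
  norm2 ((x.1 : R) - (y.1 : R), (x.2 : R) - (y.2 : R)).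

Definition unit_square : set (plane R) :=
  `[- 2^-1 : R, 2^-1[ `*` `[- 2^-1 : R, 2^-1[.

End Plane.

(* A random graph embedded in the plane: in the outcome [w], the nodes are
   [node N 0 w, ..., node N (nb_nodes N w).-1 w], and [linked N i j w] says
   that the nodes of index [i] and [j] are directly connected. The values of
   [node] and [linked] at indices that are not below [nb_nodes N w] play no
   role. *)
Record network (R : realType) (T : Type) := Network {
  nb_nodes : T -> nat ;
  node : nat -> T -> plane R ;
  linked : nat -> nat -> T -> bool
}.

Section Networks.
Context {R : realType} {d : measure_display} {T : measurableType d}.
Implicit Types (N : network R T) (P : probability T R) (w : T).

Definition node_count N (A : set (plane R)) w : nat :=
  \sum_(i < nb_nodes N w) (node N i w \in A).

(* The mean of the Poisson law of [node_count N A] is [rho * |A|], which may be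
   0; this is why the probabilities are not written with the [poisson_pmf] of
   the library, which is constantly 1 in that case. *)
Definition poisson_process P N (rho : R) : Prop :=
  [/\ forall w i, (i < nb_nodes N w)%N -> unit_square (node N i w),
      forall A k, measurable A -> A `<=` unit_square ->
        let m := rho * fine (leb2 A) in
        P [set w | node_count N A w = k] =
          (m ^+ k / k`!%:R * expR (- m))%:E
    & forall n (A : 'I_n -> set (plane R)) (k : 'I_n -> nat),
        (forall i, measurable (A i)) -> (forall i, A i `<=` unit_square) ->
        trivIset setT A ->
        P [set w | forall i, node_count N (A i) w = k i] =
          (\prod_(i < n) P [set w | node_count N (A i) w = k i])%E].

Definition node_positions N n w : n.-tuple (plane R) :=
  [tuple node N i w | i < n].

(* Conditional probability that the graph on nodes at positions [x] is the one
   with adjacency relation [e]. *)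
Definition graph_likelihood (conn : R -> R) n (x : n.-tuple (plane R))
    (e : rel 'I_n) : R :=
  \prod_(p : 'I_n * 'I_n | (p.1 < p.2)%N)
    let c := conn (dist2 (tnth x p.1) (tnth x p.2)) in
    if e p.1 p.2 then c else 1 - c.

(* Conditionally on the number and on the positions of the nodes, each pair of
   nodes at distance [x] is linked with probability [conn x], independently of
   the other pairs: this is the defining property of conditional probability
   given the sigma-algebra generated by [nb_nodes] and the positions, whose
   trace on [nb_nodes = n] consists of the events [node_positions N n \in B]. *)
Definition independent_links P N (conn : R -> R) : Prop :=
  forall n (B : set (n.-tuple (plane R))) (e : rel 'I_n), measurable B ->
    let D := [set w | nb_nodes N w = n /\ B (node_positions N n w)] in
    P (D `&` [set w | forall i j : 'I_n, (i < j)%N -> linked N i j w = e i j])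
    = (\int[P]_(w in D) (graph_likelihood conn (node_positions N n w) e)%:E)%E.

Definition measurable_network N : Prop :=
  [/\ measurable_fun setT (nb_nodes N),
      forall i, measurable_fun setT (node N i)
    & forall i j, measurable_fun setT (linked N i j)].

Definition random_connection_network P N (rho : R) (conn : R -> R) : Prop :=
  [/\ measurable_network N,
      forall i j w, linked N i j w = linked N j i w,
      poisson_process P N rho
    & independent_links P N conn].

Definition isolated N w (i : nat) : Prop :=
  (i < nb_nodes N w)%N /\
  forall j, (j < nb_nodes N w)%N -> j != i -> ~~ linked N i j w.

Definition has_isolated_node N : set T := [set w | exists i, isolated N w i].

End Networks.

Definition asymptotically_almost_surely (R : realType)
    (d : R -> measure_display) (T : forall rho, measurableType (d rho))
    (P : forall rho, probability (T rho) R) (A : forall rho, set (T rho)) :=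
  P rho (A rho) @[rho --> +oo%R] --> 1%E.

(* Main.v *)
Require Import Defs.
From mathcomp Require Import measurable_realfun.
From mathcomp Require Import ring lra zify.

Set Implicit Arguments.
Unset Strict Implicit.
Unset Printing Implicit Defensive.

Import Order.TTheory GRing.Theory Num.Theory.
Local Open Scope classical_set_scope.
Local Open Scope ring_scope.

(* The square is cut into m x m cells, m so large that a cell holds two nodes
   with negligible probability. A cell is "alone" when it holds exactly one node
   and this node is isolated. As the cell counts are independent Poisson
   variables and [g] is monotone, the probability that given cells are alone is
   bounded above and below by explicit exponentials of lattice sums of [g], and
   sum_k rho * g(|k| / (m r)) / m^2 is close to ln rho + b.

   (i) The expected number of alone cells is at most about exp(-b) in the bulk;
   the cells near the sides and the corners see only a half and a quarter of the
   mass, but are few enough. The decay of [g] bounds the mass missed by a cell at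
   distance rho^delta * r from the boundary by O(1 / ln rho), which changes
   exp(-(ln rho + b)) by a bounded factor only. Since isolation is monotone in r,
   b may be replaced by min(b, ln rho).

   (ii) The expected number M of alone cells in the central quarter is at least
   about exp(-b) / 4, and by the second moment method it suffices that alone
   cells are asymptotically uncorrelated. For far pairs the lattice sums hardly
   overlap; for near pairs, a lune at the second cell which is not seen from the
   first one makes both cells being alone unlikely. *)

(** The network is known only through its cell counts and, given the positions, its links. Fixing
    the number of nodes and the cell of each node splits the outcomes into countably many events on
    which isolation concerns links between fixed indices; this replaces a Palm formula. Let [a] be
    the cell side divided by the connection radius and [L = ln rho + b] (with [b] truncated in (i)).
    The mean count of a cell is then [mu = L / C * a ^+ 2], so [mu] times a full lattice sum is a
    Riemann sum for [L]. Replacing [g] by its extreme values on cells costs [O(1 / a)] in a lattice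
    sum, because monotone differences telescope, hence [O(L * a)] in an exponent; a mesh with
    [a <= 1 / rho] makes this negligible. In (ii) [L] is merely positive and may tend to 0. Errors
    are therefore kept explicit: constants that come from [g] alone, times an exponential in [b]
    plus an inverse power of [ln rho]. *)

(** * Integrals over countable partitions and products of independent counts *)

Section Expectations.
Context d (T : measurableType d) (R : realType).

Lemma eseries_single (n : nat) (u : nat -> \bar R) :
  (0 <= u n)%E -> (forall j, j != n -> u j = 0%E) ->
  (\sum_(j <oo) u j = u n)%E.
Proof.
move=> un0 u0; rewrite (@nneseriesD1 R u n)//; last first.
  by move=> k _; have [->//|/u0->] := eqVneq k n.
by rewrite eseries0 ?adde0// => i _ /u0.
Qed.

Lemma integral_partition_le (P : {measure set T -> \bar R}) (I : countType)
    (F : I -> set T) (f1 f2 : T -> \bar R) :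
  (forall i, measurable (F i)) -> trivIset setT F -> (forall w, exists i, F i w) ->
  measurable_fun setT f1 -> measurable_fun setT f2 ->
  (forall w, 0 <= f1 w)%E -> (forall w, 0 <= f2 w)%E ->
  (forall i, \int[P]_(w in F i) f1 w <= \int[P]_(w in F i) f2 w)%E ->
  (\int[P]_w f1 w <= \int[P]_w f2 w)%E.
Proof.
move=> mF tF cF mf1 mf2 f10 f20 le12.
(* Several codes may be unpickled to the same index; the test [pickle i == n] keeps one code per
   index, so that the sequence stays disjoint. *)
pose F' n := if unpickle n is Some i then
  (if pickle i == n then F i else set0) else set0.
have mF' n : measurable (F' n).
  by rewrite /F'; case: unpickle => // i; case: ifP.
have cF' : \bigcup_n F' n = setT.
  apply/seteqP; split => // w _; have [i Fi] := cF w.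
  by exists (pickle i) => //; rewrite /F' pickleK eqxx.
have tF' : trivIset setT F'.
  move=> m n _ _ [w []]; rewrite /F'.
  case: unpickle => // i; case: ifP => // /eqP im Fi.
  case: unpickle => // j; case: ifP => // /eqP jn Fj.
  rewrite -im -jn; congr pickle; apply: tF => //; by exists w.
have E (f : T -> \bar R) : measurable_fun setT f -> (forall w, 0 <= f w)%E ->
    (\int[P]_w f w = \sum_(i <oo) \int[P]_(w in F' i) f w)%E.
  by move=> mf f0; rewrite -cF' ge0_integral_bigcup// cF'.
rewrite !E//; apply: lee_nneseries => [i _ _|i _].
  by apply: integral_ge0.
rewrite /F'; case: unpickle => [j|]; last by rewrite !integral_set0.
by case: ifP; rewrite ?integral_set0.
Qed.

Lemma measurable_nat_comp (X : T -> nat) (f : nat -> R) :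
  measurable_fun setT X -> measurable_fun setT (fun w => (f (X w))%:E).
Proof. by move=> mX; apply/measurable_EFinP; apply: measurableT_comp. Qed.

Lemma integral_prod_independent (P : {measure set T -> \bar R})
    (K : finType) (X : K -> T -> nat) (p f : K -> nat -> R) (s : K -> R) :
  (forall k, measurable_fun setT (X k)) ->
  (forall k j, 0 <= f k j) -> (forall k j, 0 <= p k j) ->
  (forall k, \sum_(j <oo) (f k j * p k j)%:E = (s k)%:E)%E ->
  (forall kappa : K -> nat,
    P [set w | forall k, X k w = kappa k] = (\prod_k p k (kappa k))%:E) ->
  (\int[P]_w (\prod_k f k (X k w))%:E = (\prod_k s k)%:E)%E.
Proof.
move=> mX f0 p0 fps indep.
(* Induction on [q]: the coordinates outside [q] are pinned to the values
   [kappa], those in [q] have been summed out. *)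
pose h (q : seq K) (kappa : K -> nat) k j : R :=
  if k \in q then f k j else (j == kappa k)%:R.
have h0 q kappa k j : 0 <= h q kappa k j by rewrite /h; case: ifP.
have mh q kappa : measurable_fun setT
    (fun w => (\prod_k h q kappa k (X k w))%:E).
  apply/measurable_EFinP; apply: measurable_prod => k _.
  exact/measurable_EFinP/measurable_nat_comp.
have main q kappa : uniq q ->
    (\int[P]_w (\prod_k h q kappa k (X k w))%:E =
     (\prod_k if k \in q then s k else p k (kappa k))%:E)%E.
  elim: q kappa => [|k0 q IH] kappa.
    move=> _; rewrite -[RHS]indep.
    have -> : [set w | forall k, X k w = kappa k] =
        \big[setI/setT]_k (X k @^-1` [set kappa k]).
      apply/seteqP; split => w /=.
        by move=> H; rewrite -bigcap_seq => k _ /=; exact: H.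
      by rewrite -bigcap_seq => H k; apply: H; rewrite /= mem_index_enum.
    rewrite -[in RHS](setIT (\big[_/_]_k _)) -integral_indic//; last first.
      apply: bigsetI_measurable => k _; rewrite -[X in measurable X]setTI; exact: mX.
    apply: eq_integral => w _; congr EFin.
    rewrite /= indicE.
    have [/= wI|/= wI] := pselect (w \in \big[setI/setT]_k (X k @^-1` [set kappa k])).
      rewrite wI big1// => k _; rewrite /h in_nil.
      move: wI; rewrite inE -bigcap_seq => /(_ k); rewrite /= mem_index_enum.
      by move=> /(_ isT) ->; rewrite eqxx.
    move/negP: (wI) => /negPf ->.
    apply/eqP; apply: contra_notT wI => /prodf_neq0 H; rewrite inE -bigcap_seq => k _ /=.
    have := H k isT; rewrite /h in_nil.
    by case: (X k w =P kappa k) => // _; rewrite eqxx.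
  move=> /= /andP[k0q uq].
  pose kap j k := if k == k0 then j else kappa k.
  have hE w j : \prod_k h q (kap j) k (X k w) =
      (X k0 w == j)%:R * \prod_(k | k != k0) h (k0 :: q) kappa k (X k w).
    rewrite (bigD1 k0)//= /h (negPf k0q) /kap eqxx; congr (_ * _).
    by apply: eq_bigr => k /negPf kk0; rewrite inE kk0.
  (* The value of coordinate [k0] is split off: by [hE] only the term [j = X k0 w] survives. In each
     term [k0] is pinned to [j], and the induction hypothesis applies. *)
  transitivity (\int[P]_w (\sum_(j <oo) (f k0 j)%:E * (\prod_k h q (kap j) k (X k w))%:E))%E.
    apply: eq_integral => w _; rewrite (@eseries_single (X k0 w)).
    - by rewrite -EFinM hE eqxx mul1r (bigD1 k0)//= {1}/h mem_head.
    - by rewrite -EFinM lee_fin mulr_ge0// prodr_ge0.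
    - move=> j jX; rewrite hE eq_sym (negPf jX) mul0r mule0//.
  rewrite integral_nneseries//; last 2 first.
    by move=> j; apply: measurable_funeM.
    by move=> j w _; rewrite -EFinM lee_fin mulr_ge0// prodr_ge0.
  under eq_eseriesr => j _.
    rewrite ge0_integralZl//; last 2 first.
      by move=> w _; rewrite lee_fin prodr_ge0.
      by rewrite lee_fin.
    rewrite IH// (bigD1 k0)//= (negPf k0q) {1}/kap eqxx.
    rewrite -EFinM mulrA.
    rewrite (eq_bigr (fun k => if k \in k0 :: q then s k else p k (kappa k))); last first.
      by move=> k /negPf kk0; rewrite /kap inE kk0.
    rewrite mulrC EFinM.
    over.
  rewrite nneseriesZl; last by move=> j _; rewrite lee_fin mulr_ge0.
  by rewrite fps -EFinM [in RHS](bigD1 k0)//= mem_head mulrC.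
have := main (enum K) (fun=> 0%N) (enum_uniq K).
under eq_integral => w _ do under eq_bigr => k _ do rewrite /h mem_enum /=.
by under eq_bigr => k _ do rewrite mem_enum /=.
Qed.

End Expectations.

Lemma measure_finite_union d (T : measurableType d) (R : realType)
    (P : {measure set T -> \bar R}) (I : finType) (Q : {pred I}) (F : I -> set T) :
  (forall i, measurable (F i)) -> trivIset setT F ->
  P (\bigcup_(i in [set` Q]) F i) = (\sum_(i in Q) P (F i))%E.
Proof.
move=> mF tF; rewrite measure_fin_bigcup//.
  by rewrite -(@bigfs _ _ _ _ (index_enum I))// ?index_enum_uniq// => i _; rewrite mem_index_enum.
exact: sub_trivIset tF.
Qed.

(** * Absence of links, conditionally on the node positions *)

Section Isolation.
Context (R : realType) d (T : measurableType d) (P : probability T R).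
Variables (N : network R T) (conn : R -> R).
Hypothesis mN : measurable_network N.
Hypothesis linkC : forall i j w, linked N i j w = linked N j i w.
Hypothesis indep : independent_links P N conn.
Hypothesis conn01 : forall x, 0 <= x -> 0 <= conn x <= 1.
Hypothesis conn_noninc : forall x y, 0 <= x -> x <= y -> conn y <= conn x.

Lemma measurable_nb_nodes : measurable_fun setT (nb_nodes N).
Proof. by case: mN. Qed.

Lemma measurable_node i : measurable_fun setT (node N i).
Proof. by case: mN. Qed.

Lemma measurable_node_positions n :
  measurable_fun setT (node_positions N n).
Proof.
apply/measurable_fun_tnthP => i.
rewrite (_ : _ \o _ = node N i); first exact: measurable_node.
by apply/funext => w /=; rewrite tnth_mktuple.
Qed.

Lemma measurable_linked i j b : measurable [set w | linked N i j w = b].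
Proof.
have [_ _ ml] := mN.
by rewrite -[X in measurable X]setTI; exact: (ml i j measurableT [set b]).
Qed.

Lemma dist2_ge0 (x y : plane R) : 0 <= dist2 x y.
Proof. exact: sqrtr_ge0. Qed.

Lemma dist2C (x y : plane R) : dist2 x y = dist2 y x.
Proof.
by rewrite /dist2 /norm2 /= -sqrrN opprB -[X in _ + X]sqrrN opprB.
Qed.

Lemma measurable_conn i j :
  measurable_fun setT (fun w => conn (dist2 (node N i w) (node N j w))).
Proof.
(* [conn] is controlled on nonnegative reals only; [Num.sqrt] sends the negative ones to 0, so the
   composite is non-increasing on the whole line. *)
have mh : measurable_fun setT (fun t : R => conn (Num.sqrt t)).
  apply: nonincreasing_measurable => // s t st.
  by rewrite conn_noninc ?sqrtr_ge0// ler_wsqrtr.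
have mc1 k : measurable_fun setT (fun w => (node N k w).1 : R).
  exact: (measurableT_comp measurable_fst (measurable_node k)).
have mc2 k : measurable_fun setT (fun w => (node N k w).2 : R).
  exact: (measurableT_comp measurable_snd (measurable_node k)).
rewrite /dist2 /norm2 /=.
apply: (measurableT_comp mh).
by apply: measurable_funD; apply: measurable_funX; apply: measurable_funB.
Qed.

Definition positions_event n (B : set (n.-tuple (plane R))) : set T :=
  [set w | nb_nodes N w = n /\ B (node_positions N n w)].

Lemma measurable_positions_event n (B : set (n.-tuple (plane R))) :
  measurable B -> measurable (positions_event B).
Proof.
move=> mB; apply: measurableI.
  rewrite -[X in measurable X]setTI.
  exact: (measurable_nb_nodes measurableT (Y := [set n])).
by rewrite -[X in measurable X]setTI; exact: measurable_node_positions.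
Qed.

Definition no_links n (S : {set 'I_n}) : set T :=
  [set w | forall i j : 'I_n, i \in S -> j != i -> ~~ linked N i j w].

Definition no_links_lik n (S : {set 'I_n}) w : R :=
  \prod_(p : 'I_n * 'I_n | ((p.1 < p.2)%N) && ((p.1 \in S) || (p.2 \in S)))
    (1 - conn (dist2 (node N p.1 w) (node N p.2 w))).

Lemma measurable_no_links_lik n (S : {set 'I_n}) :
  measurable_fun setT (no_links_lik S).
Proof.
rewrite /no_links_lik; under eq_fun do rewrite -big_filter.
apply: measurable_prod => p _; apply: measurable_funB => //.
exact: measurable_conn.
Qed.

Lemma no_links_lik_ge0 n (S : {set 'I_n}) w : 0 <= no_links_lik S w.
Proof.
apply: prodr_ge0 => p _; rewrite subr_ge0.
by have /andP[] := conn01 (dist2_ge0 (node N p.1 w) (node N p.2 w)).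
Qed.

(** [indep] gives the probability of complete graphs, so the event is split over all graphs without
    an edge touching [S]. The sum of their likelihoods factorises over the pairs: a pair touching
    [S] leaves [1 - c], any other one [c + (1 - c) = 1]. *)
Lemma no_links_prob n (S : {set 'I_n}) (B : set (n.-tuple (plane R))) :
  measurable B ->
  P (positions_event B `&` no_links S) =
  (\int[P]_(w in positions_event B) (no_links_lik S w)%:E)%E.
Proof.
move=> mB; set D := positions_event B.
pose lt := [pred p : 'I_n * 'I_n | (p.1 < p.2)%N].
pose Q (p : 'I_n * 'I_n) (b : bool) := ~~ (b && ((p.1 \in S) || (p.2 \in S))).
pose adj (f : {ffun 'I_n * 'I_n -> bool}) : rel 'I_n := fun i j => f (i, j).
pose L f : set T := [set w | forall i j : 'I_n, (i < j)%N -> linked N i j w = adj f i j].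
(* Imposing [false] off the pairs [i < j] makes each graph correspond to a single function. Outside
   [pf] the events [F f] are empty, which keeps the whole family disjoint. *)
pose pf := [pred f in pfamily false lt Q].
pose F (f : {ffun 'I_n * 'I_n -> bool}) : set T := if f \in pf then D `&` L f else set0.
have mD : measurable D by exact: measurable_positions_event.
have mL f : measurable (L f).
  rewrite (_ : L f = \big[setI/setT]_(i : 'I_n) \big[setI/setT]_(j : 'I_n)
     (if (i < j)%N then [set w | linked N i j w = adj f i j] else setT)).
    by apply: bigsetI_measurable => i _; apply: bigsetI_measurable => j _;
      case: ifP => // _; exact: measurable_linked.
  apply/seteqP; split => w /=.
    rewrite -bigcap_seq => H i _; rewrite -bigcap_seq => j _ /=.
    by case: ifP => // ij; exact: H.
  rewrite -bigcap_seq => H i j ij; have /= := H i.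
  rewrite mem_index_enum => /(_ isT); rewrite -bigcap_seq => /(_ j) /=.
  by rewrite mem_index_enum ij => /(_ isT).
have mF f : measurable (F f).
  by rewrite /F; case: ifP => // _; exact: measurableI.
have -> : D `&` no_links S = \bigcup_(f in [set` pf]) F f.
  apply/seteqP; split => w.
    move=> [Dw nl]; pose f := [ffun p : 'I_n * 'I_n => (p.1 < p.2)%N && linked N p.1 p.2 w].
    have fpf : f \in pf.
      apply/pfamilyP; split.
        by apply/supportP => p; rewrite inE ffunE => /negPf ->.
      move=> p; rewrite !inE => p12; rewrite unfold_in /Q /= ffunE p12 /=.
      apply/negP => /andP[lp /orP[p1S|p2S]].
        by have := nl _ p.2 p1S; rewrite lp neq_ltn p12 orbT => /(_ isT).
      by have := nl _ p.1 p2S; rewrite linkC lp neq_ltn p12 => /(_ isT).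
    exists f => //; rewrite /F fpf; split => // i j ij.
    by rewrite /adj ffunE /= ij.
  move=> [f] /=; rewrite /F => fpf; rewrite fpf => -[Dw Lw]; split => // i j iS ji.
  move/pfamilyP : fpf => [_ fQ].
  move: ji; rewrite neq_ltn => /orP[ji|ij].
    have := fQ (j, i); rewrite !inE => /(_ ji); rewrite unfold_in /Q /= iS orbT andbT.
    by rewrite linkC Lw.
  have := fQ (i, j); rewrite !inE => /(_ ij); rewrite unfold_in /Q /= iS andbT.
  by rewrite Lw.
rewrite measure_finite_union//; last first.
  move=> f1 f2 _ _ [w []]; rewrite /F.
  case: ifP => // f1pf [_ L1]; case: ifP => // f2pf [_ L2].
  apply/ffunP => -[i j].
  have [ij|ji] := boolP (i < j)%N.
    by have := L1 _ _ ij; rewrite L2.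
  move/pfamilyP : f1pf => [/supportP s1 _]; move/pfamilyP : f2pf => [/supportP s2 _].
  by rewrite s1 ?s2// inE.
transitivity (\sum_(f in pf) \int[P]_(w in D) (graph_likelihood conn (node_positions N n w) (adj f))%:E)%E.
  by apply: eq_bigr => f fpf; rewrite /F fpf; exact: indep.
rewrite -[LHS]big_filter -ge0_integral_sum//; last 2 first.
- move=> f; apply: (measurable_funS measurableT) => //.
  apply/measurable_EFinP; rewrite /graph_likelihood.
  under eq_fun do rewrite -big_filter.
  apply: measurable_prod => p _.
  have := measurable_conn p.1 p.2; rewrite /node_positions /adj /=.
  under [in X in _ -> X]eq_fun do rewrite !tnth_mktuple.
  by case: (f _) => mc; [exact: mc|exact: measurable_funB].
- move=> f w Dw; rewrite lee_fin; apply: prodr_ge0 => p _.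
  have /andP[c0 c1] := conn01 (dist2_ge0 (tnth (node_positions N n w) p.1) (tnth (node_positions N n w) p.2)).
  by case: (adj f _ _) => //; rewrite subr_ge0.
apply: eq_integral => w _; rewrite sumEFin big_filter; congr EFin.
pose c (p : 'I_n * 'I_n) := conn (dist2 (node N p.1 w) (node N p.2 w)).
transitivity (\sum_(f in pf) \prod_(p : 'I_n * 'I_n | (p.1 < p.2)%N)
   (fun p (b : bool) => if b then c p else 1 - c p) p (f p)).
  apply: eq_bigr => f _; apply: eq_bigr => -[i j] _.
  by rewrite /= /c /adj !tnth_mktuple.
rewrite -(big_distr_big_dep false lt Q (fun p (b : bool) => if b then c p else 1 - c p)).
rewrite /no_links_lik big_mkcondr; apply: eq_bigr => p _.
rewrite [LHS]big_mkcond big_bool /Q /= if_neg; case: ifP => _ /=; first by rewrite add0r.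
by rewrite subrKC.
Qed.

End Isolation.

(** Separates the links leaving [S] from those inside [S]. A pair with one end in [S] may have it in
    either position; symmetry of [F] allows it to be moved to the first one. *)
Lemma prod_touching_pairs (R : comPzRingType) n (S : {set 'I_n})
    (F : 'I_n -> 'I_n -> R) : (forall i j, F i j = F j i) ->
  \prod_(p : 'I_n * 'I_n | (p.1 < p.2)%N && ((p.1 \in S) || (p.2 \in S))) F p.1 p.2 =
  (\prod_(i in S) \prod_(j | j \notin S) F i j) *
  \prod_(p : 'I_n * 'I_n | [&& (p.1 < p.2)%N, p.1 \in S & p.2 \in S]) F p.1 p.2.
Proof.
move=> Fsym; rewrite pair_big /=.
rewrite (bigID (fun p : 'I_n * 'I_n => (p.1 \in S) && (p.2 \in S))) /= mulrC; congr (_ * _).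
  rewrite (bigID (fun p : 'I_n * 'I_n => p.1 \in S)) /=.
  rewrite [RHS](bigID (fun p : 'I_n * 'I_n => (p.1 < p.2)%N)) /=; congr (_ * _).
    by apply: eq_bigl => -[i j] /=; case: (_ < _)%N; case: (i \in S); case: (j \in S).
  have swapI : injective (fun p : 'I_n * 'I_n => (p.2, p.1)).
    by move=> [i j] [i' j'] [-> ->].
  rewrite (reindex_inj swapI) /=.
  apply: eq_big => [[i j]|[i j] _] /=; last exact: Fsym.
  have [->|] := eqVneq i j; first by rewrite ltnn; case: (j \in S).
  rewrite neq_ltn => /orP[] h; rewrite h; rewrite ltnNge (ltnW h) /=;
    by case: (i \in S); case: (j \in S).
by apply: eq_bigl => -[i j] /=; case: (_ < _)%N; case: (i \in S); case: (j \in S).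
Qed.

(** * Poisson counts and alone cells: probability bounds and moments *)

Lemma poisson_generating (R : realType) (mu t : R) : 0 <= mu -> 0 <= t ->
  (\sum_(j <oo) (t ^+ j * (mu ^+ j / j`!%:R * expR (- mu)))%:E
    = (expR (- (mu * (1 - t))))%:E)%E.
Proof.
move=> mu0 t0.
have mt0 : 0 <= t * mu by exact: mulr_ge0.
transitivity (\sum_(j <oo) ((expR (- mu))%:E * ((t * mu) ^+ j / j`!%:R)%:E))%E.
  apply: eq_eseriesr => j _; rewrite -EFinM; congr EFin.
  by rewrite exprMn; ring.
rewrite nneseriesZl; last by move=> j _; rewrite lee_fin divr_ge0// exprn_ge0.
rewrite mulrBr mulr1 opprB expRD [RHS]EFinM muleC [mu * t]mulrC; congr (_ * _)%E.
rewrite expRE -EFin_lim; last first.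
  rewrite /pseries/=; under eq_fun do rewrite mulrC.
  exact: is_cvg_series_exp_coeff.
apply/congr_lim/funext => n/=; rewrite /pseries/= /series/= -sumEFin//.
by under eq_bigr do rewrite mulrC.
Qed.

Section Cells.
Context (R : realType) d (T : measurableType d) (P : probability T R).
Variables (N : network R T) (conn : R -> R) (rho : R).
Hypothesis mN : measurable_network N.
Hypothesis linkC : forall i j w, linked N i j w = linked N j i w.
Hypothesis poisson : poisson_process P N rho.
Hypothesis indep : independent_links P N conn.
Hypothesis conn01 : forall x, 0 <= x -> 0 <= conn x <= 1.
Hypothesis conn_noninc : forall x y, 0 <= x -> x <= y -> conn y <= conn x.

Variables (K : finType) (Q : K -> set (plane R)) (mu : R).
Hypothesis mQ : forall k, measurable (Q k).
Hypothesis tQ : trivIset setT Q.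
Hypothesis Qsub : forall k, Q k `<=` unit_square.
Hypothesis Qcov : forall z, unit_square z -> exists k, Q k z.
Hypothesis Qmu : forall k, rho * fine (leb2 (Q k)) = mu.
Hypothesis mu_ge0 : 0 <= mu.

Let count k w := node_count N (Q k) w.

Lemma measurable_eq_nb_nodes n : measurable [set w | nb_nodes N w = n].
Proof.
rewrite -[X in measurable X]setTI.
exact: (measurable_nb_nodes mN measurableT (Y := [set n])).
Qed.

Lemma measurable_lt_nb_nodes i : measurable [set w | (i < nb_nodes N w)%N].
Proof.
rewrite -[X in measurable X]setTI.
exact: (measurable_nb_nodes mN measurableT (Y := [set n | (i < n)%N])).
Qed.

Lemma measurable_in_cell i k : measurable [set w | Q k (node N i w)].
Proof.
by rewrite -[X in measurable X]setTI; exact: (measurable_node mN).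
Qed.

(** The count is a sum with a random number of terms; on each event [nb_nodes N w = n] it becomes a
    sum of fixed length, treated by induction. *)
Lemma measurable_eq_count k j : measurable [set w | count k w = j].
Proof.
pose S n w := (\sum_(i < n) (node N i w \in Q k))%N.
have mS n : forall m, measurable [set w | S n w = m].
  elim: n => [|n IH] m.
    have [->|m0] := eqVneq m 0%N.
      by rewrite (_ : mkset _ = setT)//; apply/seteqP; split => w //= _; rewrite /S big_ord0.
    rewrite (_ : mkset _ = set0)//; apply/seteqP; split => w //=.
    by rewrite /S big_ord0 => /eqP; rewrite eq_sym (negPf m0).
  pose A := [set w | Q k (node N n w)].
  rewrite (_ : mkset _ = ([set w | S n w = m] `&` ~` A) `|`
      (if m is m'.+1 then [set w | S n w = m'] `&` A else set0)).
    have mA : measurable A by exact: measurable_in_cell.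
    apply: measurableU; first by apply: measurableI => //; exact: measurableC.
    by case: m => [//|m]; exact: measurableI.
  apply/seteqP; split => w /=; rewrite /S big_ord_recr /=.
    have [Aw|Aw] := pselect (A w).
      by rewrite mem_set// addn1 => <-; right.
    by rewrite memNset// addn0 => <-; left.
  case=> [[<- Aw]|]; first by rewrite memNset// addn0.
  by case: m => [//|m] [<- Aw]; rewrite mem_set// addn1.
rewrite (_ : mkset _ = \bigcup_n ([set w | nb_nodes N w = n] `&` [set w | S n w = j])).
  apply: bigcup_measurable => n _; apply: measurableI => //.
  exact: measurable_eq_nb_nodes.
apply/seteqP; split => w /=.
  by move=> h; exists (nb_nodes N w).
by move=> [n _ [<- h]].
Qed.

Lemma measurable_count k : measurable_fun setT (count k).
Proof.
move=> _ Y _; rewrite setTI.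
rewrite (_ : _ @^-1` Y = \bigcup_(j in Y) [set w | count k w = j]).
  by apply: bigcup_measurable => j _; exact: measurable_eq_count.
apply/seteqP; split => w /=; first by move=> Yw; exists (count k w).
by move=> [j Yj ->].
Qed.

Lemma measurable_isolated i : measurable [set w | isolated N w i].
Proof.
rewrite (_ : mkset _ = [set w | (i < nb_nodes N w)%N] `&`
   \bigcap_j (if j == i then setT else ~` [set w | (j < nb_nodes N w)%N] `|`
                                [set w | linked N i j w = false])).
  apply: measurableI; first exact: measurable_lt_nb_nodes.
  apply: bigcapT_measurable => j; case: eqP => // _; apply: measurableU.
    by apply: measurableC; exact: measurable_lt_nb_nodes.
  exact: measurable_linked.
apply/seteqP; split => w /= [iN H]; split => //.
  move=> j _ /=; case: eqVneq => // ji.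
  have [jN|jN] := boolP (j < nb_nodes N w)%N; last by left; exact/negP.
  by right; apply/negbTE; exact: H.
move=> j jN ji; have := H j I; rewrite (negPf ji) => -[|->//].
by move=> /(_ jN).
Qed.

Lemma measurable_has_isolated_node : measurable (has_isolated_node N).
Proof.
rewrite (_ : has_isolated_node N = \bigcup_i [set w | isolated N w i]).
  by apply: bigcup_measurable => i _; exact: measurable_isolated.
by apply/seteqP; split => w [i]; [exists i|move=> _; exists i].
Qed.

Definition alone k : set T :=
  [set w | count k w = 1%N /\ exists i, isolated N w i /\ Q k (node N i w)].

Lemma measurable_alone k : measurable (alone k).
Proof.
rewrite (_ : alone k = [set w | count k w = 1%N] `&`
    \bigcup_i ([set w | isolated N w i] `&` [set w | Q k (node N i w)])).
  apply: measurableI; first exact: measurable_eq_count.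
  apply: bigcup_measurable => i _; apply: measurableI.
    exact: measurable_isolated.
  exact: measurable_in_cell.
apply/seteqP; split => w [c1]; first by move=> [i iw]; split => //; exists i.
by move=> [i _ iw]; split => //; exists i.
Qed.

Definition all_alone (S : {set K}) : set T := \bigcap_(k in [set` S]) alone k.

Lemma measurable_all_alone S : measurable (all_alone S).
Proof.
apply: fin_bigcap_measurable => // k _; exact: measurable_alone.
Qed.

Section Pattern.
Variables (n : nat) (s : {ffun 'I_n -> K}).

Let B : set (n.-tuple (plane R)) := [set x | forall i, Q (s i) (tnth x i)].

Lemma measurable_pattern : measurable B.
Proof.
rewrite (_ : B = \big[setI/setT]_(i : 'I_n) ((@tnth n (plane R) ^~ i) @^-1` (Q (s i)))).
  apply: bigsetI_measurable => i _; rewrite -[X in measurable X]setTI.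
  exact: measurable_tnth.
apply/seteqP; split => x /=; rewrite -bigcap_seq.
  by move=> H i _; exact: H.
by move=> H i; apply: H; rewrite /= mem_index_enum.
Qed.

(** Over all [n] and [s] these events partition the outcomes. On each of them the counts are
    constant, and being alone either is impossible or reduces to [no_links] for fixed indices, whose
    probability [no_links_prob] computes. Bounds on probabilities are thus proved pattern by
    pattern. *)
Definition pattern : set T := positions_event N B.

Lemma patternE w : pattern w <-> nb_nodes N w = n /\ forall i : 'I_n, Q (s i) (node N i w).
Proof.
rewrite /pattern /positions_event /B /=; split => -[-> H]; split => // i; have := H i;
  by rewrite tnth_mktuple.
Qed.

Lemma measurable_pattern_event : measurable pattern.
Proof. exact: measurable_positions_event measurable_pattern. Qed.

Lemma count_pattern k w : pattern w -> count k w = #|[set i | s i == k]%SET|.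
Proof.
move=> /patternE[nE H]; rewrite /count /node_count nE -sum1_card [RHS]big_mkcond /=.
apply: eq_bigr => i _; rewrite inE.
have [<-|sk] := eqVneq (s i) k; first by rewrite mem_set//; exact: H.
rewrite memNset// => Qk; move/eqP: sk; apply; apply: tQ => //.
by exists (node N i w); split => //; exact: H.
Qed.

Lemma all_alone_pattern (S : {set K}) :
  (forall k, k \in S -> #|[set i | s i == k]%SET| = 1%N) ->
  pattern `&` all_alone S = pattern `&` no_links N [set i | s i \in S]%SET.
Proof.
move=> S1; apply/seteqP; split => w [pw H]; split => //; have /patternE [nE Qw] := pw.
  move=> i j; rewrite inE => iS ji.
  have [_ [i' [[i'n iso] Qi']]] := H _ iS.
  rewrite nE in i'n iso.
  have iE : i = Ordinal i'n.
    have /eqP/cards1P[x sx] := S1 _ iS.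
    have : i \in [set x]%SET by rewrite -sx inE.
    have : Ordinal i'n \in [set x]%SET.
      rewrite -sx inE; apply/eqP; apply: tQ => //; exists (node N i' w).
      by split => //; exact: Qw (Ordinal i'n).
    by rewrite !inE => /eqP -> /eqP.
  by rewrite iE; apply: iso => //; move: ji; rewrite iE.
move=> k kS; split; first by rewrite count_pattern// S1.
have /eqP/cards1P[i si] := S1 _ kS.
have sik : s i = k.
  by have := set11 i; rewrite -si inE => /eqP.
exists i; split; last by rewrite -sik; exact: Qw.
split; first by rewrite nE.
move=> j; rewrite nE => jn ji; apply: (H i (Ordinal jn)) => //.
by rewrite inE sik.
Qed.

Lemma all_alone_pattern0 (S : {set K}) k :
  k \in S -> #|[set i | s i == k]%SET| != 1%N -> pattern `&` all_alone S = set0.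
Proof.
move=> kS /eqP sk; apply/seteqP; split => w // -[pw /(_ _ kS)[c _]]; apply: sk.
by rewrite -c count_pattern.
Qed.

End Pattern.

Lemma integral_pattern_le (f1 f2 : T -> \bar R) :
  measurable_fun setT f1 -> measurable_fun setT f2 ->
  (forall w, 0 <= f1 w)%E -> (forall w, 0 <= f2 w)%E ->
  (forall n (s : {ffun 'I_n -> K}),
    \int[P]_(w in pattern s) f1 w <= \int[P]_(w in pattern s) f2 w)%E ->
  (\int[P]_w f1 w <= \int[P]_w f2 w)%E.
Proof.
move=> mf1 mf2 f10 f20 H.
pose F (u : {n : nat & {ffun 'I_n -> K}}) := pattern (tagged u).
apply: (@integral_partition_le _ _ _ _ _ F) => //.
- by move=> u; exact: measurable_pattern_event.
- move=> [n s] [n' s'] _ _ [w [/patternE[/= nE Qs] /patternE[/= nE' Qs']]].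
  move: nE' s' Qs'; rewrite nE => <- s' Qs'; congr existT.
  by apply/ffunP => i; apply: tQ => //; exists (node N i w).
- move=> w; have [inN _ _] := poisson.
  have /choice[f fP] : forall i : 'I_(nb_nodes N w), exists k, Q k (node N i w).
    by move=> i; apply: Qcov; exact: inN.
  exists (existT _ (nb_nodes N w) [ffun i => f i]); apply/patternE => /=; split => // i.
  by rewrite ffunE.
- by move=> [n s]; exact: H.
Qed.

Lemma poisson_counts (kappa : K -> nat) :
  P [set w | forall k, count k w = kappa k] =
  (\prod_k (mu ^+ kappa k / (kappa k)`!%:R * expR (- mu)))%:E.
Proof.
have [_ law ind] := poisson.
have := ind #|K| (fun i => Q (enum_val i)) (fun i => kappa (enum_val i)).
move=> /(_ (fun i => mQ (enum_val i)) (fun i => @Qsub (enum_val i))) H.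
transitivity (P [set w | forall i : 'I_#|K|, node_count N (Q (enum_val i)) w = kappa (enum_val i)]).
  congr (P _); apply/seteqP; split => w /= h; first by move=> i; exact: h.
  by move=> k; have := h (enum_rank k); rewrite enum_rankK.
rewrite H; last by apply/trivIsetP => i j _ _ ij; move/trivIsetP : tQ; apply => //;
  apply: contra_neq ij; exact: enum_val_inj.
rewrite -prodEFin.
rewrite [RHS](reindex (@enum_val K K)) /=; last first.
  by apply: onW_bij; exists enum_rank => x; rewrite (enum_valK, enum_rankK).
by apply: eq_bigr => i _; rewrite law// Qmu.
Qed.

Lemma integral_prod_counts (f : K -> nat -> R) (t : K -> R) :
  (forall k j, 0 <= f k j) ->
  (forall k, \sum_(j <oo) (f k j * (mu ^+ j / j`!%:R * expR (- mu)))%:E = (t k)%:E)%E ->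
  (\int[P]_w (\prod_k f k (count k w))%:E = (\prod_k t k)%:E)%E.
Proof.
move=> f0 ft; apply: (integral_prod_independent (p := fun _ j => mu ^+ j / j`!%:R * expR (- mu))) => //.
- by move=> k; exact: measurable_count.
- by move=> _ j; rewrite mulr_ge0 ?expR_ge0// divr_ge0// exprn_ge0.
- exact: poisson_counts.
Qed.

(** Factor contributed by a cell holding [j] nodes: a cell of [S] must hold exactly one, and
    elsewhere each node pays [t k] for having no link to the nodes of [S]. The upper and the lower
    bound both integrate this product, with different [t]. *)
Let weight (S : {set K}) (t : K -> R) k j : R :=
  if k \in S then (j == 1%N)%:R else t k ^+ j.

Lemma integral_weight (S : {set K}) (t : K -> R) : (forall k, 0 <= t k) ->
  (\int[P]_w (\prod_k weight S t k (count k w))%:E =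
   ((mu * expR (- mu)) ^+ #|S| * \prod_(k | k \notin S) expR (- (mu * (1 - t k))))%:E)%E.
Proof.
move=> t0.
rewrite (integral_prod_counts (t := fun k => if k \in S then mu * expR (- mu) else expR (- (mu * (1 - t k))))).
- by congr EFin; rewrite (bigID (mem S)) /=; congr (_ * _);
    [rewrite -prodr_const; apply: eq_bigr => k ->|apply: eq_bigr => k /negPf ->].
- by move=> k j; rewrite /weight; case: ifP => // _; exact: exprn_ge0.
- move=> k; rewrite /weight; case: ifP => kS; last exact: poisson_generating.
  rewrite (@eseries_single _ 1%N).
  + by rewrite eqxx mul1r expr1 factS fact0 muln1 invr1 mulr1.
  + by rewrite lee_fin eqxx mul1r mulr_ge0 ?expR_ge0// divr_ge0// exprn_ge0.
  + by move=> j /negPf ->; rewrite mul0r.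
Qed.

Lemma weight_pattern n (s : {ffun 'I_n -> K}) (S : {set K}) t w :
  (forall k, k \in S -> #|[set i | s i == k]%SET| = 1%N) -> pattern s w ->
  \prod_k weight S t k (count k w) = \prod_(i | s i \notin S) t (s i).
Proof.
move=> S1 sw; rewrite (bigID (mem S)) /= big1 ?mul1r; last first.
  by move=> k kS; rewrite /weight kS (count_pattern _ sw) S1.
rewrite [RHS](partition_big s (fun k => k \notin S)) //=.
apply: eq_bigr => k kS; rewrite /weight (negPf kS) (count_pattern _ sw).
rewrite -prodr_const; apply: eq_big => [i|i].
  by rewrite inE; case: eqP => [->|]; rewrite ?kS ?andbF.
by rewrite inE => /eqP ->.
Qed.

(* Given the counts, a node of a cell [l] outside [S] is linked to none of the
   nodes of [S] with probability at most [t l]; the Poisson generating function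
   then integrates [t l ^ count l] out. Links inside [S] are just dropped. *)
Lemma all_alone_le (S : {set K}) (gl : K -> K -> R) :
  (forall k l, 0 <= gl k l <= 1) ->
  (forall k l x y, Q k x -> Q l y -> gl k l <= conn (dist2 x y)) ->
  (P (all_alone S) <= ((mu * expR (- mu)) ^+ #|S| *
    \prod_(l | l \notin S) expR (- (mu * (1 - \prod_(k in S) (1 - gl k l)))))%:E)%E.
Proof.
move=> gl01 glE; pose t l := \prod_(k in S) (1 - gl k l).
have glB k l : 0 <= 1 - gl k l by rewrite subr_ge0; have /andP[] := gl01 k l.
have t0 l : 0 <= t l by apply: prodr_ge0 => k _.
rewrite -(integral_weight S t0) -[all_alone S]setIT -integral_indic//; last first.
  exact: measurable_all_alone.
have mw : measurable_fun setT (fun w => (\prod_k weight S t k (count k w))%:E).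
  apply/measurable_EFinP; apply: measurable_prod => k _.
  by apply/measurable_EFinP/measurable_nat_comp; exact: measurable_count.
have w0 k j : 0 <= weight S t k j by rewrite /weight; case: ifP => // _; exact: exprn_ge0.
apply: integral_pattern_le => //.
- by apply/measurable_EFinP; apply: measurable_indic; exact: measurable_all_alone.
- by move=> w; rewrite lee_fin prodr_ge0.
move=> n s; have mp := measurable_pattern_event s.
rewrite integral_indic//; last exact: measurable_all_alone.
have [/forall_inP S1|] := boolP [forall k in S, #|[set i | s i == k]%SET| == 1%N]; last first.
  rewrite negb_forall_in => /exists_inP[k kS sk].
  rewrite setIC (all_alone_pattern0 kS sk) measure0.
  by apply: integral_ge0 => w _; rewrite lee_fin prodr_ge0.
rewrite setIC all_alone_pattern; last by move=> k /S1/eqP.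
rewrite [leLHS](no_links_prob mN linkC indep conn01 conn_noninc); last exact: measurable_pattern.
apply: ge0_le_integral => //.
- by move=> w _; rewrite lee_fin no_links_lik_ge0.
- by apply: (measurable_funS measurableT) => //; apply/measurable_EFinP; exact: measurable_no_links_lik.
- exact: (measurable_funS measurableT).
move=> w sw; rewrite lee_fin (weight_pattern _ _ sw); last by move=> k /S1/eqP.
have /patternE[nE Qs] := sw.
rewrite /no_links_lik (prod_touching_pairs _ (F := fun i j => 1 - conn (dist2 (node N i w) (node N j w)))); last first.
  by move=> i j; rewrite dist2C.
have c01 i j : 0 <= 1 - conn (dist2 (node N i w) (node N j w)) <= 1.
  have := conn01 (dist2_ge0 (node N i w) (node N j w)).
  by rewrite subr_ge0 lerBlDr lerDl andbC.
rewrite -[leRHS]mulr1; apply: ler_pM.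
- by apply: prodr_ge0 => i _; apply: prodr_ge0 => j _; have /andP[] := c01 i j.
- by apply: prodr_ge0 => p _; have /andP[] := c01 p.1 p.2.
- rewrite exchange_big /=; rewrite [leRHS](eq_bigl (fun j => j \notin [set i | s i \in S]%SET)); last by move=> j; rewrite inE.
  apply: ler_prod => j jS; apply/andP; split.
    by apply: prodr_ge0 => i _; have /andP[] := c01 i j.
  rewrite /t (partition_big s (mem S))/=; last by move=> i; rewrite inE.
  apply: ler_prod => k kS; apply/andP; split.
    by apply: prodr_ge0 => i _; have /andP[] := c01 i j.
  have /cards1P[i si] := S1 _ kS.
  have ik : s i = k by have := set11 i; rewrite -si inE => /eqP.
  rewrite (big_pred1 i); last first.
    move=> i' /=; have <- : (i' \in [set i]%SET) = (i' == i) by rewrite inE.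
    rewrite -si !inE.
    by case: eqP => [->|]; rewrite ?kS ?andbF.
  by rewrite lerD2l lerN2 glE// -ik; exact: Qs.
- by apply: prodr_ile1 => p _; exact: c01.
Qed.

(** Counterpart of [all_alone_le] for one cell. A cell with a single node has no internal link, so
    nothing is dropped, and every other node misses it with probability at least [1 - gu k l]. *)
Lemma alone_ge (k : K) (gu : K -> K -> R) :
  (forall l, 0 <= gu k l <= 1) ->
  (forall l x y, Q k x -> Q l y -> conn (dist2 x y) <= gu k l) ->
  ((mu * expR (- mu) * \prod_(l | l != k) expR (- (mu * gu k l)))%:E <= P (alone k))%E.
Proof.
move=> gu01 guE; pose S := [set k]%SET; pose t l := 1 - gu k l.
have t0 l : 0 <= t l by rewrite subr_ge0; have /andP[] := gu01 l.
have -> : alone k = all_alone S.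
  apply/seteqP; split => w; first by move=> kw l /=; rewrite inE => /eqP ->.
  by move=> /(_ k); apply => /=; rewrite inE.
have := integral_weight S t0; rewrite cards1 expr1.
rewrite (eq_bigr (fun l => expR (- (mu * gu k l)))); last by move=> l _; rewrite /t subKr.
under eq_bigl do rewrite inE.
move=> <-; rewrite -[all_alone S]setIT -integral_indic//; last first.
  exact: measurable_all_alone.
have mw : measurable_fun setT (fun w => (\prod_k weight S t k (count k w))%:E).
  apply/measurable_EFinP; apply: measurable_prod => l _.
  by apply/measurable_EFinP/measurable_nat_comp; exact: measurable_count.
have w0 l j : 0 <= weight S t l j by rewrite /weight; case: ifP => // _; exact: exprn_ge0.
apply: integral_pattern_le => //.
- by apply/measurable_EFinP; apply: measurable_indic; exact: measurable_all_alone.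
- by move=> w; rewrite lee_fin prodr_ge0.
move=> n s; have mp := measurable_pattern_event s.
rewrite integral_indic//; last exact: measurable_all_alone.
have [sk|sk] := boolP (#|[set i | s i == k]%SET| == 1%N); last first.
  rewrite (eq_integral (fun=> 0%E)) ?integral0// => w; rewrite inE => sw.
  rewrite (bigD1 k)//= /weight inE eqxx (count_pattern _ sw).
  by rewrite (negPf sk) mul0r.
have S1 l : l \in S -> #|[set i | s i == l]%SET| = 1%N by rewrite inE => /eqP ->; exact/eqP.
rewrite setIC all_alone_pattern//.
rewrite [leRHS](no_links_prob mN linkC indep conn01 conn_noninc); last exact: measurable_pattern.
apply: ge0_le_integral => //.
- by move=> w _; rewrite lee_fin prodr_ge0.
- exact: (measurable_funS measurableT).
- by apply: (measurable_funS measurableT) => //; apply/measurable_EFinP; exact: measurable_no_links_lik.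
move=> w sw; rewrite lee_fin (weight_pattern _ _ sw)//.
have /patternE[nE Qs] := sw.
have /cards1P[i si] := sk.
have ik : s i = k by have := set11 i; rewrite -si inE => /eqP.
have -> : [set i | s i \in S]%SET = [set i]%SET by rewrite -si; apply/setP => j; rewrite !inE.
rewrite /no_links_lik (prod_touching_pairs _ (F := fun i j => 1 - conn (dist2 (node N i w) (node N j w)))); last first.
  by move=> i' j; rewrite dist2C.
rewrite big_set1 [X in _ <= _ * X]big1 ?mulr1; last first.
  by move=> p; rewrite !inE => /and3P[p12 /eqP p1i /eqP p2i]; move: p12; rewrite p1i p2i ltnn.
rewrite [leLHS](eq_bigl (fun j => j \notin [set i]%SET)); last first.
  by move=> j; rewrite -si !inE.
apply: ler_prod => j jk; rewrite t0 /t lerD2l lerN2 guE// -?ik; exact: Qs.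
Qed.

Lemma has_isolated_node_sub :
  has_isolated_node N `<=` \big[setU/set0]_k (~` ([set w | count k w = 0%N] `|` [set w | count k w = 1%N]) `|` alone k).
Proof.
move=> w [i iw]; have [inN _ _] := poisson; have [iN _] := iw.
have [k Qki] := Qcov (inN _ _ iN).
rewrite -bigcup_seq; exists k; first by rewrite /= mem_index_enum.
have [c1|c1] := pselect (count k w = 1%N); first by right; split => //; exists i.
left => -[/=|//]; rewrite /count /node_count (bigD1 (Ordinal iN))//= mem_set//.
Qed.

Lemma prob_two_nodes k :
  (P (~` ([set w | count k w = 0%N] `|` [set w | count k w = 1%N])) <= (mu ^+ 2)%:E)%E.
Proof.
have [_ law _] := poisson.
have m j := measurable_eq_count k j.
rewrite probability_setC; last exact: measurableU.
have -> : (P ([set w | count k w = 0%N] `|` [set w | count k w = 1%N]) =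
    P [set w | count k w = 0%N] + P [set w | count k w = 1%N])%E.
  by apply: measureU => //; apply/seteqP; split => w // -[/= ->].
rewrite !law// Qmu expr0 expr1 fact0 (factS 0) fact0 muln1 invr1 !mul1r mulr1.
rewrite -EFinD lee_fin.
(* Whence [1 - (1 + mu) * expR (- mu) <= 1 - (1 + mu) * (1 - mu) = mu ^+ 2]. *)
have h : 0 <= expR (- mu) - (1 - mu) by rewrite subr_ge0; exact: expR_ge1Dx.
have := mulr_ge0 (addr_ge0 (@ler01 R) mu_ge0) h; nra.
Qed.

Lemma has_isolated_node_le (gl : K -> K -> R) :
  (forall k l, 0 <= gl k l <= 1) ->
  (forall k l x y, Q k x -> Q l y -> gl k l <= conn (dist2 x y)) ->
  (P (has_isolated_node N) <= (\sum_k (mu ^+ 2 +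
    mu * expR (- \sum_(l | l != k) (mu * gl k l))))%:E)%E.
Proof.
move=> gl01 glE.
have m k : measurable (~` ([set w | count k w = 0%N] `|` [set w | count k w = 1%N])).
  by apply: measurableC; apply: measurableU; exact: measurable_eq_count.
have mF k := measurableU _ _ (m k) (measurable_alone k).
apply: (@le_trans _ _ (\sum_k P (~` ([set w | count k w = 0%N] `|` [set w | count k w = 1%N]) `|` alone k))%E).
  apply: (@le_trans _ _ (P (\big[setU/set0]_k (~` ([set w | count k w = 0%N] `|` [set w | count k w = 1%N]) `|` alone k)))).
    apply: le_measure; rewrite ?inE.
    - exact: measurable_has_isolated_node.
    - exact: bigsetU_measurable.
    - exact: has_isolated_node_sub.
  elim: (index_enum K) => [|k q IH]; first by rewrite !big_nil measure0.
  rewrite !big_cons; apply: le_trans (leeD2l _ IH).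
  by apply: measureU2 => //; exact: bigsetU_measurable.
rewrite -sumEFin; apply: lee_sum => k _.
apply: le_trans (measureU2 _ _ _) _ => //; first exact: measurable_alone.
rewrite EFinD; apply: leeD; first exact: prob_two_nodes.
have -> : alone k = all_alone [set k]%SET.
  apply/seteqP; split => w; first by move=> kw l /=; rewrite inE => /eqP ->.
  by move=> /(_ k); apply => /=; rewrite inE.
apply: le_trans (all_alone_le _ gl01 glE) _; rewrite lee_fin cards1 expr1.
rewrite -sumrN expR_sum; apply: ler_pM.
- by rewrite mulr_ge0// expR_ge0.
- by apply: prodr_ge0 => i _; exact: expR_ge0.
- by rewrite -[leRHS]mulr1; apply: ler_wpM2l => //; rewrite expR_le1 oppr_le0.
rewrite le_eqVlt; apply/orP; left; apply/eqP; apply: eq_big => [l|l _]; first by rewrite inE.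
by rewrite big_set1 subKr.
Qed.

Lemma alone_sub_has_isolated_node k : alone k `<=` has_isolated_node N.
Proof. by move=> w [_ [i [iw _]]]; exists i. Qed.

Lemma no_isolated_node_second_moment (J : {set K}) (M : R) :
  0 < M -> M = \sum_(k in J) fine (P (alone k)) ->
  (P (~` has_isolated_node N) <=
    ((\sum_(k in J) \sum_(l in J) fine (P (alone k `&` alone l))) / M ^+ 2 - 1)%:E)%E.
Proof.
move=> M0 ME; have mH := measurableC measurable_has_isolated_node.
have mA k := measurable_alone k.
have mAA k l := measurableI _ _ (mA k) (mA l).
pose Z w : R := \sum_(k in J) \1_(alone k) w.
have Z0 w : 0 <= Z w by apply: sumr_ge0.
have intZ : (\int[P]_w (Z w)%:E = M%:E)%E.
  under eq_integral do rewrite -sumEFin -big_filter.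
  rewrite ge0_integral_sum//; last by move=> k; apply/measurable_EFinP; exact: measurable_indic.
  rewrite big_filter ME -sumEFin; apply: eq_bigr => k _.
  by rewrite integral_indic// setIT fineK// fin_num_measure.
have mZ : measurable_fun setT Z.
  rewrite /Z; under eq_fun do rewrite -big_filter.
  by apply: measurable_sum => k; exact: measurable_indic.
have intZ2 : (\int[P]_w ((Z w) ^+ 2)%:E =
    (\sum_(k in J) \sum_(l in J) fine (P (alone k `&` alone l)))%:E)%E.
  transitivity (\int[P]_w (\sum_(k in J) \sum_(l in J) (\1_(alone k `&` alone l) w : R)%:E))%E.
    apply: eq_integral => w _; rewrite expr2 /Z mulr_suml -sumEFin.
    apply: eq_bigr => k _; rewrite mulr_sumr -sumEFin.
    by apply: eq_bigr => l _; rewrite indicI.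
  under eq_integral do rewrite -big_filter.
  rewrite ge0_integral_sum//; last 2 first.
  - move=> k; under eq_fun do rewrite -big_filter.
    by apply: emeasurable_sum => l; apply/measurable_EFinP; exact: measurable_indic.
  - by move=> k w _; apply: sume_ge0.
  rewrite big_filter -sumEFin; apply: eq_bigr => k _.
  under eq_integral do rewrite -big_filter.
  rewrite ge0_integral_sum//; last by move=> l; apply/measurable_EFinP; exact: measurable_indic.
  rewrite big_filter -sumEFin; apply: eq_bigr => l _.
  by rewrite integral_indic// setIT fineK// fin_num_measure.
(* The integral of the pointwise bound [1_(Z = 0) + 2 Z / M <= 1 + (Z / M)^2]. *)
have : (P (~` has_isolated_node N) + (2 / M)%:E * M%:E <=
    1 + (M ^- 2)%:E * (\sum_(k in J) \sum_(l in J) fine (P (alone k `&` alone l)))%:E)%E.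
  rewrite -intZ -intZ2 -[~` _]setIT -integral_indic//.
  rewrite -(ge0_integralZl P measurableT (f := fun w => (Z w)%:E))//; last 3 first.
  - exact/measurable_EFinP.
  - by move=> w _; rewrite lee_fin.
  - by rewrite lee_fin divr_ge0// ltW.
  rewrite -(ge0_integralZl P measurableT (f := fun w => (Z w ^+ 2)%:E))//; last 3 first.
  - by apply/measurable_EFinP; exact: measurable_funX.
  - by move=> w _; rewrite lee_fin sqr_ge0.
  - by rewrite lee_fin invr_ge0 exprn_ge0// ltW.
  rewrite -[X in (_ <= X + _)%E](@probability_setT _ _ _ P) -[X in (_ <= P X + _)%E]setIT -integral_indic//.
  have M20 : 0 <= M ^- 2 by rewrite invr_ge0 exprn_ge0// ltW.
  have M0' : 0 <= 2 / M by rewrite divr_ge0// ltW.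
  have mind (A : set T) : measurable A -> measurable_fun setT (fun w => (\1_A w : R)%:E).
    by move=> mA'; apply/measurable_EFinP; exact: measurable_indic.
  have mZ' : measurable_fun setT (fun w => ((2 / M)%:E * (Z w)%:E)%E).
    by apply: measurable_funeM; exact/measurable_EFinP.
  have mZ2 : measurable_fun setT (fun w => ((M ^- 2)%:E * (Z w ^+ 2)%:E)%E).
    by apply: measurable_funeM; apply/measurable_EFinP; exact: measurable_funX.
  have Z0' w : [set: T] w -> (0 <= (2 / M)%:E * (Z w)%:E)%E.
    by move=> _; rewrite mule_ge0// lee_fin.
  have Z20 w : [set: T] w -> (0 <= (M ^- 2)%:E * (Z w ^+ 2)%:E)%E.
    by move=> _; rewrite mule_ge0// lee_fin sqr_ge0.
  rewrite -!ge0_integralD//; [|exact: mind..].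
  apply: ge0_le_integral => //.
  - by move=> w wT; apply: adde_ge0; [rewrite lee_fin|exact: Z0'].
  - by apply: emeasurable_funD => //; exact: mind.
  - by apply: emeasurable_funD => //; exact: mind.
  move=> w _; rewrite -!EFinM -!EFinD lee_fin indicT indicE.
  have [wI|wI] := boolP (w \in ~` has_isolated_node N).
    suff -> : Z w = 0 by rewrite expr0n /= !mulr0 !addr0.
    rewrite /Z big1// => k _; rewrite indicE memNset// => kw.
    by move: wI; rewrite inE; apply; exact: alone_sub_has_isolated_node kw.
  rewrite add0r -[X in _ <= X + _]/1 mulrAC.
  rewrite -subr_ge0 (_ : _ - _ = (1 - Z w / M) ^+ 2) ?sqr_ge0//.
  by field; rewrite gt_eqF.
have pfin : (P (~` has_isolated_node N) \is a fin_num)%E by exact: fin_num_measure.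
rewrite -(fineK pfin) -!EFinM divfK ?gt_eqF// -!EFinD !lee_fin mulrC.
by rewrite lerBrDr; lra.
Qed.

End Cells.

(** * Sums along a row of cells *)

(** The distance [|i - j|]: at least one of the two truncated differences is 0. *)
Definition dn (i j : nat) : nat := (i - j) + (j - i).

Section LineSums.
Context {R : realType}.
Implicit Types F : nat -> R.

Lemma sum_dn F (k m : nat) : (k < m)%N ->
  \sum_(i < m) F (dn k i) = \sum_(i < k) F i.+1 + \sum_(i < m - k) F i.
Proof.
move=> km; rewrite -(big_mkord xpredT (fun i => F (dn k i))).
rewrite (@big_cat_nat _ _ _ k)//= ?(ltnW km)//; congr (_ + _).
  rewrite big_nat_rev /= big_mkord; apply: eq_bigr => i _; congr F.
  by rewrite /dn add0n; have := ltn_ord i; lia.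
rewrite -{1}[k]add0n big_addn big_mkord; apply: eq_bigr => i _; congr F.
by rewrite /dn; lia.
Qed.

Lemma sum_ord_widen F (n n' : nat) : (n <= n')%N -> (forall i, 0 <= F i) ->
  \sum_(i < n) F i <= \sum_(i < n') F i.
Proof.
move=> nn F0; rewrite -!(big_mkord xpredT F) (@big_cat_nat _ _ _ n 0 n')//=.
by rewrite lerDl; apply: sumr_ge0.
Qed.

Lemma sum_dn_le F (k m : nat) : (k < m)%N -> (forall i, 0 <= F i) ->
  \sum_(i < m) F (dn k i) <= 2 * \sum_(i < m) F i.
Proof.
move=> km F0; rewrite sum_dn// mulrDl mul1r lerD//; last first.
  by apply: sum_ord_widen => //; exact: leq_subr.
apply: (@le_trans _ _ (\sum_(i < k.+1) F i)).
  by rewrite big_ord_recl lerDr.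
exact: sum_ord_widen.
Qed.

(* The distance (in cells) from cell [k] to the nearest end of a row of [h + h] cells. *)
Definition edge_dist (h k : nat) : nat := minn k (h + h - k.+1).

(** The longer side of [k] has at least [h] cells, the shorter one [edge_dist h k]. Monotonicity
    turns [F i] into [F i.+1] on the side that contains [k] itself, so that both sides take the same
    form. *)
Lemma sum_dn_ge F (k h : nat) : (k < h + h)%N -> (forall i, 0 <= F i) ->
  (forall i, F i.+1 <= F i) ->
  \sum_(i < edge_dist h k) F i.+1 + \sum_(i < h) F i.+1 <= \sum_(i < h + h) F (dn k i).
Proof.
move=> km F0 Fn; rewrite sum_dn//.
have E n : \sum_(i < n) F i.+1 <= \sum_(i < n) F i by apply: ler_sum => i _; exact: Fn.
have F0' i : 0 <= F i.+1 by exact: F0.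
rewrite /edge_dist; have [kh|hk] := leqP h k.
  rewrite addrC; apply: lerD; first exact: (sum_ord_widen (F := fun i => F i.+1)).
  apply: le_trans (E _) _; apply: sum_ord_widen => //; lia.
apply: lerD; first by apply: (sum_ord_widen (F := fun i => F i.+1)) => //; lia.
apply: le_trans (E _) _; apply: sum_ord_widen => //; lia.
Qed.

Lemma sum_edge_dist F h :
  \sum_(k < h + h) F (edge_dist h k) = 2 * \sum_(u < h) F u.
Proof.
rewrite big_split_ord /= mulrDl mul1r; congr (_ + _).
  by apply: eq_bigr => i _; congr F; have := ltn_ord i; rewrite /edge_dist; lia.
rewrite (reindex_inj rev_ord_inj); apply: eq_bigr => i _; congr F.
by have := ltn_ord i; rewrite /edge_dist /=; lia.
Qed.

Lemma telescope_shift2 F n : (forall i, 0 <= F i) -> (forall i, F i.+1 <= F i) ->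
  \sum_(i < n) F i <= 2 * F 0%N + \sum_(i < n) F i.+2.
Proof.
move=> F0 Fn; apply: (@le_trans _ _ (\sum_(i < n.+2) F i)).
  by apply: sum_ord_widen => //; lia.
rewrite !big_ord_recl /= addrA lerD//.
by rewrite mulrDl mul1r lerD2l; exact: Fn.
Qed.

(** Telescoping with step two; the first value remains twice because [0.-1 = 0]. *)
Lemma telescope_pred_succ F n : (forall i, 0 <= F i) -> (forall i, F i.+1 <= F i) ->
  \sum_(i < n) (F i.-1 - F i.+1) <= 2 * F 0%N.
Proof.
move=> F0 Fn; rewrite sumrB.
have : \sum_(i < n) F i.-1 <= \sum_(i < n.+1) F i.-1.
  by apply: (sum_ord_widen (F := fun i => F i.-1)).
rewrite big_ord_recl /=; rewrite [X in _ + X](eq_bigr (fun i : 'I_n => F i)); last by move=> i _; congr F; rewrite /= ?/bump ?leq0n.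
move=> H; rewrite lerBlDr; apply: (le_trans H).
rewrite mulrDl mul1r -addrA lerD2l.
apply: (@le_trans _ _ (\sum_(i < n.+1) F i)); first exact: sum_ord_widen.
by rewrite big_ord_recl.
Qed.

Lemma geometric_sum_le (x : R) n : 0 < x ->
  \sum_(i < n) expR (- (x * i%:R)) <= 1 + x^-1.
Proof.
move=> x0; have e1 : expR (- x) < 1 by rewrite expR_lt1 oppr_lt0.
(* Equivalent to [(1 - expR (- x))^-1 <= 1 + x^-1], the bound on the full geometric series. *)
have ex : (1 + x) * expR (- x) <= 1.
  rewrite expRN -ler_pdivlMr ?invr_gt0 ?expR_gt0// invrK mul1r; exact: expR_ge1Dx.
have H : (1 - expR (- x)) * \sum_(i < n) expR (- (x * i%:R)) <= 1.
  rewrite (eq_bigr (fun i : 'I_n => expR (- x) ^+ i)); last first.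
    by move=> i _; rewrite -expRM_natr mulNr.
  rewrite -[leLHS]opprK -mulNr opprB -subrX1 opprB gerBl.
  by rewrite exprn_ge0// expR_ge0.
rewrite -(@ler_pM2l _ (1 - expR (- x))) ?subr_gt0//; apply: (le_trans H).
have xV : x * x^-1 = 1 by rewrite divff// gt_eqF.
rewrite -(@ler_pM2l _ x)// mulr1 mulrCA mulrDr mulr1 xV; lra.
Qed.

Lemma min_geometric_sum_le (x : R) n n0 : 0 < x ->
  \sum_(i < n) expR (- (x * (minn i n0)%:R)) <= 1 + x^-1 + n%:R * expR (- (x * n0%:R)).
Proof.
move=> x0.
apply: (@le_trans _ _ (\sum_(i < n) (expR (- (x * i%:R)) + expR (- (x * n0%:R))))).
  by apply: ler_sum => i _; rewrite /minn; case: ifP => _; rewrite ?lerDl ?lerDr expR_ge0.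
rewrite big_split /= sumr_const card_ord -[X in _ + X <= _]mulr_natl lerD2r.
exact: geometric_sum_le.
Qed.

(** With [w = minn W n0], two splittings of the sum of the first [I + w] values exchange the roles
    of [I] and [w]: what remains is the first [w] values, each at least [al], minus [w] values from
    [I] on, each at most [al / 2]. *)
Lemma shifted_difference_ge F (al : R) (n0 I W : nat) : (forall i, F i.+1 <= F i) ->
  (forall i, (i < n0)%N -> al <= F i) -> (forall i, (I <= i)%N -> F i <= al / 2) ->
  al / 2 * (minn W n0)%:R <= \sum_(i < I) (F i - F (i + W)%N).
Proof.
move=> Fn Fa Fs; have Fmono i j : (i <= j)%N -> F j <= F i.
  by move=> ij; rewrite -(subnKC ij); elim: (j - i)%N => [|n IH]; rewrite ?addn0// addnS (le_trans (Fn _)).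
set w := minn W n0.
apply: (@le_trans _ _ (\sum_(i < I) (F i - F (i + w)%N))); last first.
  by apply: ler_sum => i _; rewrite lerD2l lerN2 Fmono// leq_add2l geq_minl.
have -> : \sum_(i < I) (F i - F (i + w)%N) = \sum_(i < w) (F i - F (i + I)%N).
  have A u v : \sum_(i < u + v) F i = \sum_(i < u) F i + \sum_(i < v) F (i + u)%N.
    by rewrite big_split_ord /=; congr (_ + _); apply: eq_bigr => i _; rewrite addnC.
  rewrite !sumrB; apply/eqP; rewrite subr_eq addrAC -subr_eq opprK.
  by have := A I w; rewrite addnC A => ->.
rewrite mulr_natr -[X in _ *+ X]card_ord -sumr_const; apply: ler_sum => i _.
have iw : (i < n0)%N by apply: (leq_trans (ltn_ord i)); exact: geq_minr.
have := Fa _ iw; have := Fs _ (leq_addl i I); lra.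
Qed.

(** Walks from [k'] in the direction away from [k], so that the distances to [k] are those to [k']
    plus a constant. The central half of a row of [4 h] cells leaves room for [h] steps either
    way. *)
Lemma translate_embedding (h k k' n : nat) : (h <= k < h + h + h)%N -> (h <= k' < h + h + h)%N ->
  (n <= h)%N ->
  exists2 e : 'I_n -> 'I_(h + h + h + h), injective e &
    forall i, dn k' (e i) = i /\ dn k (e i) = (i + dn k k')%N.
Proof.
move=> hk hk' nh.
have b (i : 'I_n) : (k' + i < h + h + h + h)%N by have := ltn_ord i; lia.
have b' (i : 'I_n) : (k' - i < h + h + h + h)%N by have := ltn_ord i; lia.
have [kk|kk] := leqP k k'.
  exists (fun i => Ordinal (b i)) => [i j [] /addnI /val_inj //|i].
  by rewrite /dn /=; lia.
exists (fun i => Ordinal (b' i)) => [i j [] ij|i].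
  by apply: val_inj => /=; have := ltn_ord i; have := ltn_ord j; lia.
by rewrite /dn /=; have := ltn_ord i; lia.
Qed.

End LineSums.

(** * Two-dimensional lattice sums *)

Section GridSums.
Context {R : realType}.
Variable gam : nat -> nat -> R.
Hypothesis gam_ge0 : forall i j, 0 <= gam i j.
Hypothesis gam_le1 : forall i j, gam i j <= 1.
Hypothesis gam_nincl : forall i j, gam i.+1 j <= gam i j.
Hypothesis gam_nincr : forall i j, gam i j.+1 <= gam i j.

Lemma sum_pair (I J : finType) (F : I -> J -> R) :
  \sum_(l : I * J) F l.1 l.2 = \sum_i \sum_j F i j.
Proof. by rewrite pair_bigA. Qed.

(** Mass of one quadrant around a cell. One unit of the offset 2 comes from the largest distance
    between points of two cells, the other from the shift in [sum_dn_ge]. *)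
Definition rect p q : R := \sum_(i < p) \sum_(j < q) gam i.+2 j.+2.

Lemma rect_mono p p' q q' : (p <= p')%N -> (q <= q')%N -> rect p q <= rect p' q'.
Proof.
move=> pp qq; apply: (@le_trans _ _ (rect p' q)).
  apply: (sum_ord_widen (F := fun i => \sum_(j < q) gam i.+2 j.+2)) => // i.
  exact: sumr_ge0.
by apply: ler_sum => i _; apply: (sum_ord_widen (F := fun j => gam i.+2 j.+2)).
Qed.

Lemma rect_ge (al : R) n0 p q : (n0 <= p)%N ->
  (forall i j, (i < n0)%N -> (j < n0)%N -> al <= gam i.+2 j.+2) ->
  n0%:R * al * (minn q n0)%:R <= rect p q /\ n0%:R * al * (minn q n0)%:R <= rect q p.
Proof.
move=> np H; have E x y : x%:R * al * y%:R = \sum_(i < x) \sum_(j < y) al.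
  by rewrite !sumr_const !card_ord -mulrnA -[RHS]mulr_natl natrM; ring.
split.
  apply: (@le_trans _ _ (rect n0 (minn q n0))); last by apply: rect_mono => //; exact: geq_minl.
  rewrite E; apply: ler_sum => i _; apply: ler_sum => j _; apply: H => //.
  by apply: (leq_trans (ltn_ord j)); exact: geq_minr.
apply: (@le_trans _ _ (rect (minn q n0) n0)); last by apply: rect_mono => //; exact: geq_minl.
rewrite E exchange_big; apply: ler_sum => i _; apply: ler_sum => j _; apply: H => //.
by apply: (leq_trans (ltn_ord i)); exact: geq_minr.
Qed.

(** [sum_dn_ge] along each axis: the four rectangles are the quadrants around [k], extending [h] or
    [edge_dist] cells in each direction. *)
Lemma grid_sum_ge h (k : 'I_(h + h) * 'I_(h + h)) :
  rect h h + rect (edge_dist h k.1) h + rect h (edge_dist h k.2) +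
    rect (edge_dist h k.1) (edge_dist h k.2) <=
  \sum_(l : 'I_(h + h) * 'I_(h + h)) gam (dn k.1 l.1).+1 (dn k.2 l.2).+1.
Proof.
set u := edge_dist h k.1; set v := edge_dist h k.2.
rewrite (sum_pair (fun i j : 'I_(h + h) => gam (dn k.1 i).+1 (dn k.2 j).+1)).
pose F i := \sum_(j < h + h) gam i.+1 (dn k.2 j).+1.
apply: le_trans (sum_dn_ge (F := F) (ltn_ord k.1) _ _); last 2 first.
  by move=> i; apply: sumr_ge0.
  by move=> i; apply: ler_sum.
have FE i : \sum_(j < v) gam i.+2 j.+2 + \sum_(j < h) gam i.+2 j.+2 <= F i.+1.
  exact: (sum_dn_ge (F := fun j => gam i.+2 j.+1)).
apply: (@le_trans _ _ (\sum_(i < u) (\sum_(j < v) gam i.+2 j.+2 + \sum_(j < h) gam i.+2 j.+2) +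
  \sum_(i < h) (\sum_(j < v) gam i.+2 j.+2 + \sum_(j < h) gam i.+2 j.+2))).
  by rewrite !big_split /= /rect; lra.
by apply: lerD; apply: ler_sum => i _; exact: FE.
Qed.

(** Removing the first two rows and the first two columns costs at most four axis sums. *)
Lemma rect_shift (X : R) n : (forall n, \sum_(i < n) gam i 0%N <= X) ->
  (forall n, \sum_(j < n) gam 0%N j <= X) ->
  \sum_(i < n) \sum_(j < n) gam i j <= rect n n + 4 * X.
Proof.
move=> Xi Xj.
apply: (le_trans (telescope_shift2 (F := fun i => \sum_(j < n) gam i j) n _ _)).
- by move=> i; apply: sumr_ge0.
- by move=> i; apply: ler_sum.
have H : \sum_(i < n) \sum_(j < n) gam i.+2 j <= 2 * X + rect n n.
  apply: (@le_trans _ _ (\sum_(i < n) (2 * gam i.+2 0%N + \sum_(j < n) gam i.+2 j.+2))).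
    by apply: ler_sum => i _; exact: (telescope_shift2 (F := fun j => gam i.+2 j)).
  rewrite big_split /= lerD2r -mulr_sumr ler_pM2l//; apply: le_trans (Xi n).
  by apply: ler_sum => i _; exact: le_trans (gam_nincl _ _) (gam_nincl _ _).
have := Xj n; lra.
Qed.

Lemma grid_sum_le m (k : 'I_m * 'I_m) (F : nat -> nat -> R) : (forall i j, 0 <= F i j) ->
  \sum_(l : 'I_m * 'I_m) F (dn k.1 l.1) (dn k.2 l.2) <=
  4 * \sum_(i < m) \sum_(j < m) F i j.
Proof.
move=> F0; rewrite (sum_pair (fun i j : 'I_m => F (dn k.1 i) (dn k.2 j))).
apply: (le_trans (sum_dn_le (F := fun i => \sum_(j < m) F i (dn k.2 j)) (ltn_ord k.1) _)).
  by move=> i; apply: sumr_ge0.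
rewrite (_ : 4 = 2 * 2) -?mulrA; last by ring.
rewrite ler_pM2l// mulr_sumr; apply: ler_sum => i _.
exact: (sum_dn_le (F := F i)).
Qed.

(** Compares the values of [gam] at the smallest and at the largest distances between cells. The
    difference is changed one coordinate at a time and telescopes along rows and along columns, so
    the total is of the order of an axis sum, not of the number of cells. *)
Lemma grid_oscillation_le (X : R) m (k : 'I_m * 'I_m) :
  (forall n, \sum_(i < n) gam i 0%N <= X) -> (forall n, \sum_(j < n) gam 0%N j <= X) ->
  \sum_(l : 'I_m * 'I_m) gam (dn k.1 l.1).-1 (dn k.2 l.2).-1 <=
  \sum_(l : 'I_m * 'I_m) gam (dn k.1 l.1).+1 (dn k.2 l.2).+1 + (8 + 16 * X).
Proof.
move=> Xi Xj; rewrite -lerBlDl -sumrB.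
have mono i j i' j' : (i <= i')%N -> (j <= j')%N -> gam i' j' <= gam i j.
  move=> ii jj; apply: (@le_trans _ _ (gam i j')).
    rewrite -(subnKC ii); elim: (i' - i)%N => [|n IH]; rewrite ?addn0//.
    by rewrite addnS (le_trans (gam_nincl _ _)).
  rewrite -(subnKC jj); elim: (j' - j)%N => [|n IH]; rewrite ?addn0//.
  by rewrite addnS (le_trans (gam_nincr _ _)).
apply: (le_trans (grid_sum_le k (F := fun i j => gam i.-1 j.-1 - gam i.+1 j.+1) _)).
  by move=> i j; rewrite subr_ge0; apply: mono; lia.
suff : \sum_(i < m) \sum_(j < m) (gam i.-1 j.-1 - gam i.+1 j.+1) <= 2 + 4 * X by lra.
have -> : \sum_(i < m) \sum_(j < m) (gam i.-1 j.-1 - gam i.+1 j.+1) =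
  \sum_(j < m) \sum_(i < m) (gam i.-1 j.-1 - gam i.+1 j.-1) +
  \sum_(i < m) \sum_(j < m) (gam i.+1 j.-1 - gam i.+1 j.+1).
  rewrite [X in _ = X + _]exchange_big -big_split /=; apply: eq_bigr => i _.
  by rewrite -big_split /=; apply: eq_bigr => j _; ring.
have H1 : \sum_(j < m) \sum_(i < m) (gam i.-1 j.-1 - gam i.+1 j.-1) <= 2 + 2 * X.
  apply: (@le_trans _ _ (\sum_(j < m) 2 * gam 0%N j.-1)).
    by apply: ler_sum => j _; exact: (telescope_pred_succ (F := fun i => gam i j.-1)).
  rewrite -mulr_sumr -{1}[2 in leRHS]mulr1 -mulrDr ler_pM2l//.
  apply: (@le_trans _ _ (\sum_(j < m.+1) gam 0%N j.-1)).
    by apply: (sum_ord_widen (F := fun j => gam 0%N j.-1)).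
  rewrite big_ord_recl /= lerD//.
  rewrite (eq_bigr (fun j : 'I_m => gam 0%N j)) ?Xj//.
have H2 : \sum_(i < m) \sum_(j < m) (gam i.+1 j.-1 - gam i.+1 j.+1) <= 2 * X.
  apply: (@le_trans _ _ (\sum_(i < m) 2 * gam i.+1 0%N)).
    by apply: ler_sum => i _; exact: (telescope_pred_succ (F := gam i.+1)).
  rewrite -mulr_sumr ler_pM2l//; apply: le_trans (Xi m).
  by apply: ler_sum => i _.
lra.
Qed.

(** In a coordinate where [k] and [k'] are [D] apart, a third cell is at distance at least [D / 2]
    from one of them; hence one of the two factors is at most [eps]. *)
Lemma far_overlap_le (eps : R) D m (k k' : 'I_m * 'I_m) :
  (forall i j, (D <= i + i)%N || (D <= j + j)%N -> gam i.+1 j.+1 <= eps) ->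
  (D <= dn k.1 k'.1)%N || (D <= dn k.2 k'.2)%N ->
  \sum_(l : 'I_m * 'I_m) gam (dn k.1 l.1).+1 (dn k.2 l.2).+1 *
                         gam (dn k'.1 l.1).+1 (dn k'.2 l.2).+1 <=
  eps * (\sum_(l : 'I_m * 'I_m) gam (dn k.1 l.1).+1 (dn k.2 l.2).+1 +
         \sum_(l : 'I_m * 'I_m) gam (dn k'.1 l.1).+1 (dn k'.2 l.2).+1).
Proof.
move=> H far; rewrite -big_split mulr_sumr; apply: ler_sum => l _ /=.
set x := gam _ _; set y := gam _ _.
have x0 : 0 <= x by exact: gam_ge0.
have y0 : 0 <= y by exact: gam_ge0.
have [le_x|le_y] : x <= eps \/ y <= eps.
  have t1 : (dn k.1 k'.1 <= dn k.1 l.1 + dn k'.1 l.1)%N by rewrite /dn; lia.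
  have t2 : (dn k.2 k'.2 <= dn k.2 l.2 + dn k'.2 l.2)%N by rewrite /dn; lia.
  have [c|c] := boolP ((D <= dn k.1 l.1 + dn k.1 l.1)%N || (D <= dn k.2 l.2 + dn k.2 l.2)%N).
    by left; exact: H.
  right; apply: H; move: c far t1 t2.
  move: (dn _ _) (dn _ _) (dn _ _) (dn _ _) (dn _ _) (dn _ _) => a1 a2 a3 a4 a5 a6.
  by rewrite negb_or -!ltnNge => /andP[c1 c2] /orP[c3|c3] t1 t2; apply/orP; [left|right]; lia.
- by apply: (@le_trans _ _ (eps * y)); [exact: ler_wpM2r|rewrite mulrDr lerDr mulr_ge0// (le_trans x0)].
- by apply: (@le_trans _ _ (x * eps)); [exact: ler_wpM2l|rewrite mulrC mulrDr lerDl mulr_ge0// (le_trans y0)].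
Qed.

(* As [gam <= 1], the part [x * (1 - y)] of the mass seen by [k'] alone is at
   least [x - y], which telescopes along rows. *)
Lemma lune_ge (al : R) n0 I h (k k' : 'I_(h + h + h + h) * 'I_(h + h + h + h)) :
  (h <= k.1 < h + h + h)%N -> (h <= k'.1 < h + h + h)%N ->
  (h <= k.2 < h + h + h)%N -> (h <= k'.2 < h + h + h)%N ->
  (n0 <= h)%N -> (I <= h)%N ->
  (forall i j, (i < n0)%N -> (j < n0)%N -> al <= gam i.+1 j.+1) ->
  (forall i j, (I <= i)%N -> gam i.+1 j.+1 <= al / 2) ->
  n0%:R * (al / 2 * (minn (dn k.1 k'.1) n0)%:R) <=
  \sum_(l : 'I_(h + h + h + h) * 'I_(h + h + h + h))
    gam (dn k'.1 l.1).+1 (dn k'.2 l.2).+1 * (1 - gam (dn k.1 l.1).+1 (dn k.2 l.2).+1).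
Proof.
move=> k1 k1' k2 k2' nh Ih Hal HI.
have [e ei eE] := translate_embedding k1 k1' Ih.
have [f fi fE] := translate_embedding k2 k2' nh.
set m := (h + h + h + h)%N in k k' k1 k1' k2 k2' e ei eE f fi fE *.
set G := fun i j => gam (dn k'.1 i).+1 (dn k'.2 j).+1 * (1 - gam (dn k.1 i).+1 (dn k.2 j).+1).
have G0 i j : 0 <= G i j by rewrite mulr_ge0// subr_ge0.
rewrite (sum_pair (fun i j : 'I_m => G i j)).
have sub (n : nat) (F : 'I_m -> R) (q : 'I_n -> 'I_m) : injective q -> (forall i, 0 <= F i) ->
    \sum_i F (q i) <= \sum_i F i.
  move=> qi F0.
  rewrite [leLHS](eq_bigl (fun i => i \in [set: 'I_n]%SET)) => [|i]; last by rewrite inE.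
  rewrite -(big_imset F); last by move=> x y _ _ /qi.
  rewrite [leRHS](bigID (fun x => x \in imset q (mem [set: 'I_n]%SET))) /= lerDl.
  exact: sumr_ge0.
apply: (@le_trans _ _ (\sum_(i < I) \sum_(j < n0) G (e i) (f j))); last first.
  apply: (@le_trans _ _ (\sum_(i < I) \sum_(j < m) G (e i) j)).
    by apply: ler_sum => i _; apply: (sub _ (fun j : 'I_m => G (e i) j)).
  by apply: (sub _ (fun i : 'I_m => \sum_(j < m) G i j)) => // i; apply: sumr_ge0.
rewrite exchange_big /=.
rewrite mulr_natl -[X in _ *+ X]card_ord -sumr_const; apply: ler_sum => j _.
apply: (@le_trans _ _ (\sum_(i < I) (gam i.+1 j.+1 - gam (i + dn k.1 k'.1).+1 j.+1))).
  apply: (shifted_difference_ge (F := fun i => gam i.+1 j.+1)) => // i.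
    by move=> i0; exact: Hal.
  exact: HI.
apply: ler_sum => i _; rewrite /G; have [-> ->] := eE i; have [-> ->] := fE j.
have le : gam (i + dn k.1 k'.1).+1 (j + dn k.2 k'.2).+1 <= gam (i + dn k.1 k'.1).+1 j.+1.
  elim: (dn k.2 k'.2) => [|n IH]; rewrite ?addn0//.
  by rewrite addnS (le_trans (gam_nincr _ _)).
have := gam_ge0 i.+1 j.+1; have := gam_le1 i.+1 j.+1.
have := gam_ge0 (i + dn k.1 k'.1).+1 (j + dn k.2 k'.2).+1.
move: le; nra.
Qed.

Lemma isolation_sum_le (mu al La ka : R) h n0 p : 0 < mu -> 0 < al -> (0 < n0)%N ->
  (n0 <= p)%N -> (p <= h)%N ->
  (forall i j, (i < n0)%N -> (j < n0)%N -> al <= gam i.+2 j.+2) ->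
  La <= mu * rect p p ->
  ka = 2 * (mu * (n0%:R * al)) ->
  \sum_(k : 'I_(h + h) * 'I_(h + h))
    expR (- (mu * \sum_(l : 'I_(h + h) * 'I_(h + h)) gam (dn k.1 l.1).+1 (dn k.2 l.2).+1)) <=
  4 * (h%:R ^+ 2 * expR (- (4 * La)) +
       2 * (h%:R * expR (- (2 * La)) * (1 + ka^-1 + p%:R * expR (- (ka * n0%:R)))) +
       p%:R ^+ 2 * expR (- La)).
Proof.
move=> mu0 al0 n00 np ph Hal HLa kaE.
pose E u v := mu * (rect h h + rect u h + rect h v + rect u v).
apply: (@le_trans _ _ (\sum_(k : 'I_(h + h) * 'I_(h + h))
    expR (- E (edge_dist h k.1) (edge_dist h k.2)))).
  by apply: ler_sum => k _; rewrite ler_expR lerN2 ler_pM2l//; exact: grid_sum_ge.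
rewrite (sum_pair (fun i j : 'I_(h + h) => expR (- E (edge_dist h i) (edge_dist h j)))).
under eq_bigr do rewrite (sum_edge_dist (fun v => expR (- E _ v))).
rewrite (sum_edge_dist (fun u => 2 * \sum_(v < h) expR (- E u v))) -mulr_sumr mulrA -natrM.
rewrite ler_pM2l//.
have rect0 x y : 0 <= rect x y by apply: sumr_ge0 => i _; exact: sumr_ge0.
have ka0 : 0 < ka by rewrite kaE !mulr_gt0// ltr0n.
(* Bulk cells see four rectangles of mass [La], cells within [p] of a single side
   two of them, cells near a corner one; near a side, at depth [u], the extra
   mass [ka * minn u n0] makes the sum over [u] converge. *)
pose t2 (u : nat) := expR (- (2 * La)) * expR (- (ka * (minn u n0)%:R)).
have t20 u : 0 <= t2 u by rewrite mulr_ge0 ?expR_ge0.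
have mr x y : (p <= x)%N -> (p <= y)%N -> La <= mu * rect x y.
  by move=> px py; apply: (le_trans HLa); rewrite ler_pM2l// rect_mono.
have kmin x y : (p <= y)%N -> ka * (minn x n0)%:R <= 2 * (mu * rect x y) /\
    ka * (minn x n0)%:R <= 2 * (mu * rect y x).
  move=> py; have [h1 h2] := rect_ge x (leq_trans np py) Hal.
  by rewrite kaE -!mulrA !ler_pM2l//; rewrite !mulrA; split.
have pt u v : (u < h)%N -> (v < h)%N -> expR (- E u v) <= expR (- (4 * La)) +
    ((if (u < p)%N then t2 u else 0) + (if (v < p)%N then t2 v else 0) +
     (if (u < p)%N && (v < p)%N then expR (- La) else 0)).
  move=> uh vh.
  have e4 : 0 <= expR (- (4 * La)) by exact: expR_ge0.
  have r0 x y : 0 <= mu * rect x y by rewrite mulr_ge0 ?(ltW mu0).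
  have EE : E u v = mu * rect h h + mu * rect u h + mu * rect h v + mu * rect u v.
    by rewrite /E !mulrDr.
  have [up|pu] := ltnP u p; have [vp|pv] := ltnP v p => /=.
  - apply: (@le_trans _ _ (expR (- La))).
      rewrite ler_expR lerN2 EE; have := mr h h ph ph; have := r0 u h; have := r0 h v; have := r0 u v; lra.
    by have := t20 u; have := t20 v; lra.
  - apply: (@le_trans _ _ (t2 u)); last by lra.
    rewrite /t2 -expRD ler_expR EE.
    have [k1 _] := kmin u h ph; have [k2 _] := kmin u v pv.
    have := mr h h ph ph; have := mr h v ph pv; lra.
  - apply: (@le_trans _ _ (t2 v)); last by lra.
    rewrite /t2 -expRD ler_expR EE.
    have [_ k1] := kmin v h ph; have [_ k2] := kmin v u pu.
    have := mr h h ph ph; have := mr u h pu ph; lra.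
  - rewrite !addr0 ler_expR lerN2 EE.
    by have := mr h h ph ph; have := mr u h pu ph; have := mr h v ph pv; have := mr u v pu pv; lra.
have cut (F : nat -> R) : \sum_(u < h) (if (u < p)%N then F u else 0) = \sum_(u < p) F u.
  rewrite -(big_mkord xpredT (fun u => if (u < p)%N then F u else 0)) -(big_mkord xpredT F) (@big_cat_nat _ _ _ p 0 h)//=.
  rewrite [X in _ + X]big_nat_cond [X in _ + X]big1 ?addr0.
    by apply: eq_big_nat => i /andP[_ ->].
  by move=> i /andP[/andP[pi _] _]; rewrite ltnNge pi.
have sumt2 : \sum_(u < p) t2 u <= expR (- (2 * La)) * (1 + ka^-1 + p%:R * expR (- (ka * n0%:R))).
  by rewrite -mulr_sumr ler_wpM2l ?expR_ge0//; exact: min_geometric_sum_le.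
apply: (@le_trans _ _ (\sum_(u < h) \sum_(v < h) (expR (- (4 * La)) +
    ((if (u < p)%N then t2 u else 0) + (if (v < p)%N then t2 v else 0) +
     (if (u < p)%N && (v < p)%N then expR (- La) else 0))))).
  by apply: ler_sum => u _; apply: ler_sum => v _; exact: pt.
have -> : \sum_(u < h) \sum_(v < h) (expR (- (4 * La)) +
    ((if (u < p)%N then t2 u else 0) + (if (v < p)%N then t2 v else 0) +
     (if (u < p)%N && (v < p)%N then expR (- La) else 0))) =
   h%:R ^+ 2 * expR (- (4 * La)) + 2 * (h%:R * \sum_(u < p) t2 u) + p%:R ^+ 2 * expR (- La).
  under eq_bigr => u _.
    rewrite !big_split /= !sumr_const card_ord (cut t2).
    rewrite (_ : \sum_(v < h) (if (u < p)%N && (v < p)%N then expR (- La) else 0) =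
       (if (u < p)%N then p%:R * expR (- La) else 0)); last first.
      case: (u < p)%N => /=; last by rewrite big1.
      by rewrite (cut (fun=> expR (- La))) sumr_const card_ord mulr_natl.
    over.
  rewrite !big_split /= !sumr_const card_ord (cut (fun=> p%:R * expR (- La))) sumr_const card_ord.
  rewrite sumrMnl (cut t2).
  ring.
by rewrite lerD2r lerD2l ler_pM2l// -mulrA ler_wpM2l.
Qed.

(** The exponential factorises over the coordinates, and each axis contributes at most [2 * G], as
    both sides of [k] count. *)
Lemma near_sum_le (ka G : R) m n0 p (k : 'I_m * 'I_m) :
  \sum_(u < p) expR (- (ka * (minn u n0)%:R)) <= G ->
  \sum_(l : 'I_m * 'I_m | (dn k.1 l.1 < p)%N && (dn k.2 l.2 < p)%N)
    expR (- (ka * ((minn (dn k.1 l.1) n0)%:R + (minn (dn k.2 l.2) n0)%:R))) <=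
  4 * G ^+ 2.
Proof.
move=> HG; pose F i := if (i < p)%N then expR (- (ka * (minn i n0)%:R)) else 0.
have F0 i : 0 <= F i by rewrite /F; case: ifP => // _; exact: expR_ge0.
rewrite big_mkcond (eq_bigr (fun l : 'I_m * 'I_m => F (dn k.1 l.1) * F (dn k.2 l.2))); last first.
  move=> l _; rewrite /F; case: ltnP => _ /=; last by rewrite mul0r.
  by case: ltnP => _; rewrite ?mulr0// -expRD mulrDr opprD.
apply: (le_trans (grid_sum_le k (F := fun i j => F i * F j) _)).
  by move=> i j; rewrite mulr_ge0.
rewrite ler_pM2l//.
have -> : \sum_(i < m) \sum_(j < m) F i * F j = (\sum_(i < m) F i) ^+ 2.
  by rewrite expr2 mulr_suml; apply: eq_bigr => i _; rewrite mulr_sumr.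
rewrite lerXn2r ?nnegrE//; first exact: sumr_ge0.
  by apply: le_trans HG; apply: sumr_ge0 => i _; exact: expR_ge0.
apply: le_trans HG.
apply: (@le_trans _ _ (\sum_(i < m + p) F i)); first by apply: sum_ord_widen => //; exact: leq_addr.
rewrite addnC big_split_ord /= [X in _ + X]big1 ?addr0; last first.
  by move=> i _; rewrite /F ltnNge leq_addr.
by apply: ler_sum => i _; rewrite /F ltn_ord.
Qed.

End GridSums.

(** The mean of [lune_ge] and of its transpose, which is why [al / 2] becomes [al / 4]. *)
Lemma lune_ge_sym {R : realType} (gam : nat -> nat -> R) (al : R) n0 I h
    (k k' : 'I_(h + h + h + h) * 'I_(h + h + h + h)) :
  (forall i j, 0 <= gam i j) -> (forall i j, gam i j <= 1) ->
  (forall i j, gam i.+1 j <= gam i j) -> (forall i j, gam i j.+1 <= gam i j) ->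
  (h <= k.1 < h + h + h)%N -> (h <= k'.1 < h + h + h)%N ->
  (h <= k.2 < h + h + h)%N -> (h <= k'.2 < h + h + h)%N ->
  (n0 <= h)%N -> (I <= h)%N ->
  (forall i j, (i < n0)%N -> (j < n0)%N -> al <= gam i.+1 j.+1) ->
  (forall i j, (I <= i)%N || (I <= j)%N -> gam i.+1 j.+1 <= al / 2) ->
  n0%:R * (al / 4 * ((minn (dn k.1 k'.1) n0)%:R + (minn (dn k.2 k'.2) n0)%:R)) <=
  \sum_(l : 'I_(h + h + h + h) * 'I_(h + h + h + h))
    gam (dn k'.1 l.1).+1 (dn k'.2 l.2).+1 * (1 - gam (dn k.1 l.1).+1 (dn k.2 l.2).+1).
Proof.
move=> g0 g1 gi gj k1 k1' k2 k2' nh Ih Hal HI.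
have H1 : n0%:R * (al / 2 * (minn (dn k.1 k'.1) n0)%:R) <=
  \sum_(l : 'I_(h + h + h + h) * 'I_(h + h + h + h))
    gam (dn k'.1 l.1).+1 (dn k'.2 l.2).+1 * (1 - gam (dn k.1 l.1).+1 (dn k.2 l.2).+1).
  apply: (@lune_ge _ gam _ _ _ _ al n0 I h k k') => //.
  by move=> i j Ii; apply: HI; rewrite Ii.
have H2 : n0%:R * (al / 2 * (minn (dn k.2 k'.2) n0)%:R) <=
  \sum_(l : 'I_(h + h + h + h) * 'I_(h + h + h + h))
    gam (dn k'.1 l.1).+1 (dn k'.2 l.2).+1 * (1 - gam (dn k.1 l.1).+1 (dn k.2 l.2).+1).
  have swapI : injective (fun l : 'I_(h + h + h + h) * 'I_(h + h + h + h) => (l.2, l.1)).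
    by move=> [i j] [i' j'] [-> ->].
  rewrite (reindex_inj swapI) /=.
  apply: (@lune_ge _ (fun i j => gam j i) _ _ _ _ al n0 I h (k.2, k.1) (k'.2, k'.1)) => //=.
    by move=> i j i0 j0; exact: Hal.
  by move=> i j Ii; apply: HI; rewrite Ii orbT.
rewrite mulrA in H1; rewrite mulrA in H2.
rewrite mulrDr mulrDr; lra.
Qed.

(** * Geometry of square cells *)

Definition hyp {R : realType} (i j : nat) : R := Num.sqrt (i%:R ^+ 2 + j%:R ^+ 2).

Section Squares.
Context {R : realType}.
Implicit Types (a x y : R) (z : plane R).

Definition step (x0 : R) a (i : nat) : set (measurableTypeR R) :=
  `[x0 + a * i%:R, x0 + a * i.+1%:R[.

Definition square x0 a (i j : nat) : set (plane R) := step x0 a i `*` step (x0 : R) a j.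

Lemma stepP x0 a i x : step (x0 : R) a i x <-> x0 + a * i%:R <= x < x0 + a * i.+1%:R.
Proof. by rewrite /step /= in_itv. Qed.

Lemma measurable_step x0 a i : measurable (step (x0 : R) a i).
Proof. exact: measurable_itv. Qed.

Lemma measurable_square x0 a i j : measurable (square (x0 : R) a i j).
Proof. by apply: measurableX; exact: measurable_step. Qed.

Lemma lebesgue_step x0 a i : 0 < a -> lebesgue_measure (step (x0 : R) a i) = a%:E.
Proof.
move=> a0; rewrite /step lebesgue_measure_itv /= lte_fin ltrD2l ltr_pM2l// ltr_nat ltnSn.
by rewrite -EFinD; congr EFin; rewrite -natr1; ring.
Qed.

Lemma leb2X (A B : set (measurableTypeR R)) : measurable A -> measurable B ->
  leb2 (A `*` B) = (lebesgue_measure A * lebesgue_measure B)%E.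
Proof. exact: product_measure1E. Qed.

Lemma leb2_square x0 a i j : 0 < a -> leb2 (square (x0 : R) a i j) = (a ^+ 2)%:E.
Proof.
move=> a0; rewrite /square leb2X; [|exact: measurable_step..].
by rewrite !lebesgue_step// -EFinM expr2.
Qed.

Lemma step_inj x0 a i j x : 0 < a -> step x0 a i x -> step (x0 : R) a j x -> i = j.
Proof.
move=> a0 /stepP/andP[i1 i2] /stepP/andP[j1 j2].
have := le_lt_trans i1 j2; have := le_lt_trans j1 i2.
by rewrite !ltrD2l !ltr_pM2l// !ltr_nat; lia.
Qed.

Lemma step_cover (x0 : R) a n x : 0 < a -> x0 <= x < x0 + a * n%:R ->
  exists i : 'I_n, step x0 a i x.
Proof.
move=> a0 /andP[x1 x2].
have y0 : 0 <= (x - x0) / a by rewrite divr_ge0 ?subr_ge0// ltW.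
have /andP[t1 t2] := Num.Theory.truncn_itv y0.
move: t1 t2; rewrite ler_pdivlMr// ltr_pdivrMr// => t1 t2.
have tn : (Num.truncn ((x - x0) / a) < n)%N.
  rewrite -(ltr_nat R) -(ltr_pM2r a0); apply: (le_lt_trans t1); lra.
by exists (Ordinal tn); apply/stepP => /=; apply/andP; split; lra.
Qed.

Lemma square_trivIset (x0 : R) a n : 0 < a ->
  trivIset setT (fun l : 'I_n * 'I_n => square x0 a l.1 l.2).
Proof.
move=> a0 [i j] [i' j'] _ _ [z [[/= z1 z2] [/= z1' z2']]].
by congr pair; apply: val_inj; [exact: step_inj z1 z1'|exact: step_inj z2 z2'].
Qed.

Lemma step_dist_le x0 a i j x y : 0 < a -> step x0 a i x -> step (x0 : R) a j y ->
  `|x - y| <= a * (dn i j).+1%:R.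
Proof.
move=> a0 /stepP/andP[i1 i2] /stepP/andP[j1 j2].
have H : (i%:R : R) - j%:R <= (dn i j)%:R.
  by rewrite lerBlDr -natrD ler_nat /dn; lia.
have H' : (j%:R : R) - i%:R <= (dn i j)%:R.
  by rewrite lerBlDr -natrD ler_nat /dn; lia.
have := ler_wpM2l (ltW a0) H; have := ler_wpM2l (ltW a0) H'.
rewrite ler_norml; move: i1 i2 j1 j2; rewrite -!natr1 !mulrDr !mulr1 => *.
apply/andP; split; lra.
Qed.

Lemma step_dist_ge x0 a i j x y : 0 < a -> step x0 a i x -> step (x0 : R) a j y ->
  a * (dn i j).-1%:R <= `|x - y|.
Proof.
move=> a0 /stepP/andP[i1 i2] /stepP/andP[j1 j2].
have [->|d0] := posnP (dn i j); first by rewrite mulr0.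
have dE : ((dn i j).-1%:R : R) = (dn i j)%:R - 1.
  by rewrite -[in RHS](prednK d0) -natr1 addrK.
have [ij|ji] := leqP i j.
  have E : (dn i j)%:R = (j%:R : R) - i%:R.
    by apply/eqP; rewrite eq_sym subr_eq -natrD eqr_nat /dn; lia.
  rewrite dE E ler_normr; apply/orP; right.
  by move: i1 i2 j1 j2; rewrite -!natr1 => *; lra.
have E : (dn i j)%:R = (i%:R : R) - j%:R.
  by apply/eqP; rewrite eq_sym subr_eq -natrD eqr_nat /dn; lia.
rewrite dE E ler_normr; apply/orP; left.
by move: i1 i2 j1 j2; rewrite -!natr1 => *; lra.
Qed.

Lemma sqrt_le_hyp (a u v : R) (p q : nat) : 0 < a -> `|u| <= a * p%:R -> `|v| <= a * q%:R ->
  Num.sqrt (u ^+ 2 + v ^+ 2) <= a * hyp p q.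
Proof.
move=> a0 up vq; rewrite /hyp -[X in X * _](ger0_norm (ltW a0)) -sqrtr_sqr -sqrtrM ?sqr_ge0//.
apply: ler_wsqrtr; rewrite mulrDr -!exprMn lerD//;
  by rewrite -[leLHS]real_normK ?num_real// lerXn2r ?nnegrE ?mulr_ge0// ltW.
Qed.

Lemma hyp_le_sqrt (a u v : R) (p q : nat) : 0 < a -> a * p%:R <= `|u| -> a * q%:R <= `|v| ->
  a * hyp p q <= Num.sqrt (u ^+ 2 + v ^+ 2).
Proof.
move=> a0 up vq; rewrite /hyp -[X in X * _](ger0_norm (ltW a0)) -sqrtr_sqr -sqrtrM ?sqr_ge0//.
apply: ler_wsqrtr; rewrite mulrDr -!exprMn lerD//;
  by rewrite -[leRHS]real_normK ?num_real// lerXn2r ?nnegrE ?mulr_ge0// ltW.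
Qed.

Lemma square_dist_le (x0 : R) a i j i' j' (x y : plane R) : 0 < a ->
  square x0 a i j x -> square x0 a i' j' y ->
  dist2 x y <= a * hyp (dn i i').+1 (dn j j').+1.
Proof.
move=> a0 [x1 x2] [y1 y2]; apply: sqrt_le_hyp => //=.
  exact: (step_dist_le a0 x1 y1).
exact: (step_dist_le a0 x2 y2).
Qed.

Lemma square_dist_ge (x0 : R) a i j i' j' (x y : plane R) : 0 < a ->
  square x0 a i j x -> square x0 a i' j' y ->
  a * hyp (dn i i').-1 (dn j j').-1 <= dist2 x y.
Proof.
move=> a0 [x1 x2] [y1 y2]; apply: hyp_le_sqrt => //=.
  exact: (step_dist_ge a0 x1 y1).
exact: (step_dist_ge a0 x2 y2).
Qed.

Lemma hyp_ge0 i j : 0 <= hyp i j :> R.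
Proof. exact: sqrtr_ge0. Qed.

Lemma hyp_mono i j i' j' : (i <= i')%N -> (j <= j')%N -> hyp i j <= hyp i' j' :> R.
Proof.
by move=> ii jj; apply: ler_wsqrtr; apply: lerD; rewrite lerXn2r ?nnegrE// ler_nat.
Qed.

Lemma hyp_le i j : hyp i j <= (i + j)%:R :> R.
Proof.
rewrite -[leRHS]ger0_norm// -sqrtr_sqr; apply: ler_wsqrtr.
rewrite natrD sqrrD -addrA [_ *+ 2 + _]addrC addrA lerDl.
by rewrite mulrn_wge0// mulr_ge0.
Qed.

Lemma hyp_ge i j : (maxn i j)%:R <= hyp i j :> R.
Proof.
rewrite -[leLHS]ger0_norm// -sqrtr_sqr; apply: ler_wsqrtr.
by rewrite /maxn; case: ifP => _; rewrite ?lerDl ?lerDr sqr_ge0.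
Qed.

End Squares.

Section UnitGrid.
Context {R : realType}.
Variable m : nat.
Hypothesis m_gt0 : (0 < m)%N.

Definition unit_cell (l : 'I_m * 'I_m) : set (plane R) :=
  square (- 2^-1) m%:R^-1 l.1 l.2.

Let mR : 0 < m%:R^-1 :> R. Proof. by rewrite invr_gt0 ltr0n. Qed.

Lemma unit_cell_sub l : unit_cell l `<=` unit_square.
Proof.
have H (i : 'I_m) x : step (- 2^-1) m%:R^-1 i x -> `[- 2^-1, 2^-1[%classic (x : R).
  move=> /stepP/andP[i1 i2]; rewrite /= in_itv /=; apply/andP; split.
    by apply: le_trans i1; rewrite lerDl mulr_ge0// ltW.
  apply: (lt_le_trans i2); rewrite -lerBrDl opprK.
  rewrite [leRHS](_ : _ = m%:R^-1 * m%:R); last by rewrite mulVf ?pnatr_eq0 -?lt0n//; field.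
  by rewrite ler_pM2l// ler_nat.
by move=> z [z1 z2]; split; [exact: H z1|exact: H z2].
Qed.

Lemma unit_cell_cover z : unit_square z -> exists l, unit_cell l z.
Proof.
have H (x : R) : `[- 2^-1, 2^-1[%classic x -> exists i : 'I_m, step (- 2^-1) m%:R^-1 i x.
  rewrite /= in_itv /= => /andP[x1 x2]; apply: step_cover => //.
  rewrite mulVf ?pnatr_eq0 -?lt0n// x1 /=; lra.
by move=> [/H[i zi] /H[j zj]]; exists (i, j).
Qed.

End UnitGrid.

(** * Riemann sums and tail of the integral of [g] *)

Section RadialMass.
Context {R : realType}.
Variables (g : R -> R) (C : R).
Hypothesis g01 : forall x : R, 0 <= x -> 0 <= g x <= 1.
Hypothesis g_noninc : forall x y : R, 0 <= x -> x <= y -> g y <= g x.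
Hypothesis C_int : (\int[leb2]_z (g (norm2 z))%:E = C%:E)%E.

(** With [a] the cell side in units of the connection radius, this is the connection probability at
    an offset of [(i, j)] cells. *)
Definition gam (a : R) i j : R := g (a * hyp i j).

Lemma measurable_radial : measurable_fun setT (fun z : plane R => (g (norm2 z))%:E).
Proof.
apply/measurable_EFinP.
have mh : measurable_fun setT (fun t : R => g (Num.sqrt t)).
  apply: nonincreasing_measurable => // s t st.
  by rewrite g_noninc ?sqrtr_ge0// ler_wsqrtr.
apply: (measurableT_comp mh); apply: measurable_funD; apply: measurable_funX => //.
Qed.

Lemma radial_ge0 (z : plane R) : (0 <= (g (norm2 z))%:E)%E.
Proof. by rewrite lee_fin; have /andP[] := g01 (sqrtr_ge0 _ : 0 <= norm2 z). Qed.

(** The sup norm is used so that this set contains all that a square box of cells leaves out. *)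
Definition outside (s : R) : set (plane R) :=
  [set z | s <= Num.max `|z.1 : R| `|z.2 : R|].

Lemma measurable_outside s : measurable (outside s).
Proof.
have m1 : measurable_fun setT (fun z : plane R => `|z.1 : R|).
  exact: (measurableT_comp (@normr_measurable R setT) measurable_fst).
have m2 : measurable_fun setT (fun z : plane R => `|z.2 : R|).
  exact: (measurableT_comp (@normr_measurable R setT) measurable_snd).
rewrite (_ : outside s = setT `&` ((fun z : plane R => Num.max `|z.1 : R| `|z.2 : R|) @^-1` `[s, +oo[)).
  apply: (measurable_maxr m1 m2) => //; exact: measurable_itv.
by apply/seteqP; split => z /=; rewrite in_itv /= andbT; [|move=> []].
Qed.

Section Grid.
Variables (a : R) (n : nat).
Hypothesis a_gt0 : 0 < a.

Let x0 : R := - (a * n%:R).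
Let K : finType := ('I_(n + n) * 'I_(n + n))%type.
Let cell (l : K) : set (plane R) := square x0 a l.1 l.2.

(* Distance from the origin, in grid steps, of the [i]-th of the [n + n] steps of [-a n, a n[. *)
Let q (i : nat) : nat := (n.-1 - i) + (i - n).

Let step_norm i x : (i < n + n)%N -> step x0 a i x -> a * (q i)%:R <= `|x| <= a * (q i).+1%:R.
Proof.
move=> ilt /stepP/andP[]; rewrite /x0 -natr1 => i1 i2.
have [ni|ni] := leqP n i.
  have E : (q i)%:R = (i%:R : R) - n%:R.
    by rewrite -natrB// /q; congr (_%:R); lia.
  have ain : a * n%:R <= a * i%:R by rewrite ler_pM2l// ler_nat.
  rewrite ger0_norm; last lra.
  by rewrite -[(q i).+1%:R]natr1 E; apply/andP; split; lra.
have E : (q i)%:R + i%:R + 1 = (n%:R : R).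
  by rewrite -natrD natr1; congr (_%:R); rewrite /q; lia.
have Ea : a * (q i)%:R + a * i%:R + a = a * n%:R by rewrite -E; ring.
have ai0 : 0 <= a * (q i)%:R by rewrite mulr_ge0// ltW.
rewrite ltr0_norm; last by lra.
by rewrite -[(q i).+1%:R]natr1 mulrDr mulr1; apply/andP; split; lra.
Qed.

Let sum_q (F : nat -> R) : \sum_(i < n + n) F (q i) = 2 * \sum_(i < n) F i.
Proof.
rewrite big_split_ord /= mulrDl mul1r; congr (_ + _); last first.
  by apply: eq_bigr => i _; congr F; rewrite /q; lia.
rewrite (reindex_inj rev_ord_inj); apply: eq_bigr => i _; congr F.
by have := ltn_ord i; rewrite /q /=; lia.
Qed.

Let sum_cells (F : nat -> nat -> R) :
  \sum_(l : K) F (q l.1) (q l.2) = 4 * \sum_(i < n) \sum_(j < n) F i j.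
Proof.
rewrite -(pair_bigA _ (fun i j : 'I_(n + n) => F (q i) (q j))) /=.
rewrite (eq_bigr (fun i : 'I_(n + n) => 2 * \sum_(j < n) F (q i) j)); last first.
  by move=> i _; rewrite (sum_q (F (q i))).
rewrite (sum_q (fun i => 2 * \sum_(j < n) F i j)) -mulr_sumr; ring.
Qed.

Let Box : set (plane R) := \big[setU/set0]_(l : K) cell l.

Let mcell l : measurable (cell l).
Proof. exact: measurable_square. Qed.

Let mBox : measurable Box.
Proof. exact: bigsetU_measurable. Qed.

Let BoxE : (\int[leb2]_(z in Box) (g (norm2 z))%:E = \sum_(l : K) \int[leb2]_(z in cell l) (g (norm2 z))%:E)%E.
Proof.
apply: ge0_integral_bigsetU => //.
- exact: index_enum_uniq.
- by move=> l l' _ _ H; exact: (@square_trivIset R x0 a (n + n) a_gt0 l l' Logic.I Logic.I H).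
- exact: (measurable_funS measurableT _ measurable_radial).
- by move=> z _; exact: radial_ge0.
Qed.

Let cell_ge (l : K) : ((gam a (q l.1).+1 (q l.2).+1 * a ^+ 2)%:E <= \int[leb2]_(z in cell l) (g (norm2 z))%:E)%E.
Proof.
rewrite EFinM -(leb2_square x0 l.1 l.2 a_gt0) -(integral_cst leb2 (mcell l)).
apply: ge0_le_integral => //.
- move=> z _ /=; rewrite lee_fin.
  by have /andP[] := g01 (mulr_ge0 (ltW a_gt0) (hyp_ge0 (q l.1).+1 (q l.2).+1)).
- exact: (measurable_funS measurableT _ measurable_radial).
move=> z [z1 z2] /=; rewrite lee_fin; apply: g_noninc; first exact: sqrtr_ge0.
have /andP[_ H1] := step_norm (ltn_ord l.1) z1.
have /andP[_ H2] := step_norm (ltn_ord l.2) z2.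
exact: sqrt_le_hyp.
Qed.

Let cell_le (l : K) : (\int[leb2]_(z in cell l) (g (norm2 z))%:E <= (gam a (q l.1) (q l.2) * a ^+ 2)%:E)%E.
Proof.
rewrite EFinM -(leb2_square x0 l.1 l.2 a_gt0) -(integral_cst leb2 (mcell l)).
apply: ge0_le_integral => //.
- by move=> z _; exact: radial_ge0.
- exact: (measurable_funS measurableT _ measurable_radial).
move=> z [z1 z2] /=; rewrite lee_fin; apply: g_noninc.
  by rewrite mulr_ge0 ?hyp_ge0// ltW.
have /andP[H1 _] := step_norm (ltn_ord l.1) z1.
have /andP[H2 _] := step_norm (ltn_ord l.2) z2.
exact: hyp_le_sqrt.
Qed.

(** On each cell of the box [g] is at least its value at the corner farthest from the origin; the 4
    counts the quadrants. [upper_lattice_sum] uses the nearest corner and charges the complement of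
    the box to [t]. *)
Lemma lower_lattice_sum : 4 * a ^+ 2 * \sum_(i < n) \sum_(j < n) gam a i.+1 j.+1 <= C.
Proof.
rewrite -lee_fin -C_int.
apply: (@le_trans _ _ (\int[leb2]_(z in Box) (g (norm2 z))%:E)%E); last first.
  apply: ge0_subset_integral => //; first exact: measurable_radial.
  by move=> z _; exact: radial_ge0.
rewrite BoxE; apply: (@le_trans _ _ (\sum_(l : K) (gam a (q l.1).+1 (q l.2).+1 * a ^+ 2)%:E)%E).
  rewrite sumEFin lee_fin -mulr_suml (sum_cells (fun i j => gam a i.+1 j.+1)).
  by rewrite mulrAC.
by apply: lee_sum => l _; exact: cell_ge.
Qed.

Lemma upper_lattice_sum (t : R) :
  (\int[leb2]_(z in outside (a * n%:R)) (g (norm2 z))%:E <= t%:E)%E ->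
  C <= 4 * a ^+ 2 * \sum_(i < n) \sum_(j < n) gam a i j + t.
Proof.
move=> tail; rewrite -lee_fin -C_int -(setUv Box).
rewrite ge0_integral_setU//; last 4 first.
- exact: measurableC.
- by rewrite setUv; exact: measurable_radial.
- by move=> z _; exact: radial_ge0.
- by rewrite disj_set2E setICr.
rewrite EFinD; apply: leeD.
  rewrite BoxE; apply: (@le_trans _ _ (\sum_(l : K) (gam a (q l.1) (q l.2) * a ^+ 2)%:E)%E).
    by apply: lee_sum => l _; exact: cell_le.
  rewrite sumEFin lee_fin -mulr_suml (sum_cells (gam a)).
  by rewrite mulrAC.
apply: le_trans tail; apply: ge0_subset_integral => //.
- exact: measurableC.
- exact: measurable_outside.
- exact: (measurable_funS measurableT _ measurable_radial).
- by move=> z _; exact: radial_ge0.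
move=> z /= zB; rewrite /outside /= leNgt; apply/negP; rewrite gt_max !ltr_norml => /andP[/andP[z1 z1'] /andP[z2 z2']].
have H (x : R) : - (a * n%:R) < x -> x < a * n%:R -> exists i : 'I_(n + n), step x0 a i x.
  move=> h1 h2; apply: step_cover => //; rewrite /x0 natrD; apply/andP; split; lra.
have [i zi] := H _ z1 z1'; have [j zj] := H _ z2 z2'.
by apply: zB; rewrite /Box -bigcup_seq; exists (i, j) => //=; rewrite mem_index_enum.
Qed.

End Grid.

Section Decay.
Variable s0 : R.
Hypothesis s0_ge4 : 4 <= s0.
Hypothesis s0_gee : expR 1 <= s0.
Hypothesis g_decay : forall x, s0 <= x -> g x <= (x ^+ 2 * ln x ^+ 2)^-1.

Lemma sum_inverse_square_le (A c : R) n : 0 < c -> 2 * c <= A ->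
  \sum_(k < n) ((A + k%:R * c) ^+ 2)^-1 <= 2 / (c * A).
Proof.
move=> c0 cA.
(* Telescoping of [c / x ^+ 2 <= (x - c)^-1 - x^-1]; then [2 * c <= A] gives
   [(A - c)^-1 <= 2 / A]. *)
have H : c * \sum_(k < n) ((A + k%:R * c) ^+ 2)^-1 <= (A - c)^-1 - (A + n%:R * c - c)^-1.
  elim: n => [|n IH]; first by rewrite big_ord0 mulr0 mul0r addr0 subrr.
  rewrite big_ord_recr /= mulrDr; apply: le_trans (lerD IH (lexx _)) _.
  have nc : 0 <= n%:R * c by rewrite mulr_ge0// ltW.
  set x := A + n%:R * c; have -> : A + n.+1%:R * c - c = x by rewrite /x -natr1; ring.
  have xc : 0 < x - c by rewrite /x; lra.
  have x0 : 0 < x by lra.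
  rewrite -addrA lerD2l [leLHS]addrC lerBlDl.
  have -> : (x - c)^-1 - x^-1 = c / ((x - c) * x) by field; rewrite !gt_eqF.
  rewrite ler_pM2l// lef_pV2 ?posrE ?exprn_gt0 ?mulr_gt0// expr2 ler_pM2r//; lra.
rewrite -(ler_pM2l c0); apply: (le_trans H).
have nc : 0 <= n%:R * c by rewrite mulr_ge0// ltW.
have -> : c * (2 / (c * A)) = 2 / A by field; rewrite !gt_eqF//; lra.
have h1 : 0 <= (A + n%:R * c - c)^-1 by rewrite invr_ge0; lra.
suff h2 : (A - c)^-1 <= 2 / A by lra.
rewrite -[(A - c)^-1]mul1r ler_pdivrMr; last lra.
rewrite mulrAC ler_pdivlMr; lra.
Qed.

Lemma tail_mass_le s : s0 <= s ->
  (\int[leb2]_(z in outside s) (g (norm2 z))%:E <= (32 / ln 2 / ln s)%:E)%E.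
Proof.
move=> s0s; have sgt0 : 0 < s by move: s0_ge4; lra.
have c0 : 0 < ln 2 :> R by rewrite ln_gt0 // ltr1n.
have A2 : 2 * ln 2 <= ln s.
  rewrite mulr_natl -lnXn// ler_ln ?posrE ?exprn_gt0//.
  by rewrite expr2; move: s0_ge4 s0s; lra.
(* Dyadic squares: on the annulus of inner radius [s 2^k], of area of order
   [(s 2^k)^2], [g] is at most [(s 2^k (ln s + k ln 2))^-2]. *)
pose big k : set (plane R) := `[- (s * 2 ^+ k.+1), s * 2 ^+ k.+1]%classic `*` `[- (s * 2 ^+ k.+1), s * 2 ^+ k.+1]%classic.
have p2 k : 0 < 2 ^+ k :> R by rewrite exprn_gt0.
have sk k : 0 < s * 2 ^+ k by rewrite mulr_gt0.
have gk0 k : 0 <= g (s * 2 ^+ k) by have /andP[] := g01 (ltW (sk k)).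
have mbig k : measurable (big k) by apply: measurableX; exact: measurable_itv.
have leb_big k : leb2 (big k) = ((4 * (s * 2 ^+ k)) ^+ 2)%:E.
  rewrite /big leb2X; [|exact: measurable_itv..].
  rewrite lebesgue_measure_itv /= lte_fin ifT; last by have := sk k.+1; lra.
  by rewrite -EFinB -EFinM; congr EFin; rewrite exprS; ring.
pose F k (z : plane R) := ((g (s * 2 ^+ k))%:E * (\1_(big k) z)%:E)%E.
have mF k : measurable_fun (outside s) (F k).
  apply: (measurable_funS measurableT) => //; apply: measurable_funeM.
  by apply/measurable_EFinP; exact: measurable_indic.
have F0 k z : outside s z -> (0 <= F k z)%E.
  by move=> _; rewrite mule_ge0// lee_fin.
apply: (@le_trans _ _ (\int[leb2]_(z in outside s) (\sum_(k <oo) F k z))%E).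
  apply: ge0_le_integral => //.
  - exact: measurable_outside.
  - by move=> z _; exact: radial_ge0.
  - exact: (measurable_funS measurableT _ measurable_radial).
  - by apply: ge0_emeasurable_sum => // k z zs _; exact: F0.
  move=> z zs; set M := Num.max `|z.1 : R| `|z.2 : R|.
  have sM : s <= M by exact: zs.
  have ex : exists k, M <= s * 2 ^+ k.+1.
    exists (Num.truncn (M / s)); rewrite mulrC -ler_pdivrMr//.
    have /andP[_ /ltW] := Num.Theory.truncn_itv (divr_ge0 (le_trans (ltW sgt0) sM) (ltW sgt0)).
    move=> /le_trans; apply; rewrite -natrX ler_nat; apply: ltnW; exact: ltn_expl.
  (* The first dyadic square that contains [z]: by minimality [z] lies beyond radius [s * 2 ^+ k],
     so its value of [g] is at most the coefficient of [F k]. *)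
  case: (ex_minnP ex) => k kM kmin.
  have skM : s * 2 ^+ k <= M.
    case: k kmin {kM} => [|k] kmin; first by rewrite expr0 mulr1.
    by rewrite leNgt; apply/negP => /ltW /kmin; rewrite ltnn.
  apply: (@le_trans _ _ (F k z)); last first.
    rewrite (@nneseriesD1 R (F ^~ z) k xpredT) ?leeDl//; last by move=> i _; exact: F0.
    by apply: nneseries_ge0 => i _ _; exact: F0.
  rewrite /F indicE mem_set ?mule1.
    rewrite lee_fin; apply: g_noninc; first exact: ltW.
    apply: (le_trans skM); rewrite /M ge_max; apply/andP; split;
      by rewrite -sqrtr_sqr; apply: ler_wsqrtr; rewrite ?lerDl ?lerDr sqr_ge0.
  by move: kM; rewrite /M ge_max /big /= !in_itv /= !ler_norml => /andP[].
rewrite integral_nneseries//; last exact: measurable_outside.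
(* The 16 is the area of [big k], a square of side [4 * (s * 2 ^+ k)], over [(s * 2 ^+ k) ^+ 2]. *)
have B k : (\int[leb2]_(z in outside s) F k z <= (16 * ((ln s + k%:R * ln 2) ^+ 2)^-1)%:E)%E.
  rewrite /F ge0_integralZl//; last 3 first.
  - exact: measurable_outside.
  - by apply/measurable_EFinP; apply: (measurable_funS measurableT) => //; exact: measurable_indic.
  - by rewrite lee_fin.
  rewrite integral_indic//; last exact: measurable_outside.
  apply: (@le_trans _ _ ((g (s * 2 ^+ k))%:E * leb2 (big k))%E).
    apply: lee_pmul; rewrite ?lee_fin//; apply: le_measure; rewrite ?inE//.
    by apply: measurableI => //; exact: measurable_outside.
  rewrite leb_big -EFinM lee_fin.
  have x0 : s0 <= s * 2 ^+ k.
    apply: (le_trans s0s); rewrite ler_peMr ?(ltW sgt0)//; apply: exprn_ege1; lra.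
  apply: (le_trans (ler_wpM2r (sqr_ge0 _) (g_decay x0))).
  have lnE : ln (s * 2 ^+ k) = ln s + k%:R * ln 2.
    by rewrite lnM ?posrE// lnXn// mulr_natl.
  rewrite lnE le_eqVlt; apply/orP; left; apply/eqP; field.
  rewrite !gt_eqF//; have : 0 <= k%:R * ln 2 :> R by rewrite mulr_ge0// ltW.
  by move: (ln s) (ln 2) (k%:R) A2 c0 => A c kk h1 h2 h3; lra.
apply: (@le_trans _ _ (\sum_(k <oo) (16 * ((ln s + k%:R * ln 2) ^+ 2)^-1)%:E)%E).
  by apply: lee_nneseries => // k _ _; apply: integral_ge0 => z; exact: F0.
apply: lime_le.
  by apply: is_cvg_nneseries => k _ _; rewrite lee_fin mulr_ge0// invr_ge0 sqr_ge0.
apply: nearW => n; rewrite big_mkord sumEFin lee_fin -mulr_sumr.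
have := sum_inverse_square_le n c0 A2.
have -> : 32 / ln 2 / ln s = 16 * (2 / (ln 2 * ln s)) :> R.
  by field; rewrite !gt_eqF//; lra.
by rewrite ler_pM2l.
Qed.

(** The square serves [x <= s0], where [g <= 1]; the 4 serves [x > s0], where [g x * x ^+ 2 <= 1]
    and [1 + x <= 2 * x]. *)
Let Kg : R := (1 + s0) ^+ 2 + 4.

Lemma radial_decay x : 0 <= x -> g x <= Kg / (1 + x) ^+ 2.
Proof.
move=> x0; have s04 := s0_ge4; have se := s0_gee.
rewrite ler_pdivlMr; last by rewrite exprn_gt0//; lra.
have /andP[gx0 gx1] := g01 x0.
have [xs|sx] := leP x s0.
  apply: (@le_trans _ _ (1 * (1 + x) ^+ 2)); first by rewrite ler_wpM2r// sqr_ge0.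
  rewrite mul1r /Kg; have : (1 + x) ^+ 2 <= (1 + s0) ^+ 2 by rewrite lerXn2r ?nnegrE; lra.
  lra.
have lnx : 1 <= ln x.
  rewrite -[leLHS]expRK ler_ln ?posrE ?expR_gt0//; lra.
have h := g_decay (ltW sx).
have h2 : g x * x ^+ 2 <= 1.
  rewrite -ler_pdivlMr ?exprn_gt0 ?div1r//; last lra.
  apply: (le_trans h); rewrite lef_pV2 ?posrE ?mulr_gt0 ?exprn_gt0//; try lra.
  by rewrite ler_peMr ?sqr_ge0// exprn_ege1.
have : (1 + x) ^+ 2 <= 4 * x ^+ 2 by rewrite -subr_ge0 (_ : _ - _ = (3 * x + 1) * (x - 1)); [apply: mulr_ge0; lra|ring].
move=> /(ler_wpM2l gx0) h3.
have : 0 <= (1 + s0) ^+ 2 by exact: sqr_ge0.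
rewrite /Kg; lra.
Qed.

(** [a / (1 + x) ^+ 2] is at most twice the increment of [- (1 + x)^-1] over a step [a <= 1], and
    these increments telescope to less than 1. *)
Lemma axis_sum_le a n : 0 < a -> a <= 1 -> \sum_(i < n) g (a * i%:R) <= 2 * Kg / a.
Proof.
move=> a0 a1; have Kg0 : 0 <= Kg by rewrite addr_ge0// sqr_ge0.
have ai0 i : 0 <= a * i%:R by rewrite mulr_ge0// ltW.
rewrite ler_pdivlMr// mulr_suml.
have H : \sum_(i < n) ((1 + a * i%:R)^-1 - (1 + a * i.+1%:R)^-1) <= 1.
  suff -> : \sum_(i < n) ((1 + a * i%:R)^-1 - (1 + a * i.+1%:R)^-1) = 1 - (1 + a * n%:R)^-1.
    by rewrite gerBl invr_ge0 addr_ge0.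
  elim: n => [|n IH]; first by rewrite big_ord0 mulr0 addr0 invr1 subrr.
  by rewrite big_ord_recr /= IH addrA subrK.
apply: (@le_trans _ _ (\sum_(i < n) 2 * Kg * ((1 + a * i%:R)^-1 - (1 + a * i.+1%:R)^-1))); last first.
  by rewrite -mulr_sumr -[leRHS]mulr1 ler_wpM2l// mulr_ge0.
apply: ler_sum => i _.
apply: (@le_trans _ _ (Kg / (1 + a * i%:R) ^+ 2 * a)).
  by rewrite ler_wpM2r ?(ltW a0)// radial_decay.
have := ai0 i; rewrite -[i.+1%:R]natr1; move: (a * i%:R) (mulrDr a i%:R 1) => y -> y0.
have -> : (1 + y)^-1 - (1 + (y + a * 1))^-1 = a / ((1 + y) * (1 + y + a)).
  by rewrite mulr1; field; rewrite !gt_eqF//; lra.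
rewrite -mulrA [2 * Kg]mulrC -mulrA ler_wpM2l// mulrA [2 * a]mulrC -mulrA.
rewrite mulrC ler_pM2l//.
rewrite ler_pdivlMr; last by rewrite mulr_gt0; lra.
rewrite mulrC ler_pdivrMr; last by rewrite exprn_gt0; lra.
nra.
Qed.

Lemma gam_axis_l a n : 0 < a -> a <= 1 -> \sum_(i < n) gam a i 0 <= 2 * Kg / a.
Proof.
move=> a0 a1; apply: le_trans (axis_sum_le n a0 a1); apply: ler_sum => i _.
apply: g_noninc; first by rewrite mulr_ge0// ltW.
by rewrite ler_pM2l//; have := hyp_ge i 0 (R := R); rewrite maxn0.
Qed.

Lemma gam_axis_r a n : 0 < a -> a <= 1 -> \sum_(j < n) gam a 0 j <= 2 * Kg / a.
Proof.
move=> a0 a1; apply: le_trans (axis_sum_le n a0 a1); apply: ler_sum => i _.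
apply: g_noninc; first by rewrite mulr_ge0// ltW.
by rewrite ler_pM2l//; have := hyp_ge 0 i (R := R); rewrite max0n.
Qed.

End Decay.

End RadialMass.

(** * Bounds at a fixed density and mesh *)

Section FixedDensity.
Context {R : realType}.
Variable g : R -> R.
Hypothesis g01 : forall x : R, 0 <= x -> 0 <= g x <= 1.
Hypothesis g_noninc : forall x y : R, 0 <= x -> x <= y -> g y <= g x.

Lemma gam01 (a : R) i j : 0 < a -> 0 <= gam g a i j <= 1.
Proof. by move=> a0; apply: g01; rewrite mulr_ge0 ?hyp_ge0// ltW. Qed.

Lemma gam_mono (a : R) i j i' j' : 0 < a -> (i <= i')%N -> (j <= j')%N ->
  gam g a i' j' <= gam g a i j.
Proof.
move=> a0 ii jj; apply: g_noninc; first by rewrite mulr_ge0 ?hyp_ge0// ltW.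
by rewrite ler_pM2l// hyp_mono.
Qed.

Context d (T : measurableType d) (P : probability T R) (N : network R T).
Variables (rho r : R).
Hypothesis rho_gt0 : 0 < rho.
Hypothesis r_gt0 : 0 < r.
Hypothesis rcn : random_connection_network P N rho (fun x => g (x / r)).

Let conn01 x : 0 <= x -> 0 <= g (x / r) <= 1.
Proof. by move=> x0; apply: g01; rewrite divr_ge0// ltW. Qed.

Let conn_noninc x y : 0 <= x -> x <= y -> g (y / r) <= g (x / r).
Proof.
move=> x0 xy; apply: g_noninc; first by rewrite divr_ge0// ltW.
by rewrite ler_pM2r// invr_gt0.
Qed.

Section Mesh.
Variables (m : nat) (r' : R).
Hypothesis m_gt0 : (0 < m)%N.
Hypothesis r'_gt0 : 0 < r'.
Hypothesis r'r : r' <= r.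

Let a := m%:R^-1 / r'.
Let mu := rho / m%:R ^+ 2.
Let K : finType := ('I_m * 'I_m)%type.

Let mR : 0 < m%:R^-1 :> R. Proof. by rewrite invr_gt0 ltr0n. Qed.

Lemma mesh_gt0 : 0 < a. Proof. by rewrite /a divr_gt0. Qed.

Lemma intensity_gt0 : 0 < mu. Proof. by rewrite /mu divr_gt0// exprn_gt0// ltr0n. Qed.

Lemma unit_cell_intensity (l : K) : rho * fine (leb2 (unit_cell l : set (plane R))) = mu.
Proof. by rewrite /unit_cell leb2_square//= exprVn. Qed.

Lemma unit_cell_gl (k l : K) (x y : plane R) : unit_cell k x -> unit_cell l y ->
  gam g a (dn k.1 l.1).+1 (dn k.2 l.2).+1 <= g (dist2 x y / r).
Proof.
move=> kx ly; apply: g_noninc; first by rewrite divr_ge0 ?dist2_ge0// ltW.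
have := square_dist_le mR kx ly; set H := hyp _ _ => le.
have H0 : 0 <= H by exact: hyp_ge0.
rewrite ler_pdivrMr//; apply: (le_trans le).
rewrite /a -!mulrA ler_pM2l// mulrCA ler_peMr//.
by rewrite mulrC ler_pdivlMr// mul1r.
Qed.

Lemma unit_cell_gu (k l : K) (x y : plane R) : r' = r -> unit_cell k x -> unit_cell l y ->
  g (dist2 x y / r) <= gam g a (dn k.1 l.1).-1 (dn k.2 l.2).-1.
Proof.
move=> rE kx ly; apply: g_noninc; first by rewrite mulr_ge0 ?hyp_ge0// ltW// mesh_gt0.
have := square_dist_ge mR kx ly; set H := hyp _ _ => le.
by rewrite ler_pdivlMr// /a rE mulrAC divfK// gt_eqF.
Qed.

Let gl (k l : K) := gam g a (dn k.1 l.1).+1 (dn k.2 l.2).+1.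

Let gl01 k l : 0 <= gl k l <= 1. Proof. exact: gam01 mesh_gt0. Qed.

(* The mesh sums are computed at a radius [r' <= r]: as [g] is non-increasing,
   this only increases the bound, and allows [b] to be truncated at [ln rho]. *)
Lemma has_isolated_node_bound :
  (P (has_isolated_node N) <= (rho * mu + mu * expR mu *
     \sum_(k : K) expR (- (mu * \sum_(l : K) gl k l)))%:E)%E.
Proof.
have [mN lC pN iN] := rcn; have mu0 := intensity_gt0.
have mcell (k : K) : measurable (unit_cell k : set (plane R)) by exact: measurable_square.
have := has_isolated_node_le mN lC pN iN conn01 conn_noninc mcell (@square_trivIset R (- 2^-1) m%:R^-1 m mR)
  (@unit_cell_sub R m m_gt0) (unit_cell_cover m_gt0) unit_cell_intensity (ltW mu0) gl01 unit_cell_gl.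
move=> /le_trans; apply.
rewrite lee_fin big_split /=; apply: lerD.
  rewrite sumr_const card_prod card_ord -mulr_natl natrM expr2 mulrA ler_pM2r//.
  by rewrite /mu expr2 mulrC divfK// mulf_neq0// pnatr_eq0 -lt0n.
rewrite -mulrA mulr_sumr mulr_sumr; apply: ler_sum => k _.
(* The factor [expR mu] pays for restoring the term [l = k] to the sum. *)
rewrite ler_pM2l// -expRD ler_expR [in leRHS](bigD1 k)//= -mulr_sumr mulrDr opprD addrA lerDr.
by have /andP[_ h] := gl01 k k; rewrite subr_ge0 ler_piMr// ltW.
Qed.

Let mass (k : K) : R := mu * \sum_(l : K) gl k l.

Let prob_alone (k : K) : R := fine (P (alone N (unit_cell (R := R) (m := m)) k)).

Let prob_alone2 (k l : K) : R :=
  fine (P (alone N (unit_cell (R := R) (m := m)) k `&` alone N (unit_cell (R := R) (m := m)) l)).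

Let mcell (k : K) : measurable (unit_cell k : set (plane R)).
Proof. exact: measurable_square. Qed.

(** Expressed with the same [mass k] as the upper bounds, so that the two can be compared. In
    [9 + 16 * X], [8 + 16 * X] is the oscillation of [gam] over cells and 1 comes from the count of
    [k] itself. *)
Lemma prob_alone_ge (X : R) (k : K) : r' = r ->
  (forall n, \sum_(i < n) gam g a i 0 <= X) -> (forall n, \sum_(j < n) gam g a 0 j <= X) ->
  mu * expR (- (mass k + mu * (9 + 16 * X))) <= prob_alone k.
Proof.
move=> rE Xi Xj; have [mN lC pN iN] := rcn; have mu0 := intensity_gt0.
pose gu (k l : K) := gam g a (dn k.1 l.1).-1 (dn k.2 l.2).-1.
have gu01 l : 0 <= gu k l <= 1 by exact: gam01 mesh_gt0.
have := alone_ge mN lC pN iN conn01 conn_noninc mcell (@square_trivIset R (- 2^-1) m%:R^-1 m mR)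
  (@unit_cell_sub R m m_gt0) (unit_cell_cover m_gt0) unit_cell_intensity (ltW mu0) gu01.
move=> /(_ (fun l x y => @unit_cell_gu k l x y rE)) H.
have {H} : mu * expR (- mu) * \prod_(l | l != k) expR (- (mu * gu k l)) <= prob_alone k.
  rewrite -lee_fin fineK// fin_num_measure//.
  exact: measurable_alone.
apply: le_trans; rewrite -expR_sum -mulrA -expRD ler_pM2l// ler_expR sumrN -opprD lerN2 -mulr_sumr.
apply: (@le_trans _ _ (mu * (1 + \sum_(l : K) gu k l))).
  rewrite mulrDr mulr1 lerD2l ler_pM2l// [leRHS](bigD1 k)//= lerDr.
  by have /andP[] := gu01 k.
rewrite /mass -mulrDr ler_pM2l//.
have := grid_oscillation_le (fun i j => proj1 (andP (gam01 i j mesh_gt0)))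
  (fun i j => proj2 (andP (gam01 i j mesh_gt0)))
  (fun i j => gam_mono mesh_gt0 (leqnSn i) (leqnn j))
  (fun i j => gam_mono mesh_gt0 (leqnn i) (leqnSn j)) k Xi Xj.
rewrite -/(gl k) /gu /gl; lra.
Qed.

(** The summand is [1 - (1 - x) * (1 - y)], from the chance of missing both nodes; [2 * mu] covers
    the restored terms [l = k] and [l = k']. *)
Lemma prob_alone2_le (k k' : K) : k != k' ->
  prob_alone2 k k' <= mu ^+ 2 * expR (2 * mu -
    mu * \sum_(l : K) (gl k l + gl k' l - gl k l * gl k' l)).
Proof.
move=> kk; have [mN lC pN iN] := rcn; have mu0 := intensity_gt0.
have kE : alone N (unit_cell (R := R) (m := m)) k `&` alone N (unit_cell (R := R) (m := m)) k' =
    all_alone N (unit_cell (R := R) (m := m)) [set k; k']%SET.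
  apply/seteqP; split => w; first by move=> [h h'] l /=; rewrite !inE => /orP[] /eqP ->.
  by move=> h; split; apply: h; rewrite /= !inE eqxx ?orbT.
have := all_alone_le mN lC pN iN conn01 conn_noninc mcell (@square_trivIset R (- 2^-1) m%:R^-1 m mR)
  (@unit_cell_sub R m m_gt0) (unit_cell_cover m_gt0) unit_cell_intensity (ltW mu0) [set k; k']%SET gl01 unit_cell_gl.
rewrite cards2 kk -kE => H.
have {H} H : prob_alone2 k k' <= (mu * expR (- mu)) ^+ 2 *
    \prod_(l | l \notin [set k; k']%SET) expR (- (mu * (1 - \prod_(k0 in [set k; k']%SET) (1 - gl k0 l)))).
  rewrite -lee_fin fineK// fin_num_measure//.
  by apply: measurableI; exact: measurable_alone.
apply: (le_trans H); rewrite -expR_sum exprMn -mulrA ler_pM2l ?exprn_gt0//.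
pose w l := gl k l + gl k' l - gl k l * gl k' l.
rewrite (eq_bigr (fun l => - (mu * w l))); last first.
  move=> l _; rewrite big_setU1 ?inE//= big_set1 /w; ring.
rewrite -expRM_natl -expRD ler_expR sumrN -mulr_sumr mulrN -opprD.
have w1 l : w l <= 1.
  have /andP[a0 a1] := gl01 k l; have /andP[b0 b1] := gl01 k' l; rewrite /w; nra.
have sw : \sum_l w l <= 2 + \sum_(l | l \notin [set k; k']%SET) w l.
  rewrite (bigID (mem [set k; k']%SET)) /= lerD2r.
  by rewrite big_setU1 ?inE//= big_set1 (_ : 2 = 1 + 1) ?lerD.
have := ler_wpM2l (ltW mu0) sw; rewrite mulrDr -/(w _); lra.
Qed.

End Mesh.

(** [M] bounds from below the expected number of alone cells in the central block of [2 h] by [2 h]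
    cells. The three error terms come from the diagonal, from the far pairs, which overlap by a
    fraction [ep] of their masses, and from the near pairs, less than [p] cells apart in both
    coordinates. [n0] and [I] are the depths up to which [gam] is at least [al] and from which it is
    at most [al / 2], as the lune bound requires. *)
Lemma no_isolated_node_bound (h n0 I p : nat) (al ep X L ka dl M G : R) :
  let m := (h + h + h + h)%N in let a := m%:R^-1 / r in let mu := rho / m%:R ^+ 2 in
  (0 < h)%N -> (n0 <= h)%N -> (I <= h)%N -> 0 <= ep ->
  mu * (4 * \sum_(i < m) \sum_(j < m) gam g a i.+1 j.+1) <= L ->
  (forall n, \sum_(i < n) gam g a i 0 <= X) -> (forall n, \sum_(j < n) gam g a 0 j <= X) ->
  (forall i j, (i < n0)%N -> (j < n0)%N -> al <= gam g a i.+1 j.+1) ->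
  (forall i j, (I <= i)%N || (I <= j)%N -> gam g a i.+1 j.+1 <= al / 2) ->
  (forall i j, (p <= i + i)%N || (p <= j + j)%N -> gam g a i.+1 j.+1 <= ep) ->
  ka = mu * (n0%:R * (al / 4)) ->
  \sum_(u < p) expR (- (ka * (minn u n0)%:R)) <= G -> dl = mu * (9 + 16 * X) ->
  M = 4 * (h%:R ^+ 2 * (mu * expR (- (L + dl)))) ->
  (P (~` has_isolated_node N) <= (M^-1 + (expR (2 * dl + 2 * mu + 2 * (ep * L)) - 1) +
    mu * expR (dl + 2 * mu) * (4 * G ^+ 2) / M)%:E)%E.
Proof.
move=> m a mu h0 nh Ih ep0 HL Xi Xj Hal HI Hep kaE HG dlE ME.
have m0 : (0 < m)%N by rewrite /m; lia.
have a0 : 0 < a by exact: mesh_gt0.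
have mu0 : 0 < mu by exact: intensity_gt0.
have g0 i j : 0 <= gam g a i j by have /andP[] := gam01 i j a0.
have g1 i j : gam g a i j <= 1 by have /andP[] := gam01 i j a0.
have gi i j : gam g a i.+1 j <= gam g a i j by apply: gam_mono.
have gj i j : gam g a i j.+1 <= gam g a i j by apply: gam_mono.
pose K : finType := ('I_m * 'I_m)%type.
pose gl (k l : K) := gam g a (dn k.1 l.1).+1 (dn k.2 l.2).+1.
pose mass (k : K) := mu * \sum_(l : K) gl k l.
have massL k : mass k <= L.
  apply: le_trans HL; rewrite ler_pM2l//.
  exact: (grid_sum_le k (F := fun i j => gam g a i.+1 j.+1)).
pose p1 (k : K) : R := fine (P (alone N (unit_cell (R := R) (m := m)) k)).
pose p2 (k l : K) : R := fine (P (alone N (unit_cell (R := R) (m := m)) k `&` alone N (unit_cell (R := R) (m := m)) l)).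
have p1ge k : mu * expR (- (mass k + dl)) <= p1 k.
  rewrite dlE; exact: (prob_alone_ge m0 r_gt0 k erefl Xi Xj).
have p2le k l : k != l -> p2 k l <= mu ^+ 2 * expR (2 * mu -
    mu * \sum_(c : K) (gl k c + gl l c - gl k c * gl l c)).
  by move=> kl; exact: (prob_alone2_le m0 r_gt0 (lexx r) kl).
pose inner := [set i : 'I_m | (h <= i < h + h + h)%N]%SET.
have card_inner : #|inner| = (h + h)%N.
  rewrite -sum1_card big_mkcond /= !big_split_ord /=.
  rewrite [X in (X + _ + _ + _)%N]big1 => [|i _]; last by rewrite inE /= leqNgt ltn_ord.
  rewrite [X in (_ + _ + _ + X)%N]big1 => [|i _]; last by rewrite inE /= [(_ + i < _)%N]ltnNge leq_addr andbF.
  rewrite (eq_bigr (fun=> 1%N)) => [|i _]; last first.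
    by rewrite inE /=; have := ltn_ord i; case: ifP => //; lia.
  rewrite [X in (_ + X + _)%N](eq_bigr (fun=> 1%N)) => [|i _]; last first.
    by rewrite inE /=; have := ltn_ord i; case: ifP => //; lia.
  by rewrite !sum1_card !card_ord; lia.
pose J := finset.setX inner inner.
have JP k : k \in J -> (h <= k.1 < h + h + h)%N /\ (h <= k.2 < h + h + h)%N.
  by rewrite !inE => /andP[].
have p10 k : 0 < p1 k by apply: lt_le_trans (p1ge k); rewrite mulr_gt0// expR_gt0.
pose S1 := \sum_(k in J) p1 k.
have M_gt0 : 0 < M by rewrite ME mulr_gt0// mulr_gt0 ?exprn_gt0 ?ltr0n// mulr_gt0 ?expR_gt0//.
have MS1 : M <= S1.
  apply: (@le_trans _ _ (\sum_(k in J) mu * expR (- (L + dl)))).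
    rewrite sumr_const cardsX card_inner -mulr_natl natrM natrD ME; lra.
  apply: ler_sum => k _; apply: le_trans (p1ge k).
  by rewrite ler_pM2l// ler_expR lerN2 lerD2r.
have S1_gt0 : 0 < S1 by exact: lt_le_trans MS1.
pose E1 := expR (2 * dl + 2 * mu + 2 * (ep * L)).
pose c2 := mu * expR (dl + 2 * mu).
pose near (k l : K) := (dn k.1 l.1 < p)%N && (dn k.2 l.2 < p)%N.
pose e (k l : K) := expR (- (ka * ((minn (dn k.1 l.1) n0)%:R + (minn (dn k.2 l.2) n0)%:R))).
have c20 : 0 <= c2 by rewrite mulr_ge0 ?expR_ge0 ?(ltW mu0).
have e0 k l : 0 <= e k l by exact: expR_ge0.
(* Every case keeps the factor [p1 k] itself: summation over [k] then gives [S1], and no uniform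
   upper bound on [p1] is called for. *)
have pt k l : k \in J -> l \in J -> p2 k l <= (if l == k then p1 k else 0) +
    ((if near k l then p1 k * (c2 * e k l) else 0) + E1 * p1 k * p1 l).
  move=> kJ lJ.
  have E1p : 0 <= E1 * p1 k * p1 l by rewrite mulr_ge0 ?(ltW (p10 _))// mulr_ge0 ?expR_ge0 ?(ltW (p10 _)).
  have ne0 : 0 <= (if near k l then p1 k * (c2 * e k l) else 0).
    by case: ifP => // _; rewrite mulr_ge0 ?(ltW (p10 _))// mulr_ge0.
  move: E1p ne0; have [->|lk] := eqVneq l k => E1p ne0.
    by rewrite /p2 setIid lerDl addr_ge0.
  have kl : k != l by rewrite eq_sym.
  rewrite add0r; have p2b := p2le _ _ kl.
  case: (boolP (near k l)) => [_|].
    apply: (@le_trans _ _ (p1 k * (c2 * e k l))); last by rewrite lerDl.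
    apply: (le_trans p2b).
    apply: (@le_trans _ _ (mu * expR (- (mass k + dl)) * (c2 * e k l))); last first.
      by rewrite ler_wpM2r// mulr_ge0.
    rewrite /c2 /e (_ : mu * _ * _ = mu ^+ 2 * (expR (- (mass k + dl)) * (expR (dl + 2 * mu) *
      expR (- (ka * ((minn (dn k.1 l.1) n0)%:R + (minn (dn k.2 l.2) n0)%:R)))))); last by ring.
    rewrite -!expRD ler_pM2l ?exprn_gt0// ler_expR.
    have [k1 k2] := JP _ kJ; have [l1 l2] := JP _ lJ.
    have H : mu * (n0%:R * (al / 4 * ((minn (dn k.1 l.1) n0)%:R + (minn (dn k.2 l.2) n0)%:R))) <=
        mu * \sum_(c : K) gl l c * (1 - gl k c).
      by rewrite ler_pM2l//; exact: (lune_ge_sym g0 g1 gi gj k1 l1 k2 l2 nh Ih Hal HI).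
    (* The mass of the union is that of [k] plus that of the lune at [l]. *)
    have -> : \sum_(c : K) (gl k c + gl l c - gl k c * gl l c) =
      \sum_(c : K) gl k c + \sum_(c : K) gl l c * (1 - gl k c).
      by rewrite -big_split /=; apply: eq_bigr => c _; ring.
    rewrite mulrDr -/(mass k) kaE.
    move: H; move: (\sum_(c : K) gl l c * (1 - gl k c)) (mass k) (_ + _) => z y W; lra.
  rewrite negb_and -!leqNgt => far; rewrite add0r; apply: (le_trans p2b).
  have := far_overlap_le g0 Hep far; rewrite -/(gl k _).
  move=> /(ler_wpM2l (ltW mu0)) H.
  apply: (@le_trans _ _ (E1 * (mu * expR (- (mass k + dl))) * (mu * expR (- (mass l + dl))))); last first.
    have q0 x : 0 <= mu * expR x by rewrite mulr_ge0 ?expR_ge0 ?(ltW mu0).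
    apply: ler_pM => //; first by rewrite mulr_ge0// expR_ge0.
    by apply: ler_wpM2l => //; exact: expR_ge0.
  rewrite /E1 (_ : _ * _ * _ = mu ^+ 2 * (expR (2 * dl + 2 * mu + 2 * (ep * L)) *
    (expR (- (mass k + dl)) * expR (- (mass l + dl))))); last by ring.
  rewrite -!expRD ler_pM2l ?exprn_gt0// ler_expR.
  rewrite sumrB big_split /=.
  have h1 := ler_wpM2l ep0 (massL k); have h2 := ler_wpM2l ep0 (massL l).
  move: H h1 h2; rewrite /mass /gl.
  move: (\sum_(c : K) _) (\sum_(c : K) _) (\sum_(c : K) _) => z1 z2 z3; nra.
have row k : k \in J -> \sum_(l in J) p2 k l <= p1 k + (p1 k * (c2 * (4 * G ^+ 2)) + E1 * p1 k * S1).
  move=> kJ; apply: (le_trans (ler_sum _ (fun l lJ => pt k l kJ lJ))).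
  rewrite big_split /= lerD//.
    by rewrite -big_mkcondr (big_pred1 k) // => l /=; case: eqVneq => [->|]; rewrite ?kJ ?andbF.
  rewrite big_split /= lerD// -?mulr_sumr//.
  rewrite -big_mkcondr /= -mulr_sumr ler_pM2l// -mulr_sumr ler_wpM2l//.
  apply: le_trans (near_sum_le k HG).
  rewrite [leRHS]big_mkcond [leLHS]big_mkcond; apply: ler_sum => l _ /=.
  by rewrite /near; case: ifP => [/andP[_ ->]//|_]; case: ifP.
have total : \sum_(k in J) \sum_(l in J) p2 k l <= S1 + (S1 * (c2 * (4 * G ^+ 2)) + E1 * S1 * S1).
  apply: (le_trans (ler_sum _ row)).
  by rewrite !big_split /= -mulr_suml -mulr_suml -mulr_sumr.
have [mN lC pN iN] := rcn.
have mcell (k : K) : measurable (unit_cell k : set (plane R)) by exact: measurable_square.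
have := no_isolated_node_second_moment mN mcell S1_gt0 (erefl S1).
move=> /le_trans; apply; rewrite lee_fin.
set B := _ * (4 * _) in total *.
have B0 : 0 <= B by rewrite mulr_ge0// mulr_ge0// sqr_ge0.
apply: (@le_trans _ _ ((S1 + (S1 * B + E1 * S1 * S1)) / S1 ^+ 2 - 1)).
  by rewrite lerD2r ler_pM2r// invr_gt0 exprn_gt0.
have -> : (S1 + (S1 * B + E1 * S1 * S1)) / S1 ^+ 2 - 1 = S1^-1 + (E1 - 1) + B / S1.
  by field; rewrite gt_eqF.
have iS : S1^-1 <= M^-1 by rewrite lef_pV2.
by rewrite lerD// ?lerD// ler_wpM2l.
Qed.

End FixedDensity.

(** * Elementary estimates with explicit constants *)

(** From [expR y >= (1 + y / 2) ^+ 2 >= (y / 2) ^+ 2] at [y = c * x]. It is the one source of the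
    factors [4 / c ^+ 2] in the constants below. *)
Lemma mul_expR_decay {R : realType} (c x : R) : 0 < c -> 0 < x ->
  x * expR (- (c * x)) <= 4 / c ^+ 2 / x.
Proof.
move=> c0 x0; have y0 : 0 < c * x by rewrite mulr_gt0.
have h : 1 + c * x / 2 <= expR (c * x / 2) by exact: expR_ge1Dx.
have h2 : (c * x / 2) ^+ 2 <= expR (c * x).
  rewrite [leRHS](_ : _ = expR (c * x / 2) ^+ 2); last first.
    by rewrite -expRM_natl; congr expR; field.
  rewrite lerXn2r ?nnegrE ?expR_ge0//; first by rewrite divr_ge0// ltW.
  by apply: le_trans h; rewrite lerDr.
have e0 : 0 < expR (c * x) by exact: expR_gt0.
rewrite expRN ler_pdivrMr// mulrAC ler_pdivlMr//.
rewrite -(@ler_pM2l _ (c ^+ 2 / 4)); last by rewrite divr_gt0 ?exprn_gt0.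
have -> : c ^+ 2 / 4 * (4 / c ^+ 2 * expR (c * x)) = expR (c * x) by field; rewrite gt_eqF.
by apply: le_trans h2; rewrite le_eqVlt; apply/orP; left; apply/eqP; field.
Qed.

Lemma le_summands {R : realDomainType} (x u v w z : R) : 1 + u + v + w + z <= x ->
  0 <= u -> 0 <= v -> 0 <= w -> 0 <= z -> [/\ 1 <= x, u <= x, v <= x, w <= x & z <= x].
Proof. by move=> *; split; lra. Qed.

Lemma gam_ge_core {R : realType} (g : R -> R) (x1 a : R) n0 i j :
  (forall x y : R, 0 <= x -> x <= y -> g y <= g x) -> 0 < a -> a * (2 * n0.+1%:R) <= x1 ->
  (i < n0)%N -> (j < n0)%N -> g x1 <= gam g a i.+2 j.+2.
Proof.
move=> gn a0 an i0 j0; apply: gn; first by rewrite mulr_ge0 ?hyp_ge0// ltW.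
apply: le_trans an; rewrite ler_pM2l//; apply: (le_trans (hyp_le _ _)).
by rewrite -natrM ler_nat; lia.
Qed.

(** Rounding [x1 / (4 * a)] down leaves room for the offset 2 of [rect] and for the bound of [hyp]
    by the sum of the coordinates: indices up to [n0.+1] stay within distance [x1]. *)
Lemma core_width {R : realType} (x1 a : R) : 0 < x1 -> 0 < a -> a <= x1 / 8 ->
  exists n0 : nat, [/\ (0 < n0)%N, x1 / 8 <= a * n0%:R, a * n0%:R <= x1 / 4 &
    a * (2 * n0.+1%:R) <= x1].
Proof.
move=> x1_gt0 a0 a1; exists (Num.truncn (x1 / (4 * a))).
have q0 : 0 <= x1 / (4 * a) by rewrite divr_ge0// ltW// mulr_gt0.
have /andP[] := Num.Theory.truncn_itv q0; set n0 := Num.truncn _ => h1 h2.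
have h1' : a * n0%:R <= x1 / 4.
  rewrite (_ : x1 / 4 = a * (x1 / (4 * a))); last by field; rewrite gt_eqF.
  by rewrite ler_pM2l.
have h2' : x1 / 4 < a * n0%:R + a.
  rewrite (_ : x1 / 4 = a * (x1 / (4 * a))); last by field; rewrite gt_eqF.
  by rewrite -[X in _ + X]mulr1 -mulrDr natr1 ltr_pM2l.
have h3 : x1 / 8 <= a * n0%:R by lra.
split => //; last by rewrite -[n0.+1%:R]natr1 mulrDr mulrDr mulr1; lra.
rewrite -(ltr0n R) -(pmulr_rgt0 _ a0); move: x1_gt0; lra.
Qed.

Lemma round_up {R : realType} (a s : R) : 0 < a -> 0 <= s -> exists p : nat,
  s <= a * p%:R /\ a * p%:R <= s + a.
Proof.
move=> a0 s_ge0; exists (Num.truncn (s / a)).+1.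
have /andP[h1 h2] := Num.Theory.truncn_itv (divr_ge0 s_ge0 (ltW a0)).
split; first by rewrite mulrC -ler_pdivrMr// ltW.
by rewrite -natr1 mulrDr mulr1 lerD2r mulrC -ler_pdivlMr.
Qed.

Lemma fine_mesh {R : realType} (rho q : R) : 0 < rho -> 0 < q ->
  exists2 h : nat, (0 < h)%N & rho <= h%:R * q.
Proof.
move=> rho0 q0; exists (Num.truncn (rho / q)).+1 => //.
have /andP[_ /ltW] := Num.Theory.truncn_itv (divr_ge0 (ltW rho0) (ltW q0)).
by rewrite ler_pdivrMr.
Qed.

(** A boundary strip of [expR (dl * lam)] radii fits in the square, since [q ^+ 2] is of order
    [lam * expR (- lam)] and [2 * dl - 1 <= - 1 / 2]. The threshold is [512 = 32 * 16], with 16 from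
    [mul_expR_decay] at [c = 1 / 2]. *)
Lemma mesh_fits {R : realType} (C lam L q dl : R) : 0 < C -> 1 <= lam -> 512 / C <= lam ->
  dl <= 1 / 16 -> 0 < L -> L <= 2 * lam -> 0 < q -> q ^+ 2 = L / (C * expR lam) ->
  4 * expR (dl * lam) * q <= 1.
Proof.
move=> C0 lam1 lamC dl16 L0 L2 q0 q2.
have lam0 : 0 < lam by exact: lt_le_trans lam1.
rewrite -(@ler_pXn2r _ 2) ?nnegrE ?mulr_ge0 ?expR_ge0 ?(ltW q0)// expr1n !exprMn q2.
rewrite -expRM_natl.
rewrite [leLHS](_ : _ = 16 * (L / C) * (expR (2 * (dl * lam)) * expR (- lam))); last first.
  by rewrite expRN; field; rewrite !gt_eqF// expR_gt0.
have LC : L / C <= 2 / C * lam by rewrite mulrAC ler_pM2r ?invr_gt0.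
rewrite -expRD; apply: (@le_trans _ _ (16 * (2 / C * lam) * expR (- (1 / 2 * lam)))).
  apply: ler_pM; rewrite ?expR_ge0//.
  - by rewrite mulr_ge0// divr_ge0 ?ltW.
  - by rewrite ler_pM2l.
  - rewrite ler_expR; have := ler_wpM2r (ltW lam0) dl16; lra.
have h2 : 0 < 1 / 2 :> R by rewrite divr_gt0.
apply: (@le_trans _ _ (32 / C * (4 / (1 / 2) ^+ 2 / lam))).
  rewrite (_ : 16 * _ * _ = 32 / C * (lam * expR (- (1 / 2 * lam)))); last by ring.
  by rewrite ler_pM2l ?divr_gt0// mul_expR_decay.
rewrite -(ler_pM2r lam0) [leRHS]mul1r; apply: le_trans lamC.
by rewrite le_eqVlt; apply/orP; left; apply/eqP; field; rewrite !gt_eqF.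
Qed.

(** [T0] is for cells with two nodes, [T1] for the bulk, [T2] for the sides, [T3] for the corners.
    Only the bulk gives [expR (lam - L)]. The sides give the rate [1 / sqrt lam]:
    [q * rho * expR (- (L / 2))] is at most of order [sqrt lam], and [a * G] of order [1 / lam]. *)
Lemma isolation_terms_le {R : realType} (C c1 c2 dl eta lam L rho q a mu G : R) (h p : nat) :
  0 < C -> 0 < c1 -> 0 < c2 -> dl <= c2 / 2 -> dl <= 1 / 16 ->
  1 <= lam -> lam <= L -> L <= 2 * lam -> rho = expR lam ->
  0 < q -> q ^+ 2 = L / (C * rho) -> 0 < a -> a <= expR (- lam) ->
  mu = L / C * a ^+ 2 -> mu * (4 * h%:R ^+ 2) = rho -> mu * (2 * h%:R) = q * rho * a ->
  a * p%:R <= 2 * expR (dl * lam) -> 0 <= G ->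
  a * G <= a + 1 / (c1 * L) + 2 * expR (dl * lam) * expR (- (c2 * L)) ->
  rho * mu + mu * expR mu *
    (4 * (h%:R ^+ 2 * expR (- (4 * (L / 4 - eta))) +
      2 * (h%:R * expR (- (2 * (L / 4 - eta))) * G) +
      p%:R ^+ 2 * expR (- (L / 4 - eta)))) <=
  (8 / C + expR (8 / C) * (expR (4 * eta) +
     4 * Num.sqrt (2 / C) * expR (2 * eta) * (4 + 1 / c1 + 2 * (4 / (c2 / 2) ^+ 2)) +
     32 / C * expR eta * (4 / (1 / 8) ^+ 2))) * (expR (lam - L) + (Num.sqrt lam)^-1).
Proof.
move=> C0 c10 c20 dlc2 dl16 lam1 lamL L2 rhoE q0 q2 a0 a_exp muE mrho muh ap G0 aG.
have lam0 : 0 < lam by exact: lt_le_trans lam1.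
have L0 : 0 < L by exact: lt_le_trans lamL.
set K2 := 4 * _ * _ * _; set K3 := 32 / C * _ * _; set w := Num.sqrt lam.
have w2 : w ^+ 2 = lam by rewrite sqr_sqrtr// ltW.
have w0 : 0 < w by rewrite sqrtr_gt0.
have w1 : 1 <= w by rewrite -[leLHS]sqrtr1 ler_wsqrtr.
have lamw : lam^-1 <= w^-1 by rewrite lef_pV2 ?posrE// -w2 expr2 ler_peMl// ltW.
have LC : L / C <= 2 / C * lam by rewrite mulrAC ler_pM2r ?invr_gt0.
have LC0 : 0 <= L / C by rewrite divr_ge0// ltW.
have inv_lam c : 0 < c -> expR (- (c * lam)) <= 4 / c ^+ 2 / lam.
  move=> cc; apply: le_trans (mul_expR_decay cc lam0).
  by rewrite ler_peMl// expR_ge0.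
have arho : a * rho <= 1.
  by rewrite rhoE; move: a_exp; rewrite expRN -[X in _ <= X]mul1r ler_pdivlMr// expR_gt0.
have rho1 : 1 <= rho by rewrite rhoE -[leLHS]expR0 ler_expR ltW.
have mu0 : 0 <= mu by rewrite muE mulr_ge0// sqr_ge0.
have T0 : rho * mu <= 8 / C / lam.
  apply: (@le_trans _ _ (2 / C * lam * expR (- (1 * lam)))).
    rewrite muE (_ : rho * _ = L / C * (a * rho * a)); last by ring.
    apply: ler_pM => //.
      by rewrite !mulr_ge0// ?ltW// rhoE expR_gt0.
    by rewrite mul1r; apply: le_trans a_exp; rewrite ler_piMl// ltW.
  rewrite -mulrA; apply: (@le_trans _ _ (2 / C * (4 / 1 ^+ 2 / lam))).
    by rewrite ler_pM2l ?divr_gt0// mul_expR_decay.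
  by rewrite le_eqVlt; apply/orP; left; apply/eqP; field; rewrite !gt_eqF.
have C8 : 0 < 8 / C by rewrite divr_gt0.
have muC : mu <= 8 / C.
  apply: (@le_trans _ _ (rho * mu)); first by rewrite ler_peMl.
  apply: (le_trans T0); rewrite ler_pdivrMr// ler_peMr// ltW//.
have emu : expR mu <= expR (8 / C) by rewrite ler_expR.
have T1 : mu * (4 * h%:R ^+ 2) * expR (- (4 * (L / 4 - eta))) = expR (4 * eta) * expR (lam - L).
  by rewrite mrho rhoE -!expRD; congr expR; field.
have aGl : a * G <= (4 + 1 / c1 + 2 * (4 / (c2 / 2) ^+ 2)) / lam.
  apply: (le_trans aG).
  rewrite [leRHS](_ : _ = 4 / lam + 1 / c1 / lam + 2 * (4 / (c2 / 2) ^+ 2) / lam); last by ring.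
  apply: lerD; first apply: lerD.
  - by apply: (le_trans a_exp); have := inv_lam 1 ltr01; rewrite mul1r expr1n divr1.
  - rewrite invfM mulrA ler_pM2l ?divr_gt0//; by rewrite lef_pV2.
  - rewrite -[leRHS]mulrA -mulrA ler_pM2l// -expRD; apply: le_trans (inv_lam _ (divr_gt0 c20 _)) => //.
    rewrite ler_expR; have := ler_wpM2r (ltW lam0) dlc2; have := ler_wpM2l (ltW c20) lamL.
    by rewrite mulrAC; lra.
have y2 : q * rho * expR (- (L / 2)) <= Num.sqrt (2 / C) * w.
  apply: (@le_trans _ _ (q * expR (lam / 2))).
    rewrite -mulrA ler_pM2l// rhoE -expRD ler_expR; lra.
  rewrite -(@ler_pXn2r _ 2) ?nnegrE ?mulr_ge0 ?expR_ge0 ?sqrtr_ge0 ?(ltW q0)//.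
  rewrite !exprMn q2 w2 sqr_sqrtr; last by rewrite divr_ge0// ltW.
  have -> : L / (C * rho) * expR (lam / 2) ^+ 2 = L / C.
    rewrite -expRM_natl (_ : 2 * (lam / 2) = lam); last by field.
    by rewrite -rhoE; field; rewrite !gt_eqF// rhoE expR_gt0.
  exact: LC.
have T2 : mu * (4 * (2 * (h%:R * expR (- (2 * (L / 4 - eta))) * G))) <= K2 / w.
  have -> : mu * (4 * (2 * (h%:R * expR (- (2 * (L / 4 - eta))) * G))) =
      4 * (q * rho * expR (- (L / 2))) * expR (2 * eta) * (a * G).
    rewrite (_ : - (2 * (L / 4 - eta)) = - (L / 2) + 2 * eta); last by field.
    rewrite expRD (_ : mu * _ = 4 * (mu * (2 * h%:R)) * (expR (- (L / 2)) * expR (2 * eta)) * G).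
      by rewrite muh; ring.
    by ring.
  have -> : K2 / w = 4 * (Num.sqrt (2 / C) * w) * expR (2 * eta) *
      ((4 + 1 / c1 + 2 * (4 / (c2 / 2) ^+ 2)) / lam).
    by rewrite /K2 -w2; field; rewrite !gt_eqF.
  apply: ler_pM => //.
  - by rewrite !mulr_ge0 ?expR_ge0 ?(ltW q0)// rhoE expR_ge0.
  - by rewrite mulr_ge0// ltW.
  - by rewrite ler_pM2r ?expR_gt0// ler_pM2l.
have T3 : mu * (4 * (p%:R ^+ 2 * expR (- (L / 4 - eta)))) <= K3 / w.
  apply: (@le_trans _ _ (K3 / lam)); last first.
    by rewrite ler_wpM2l// /K3 !mulr_ge0 ?expR_ge0 ?invr_ge0 ?(ltW C0)// sqr_ge0.
  have -> : mu * (4 * (p%:R ^+ 2 * expR (- (L / 4 - eta)))) =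
      4 * (L / C) * ((a * p%:R) ^+ 2 * expR (- (L / 4))) * expR eta.
    by rewrite (_ : - (L / 4 - eta) = - (L / 4) + eta) ?expRD ?muE; ring.
  have H : (a * p%:R) ^+ 2 * expR (- (L / 4)) <= 4 * expR (- (1 / 8 * lam)).
    apply: (@le_trans _ _ ((2 * expR (dl * lam)) ^+ 2 * expR (- (L / 4)))).
      rewrite ler_pM2r ?expR_gt0// lerXn2r ?nnegrE ?mulr_ge0 ?expR_ge0// ltW//.
    rewrite [leLHS](_ : _ = 4 * expR (2 * (dl * lam) - L / 4)); last first.
      by rewrite expRD expRM_natl; ring.
    rewrite ler_pM2l// ler_expR; have := ler_wpM2r (ltW lam0) dl16; lra.
  apply: (@le_trans _ _ (4 * (2 / C * lam) * (4 * expR (- (1 / 8 * lam))) * expR eta)).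
    rewrite ler_pM2r ?expR_gt0//; apply: ler_pM => //.
    - by rewrite mulr_ge0.
    - by rewrite mulr_ge0 ?expR_ge0// sqr_ge0.
    - by rewrite ler_pM2l.
  have h8 : 0 < 1 / 8 :> R by rewrite divr_gt0.
  have := mul_expR_decay h8 lam0; set z := _ / _ / lam.
  have -> : K3 / lam = 32 / C * expR eta * z by rewrite /K3 /z; ring.
  have -> : 4 * (2 / C * lam) * (4 * expR (- (1 / 8 * lam))) * expR eta =
     32 / C * expR eta * (lam * expR (- (1 / 8 * lam))) by ring.
  by rewrite ler_pM2l//; apply: mulr_gt0; [exact: divr_gt0|exact: expR_gt0].
have K20 : 0 <= K2.
  have c1p : 0 <= 1 / c1 by rewrite divr_ge0// ltW.
  have c2p : 0 <= 4 / (c2 / 2) ^+ 2 by rewrite divr_ge0// sqr_ge0.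
  apply: mulr_ge0; first by rewrite mulr_ge0 ?expR_ge0// mulr_ge0 ?sqrtr_ge0.
  by apply: addr_ge0; [exact: addr_ge0|exact: mulr_ge0].
have K30 : 0 <= K3 by rewrite /K3 !mulr_ge0 ?expR_ge0 ?invr_ge0 ?(ltW C0)// sqr_ge0.
have w1p : 0 <= w^-1 by rewrite invr_ge0 ltW.
have EL : 0 <= expR (lam - L) by exact: expR_ge0.
rewrite [leRHS]mulrDl; apply: lerD.
  apply: (le_trans T0); rewrite ler_pM2l//; apply: (le_trans lamw); rewrite lerDr//.
rewrite -[leRHS]mulrA [mu * _]mulrC -[leLHS]mulrA; apply: ler_pM => //; rewrite ?expR_ge0//.
  by rewrite mulr_ge0// mulr_ge0// !addr_ge0// ?mulr_ge0 ?expR_ge0 ?sqr_ge0// mulr_ge0 ?expR_ge0.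
have -> : mu * (4 * (h%:R ^+ 2 * expR (- (4 * (L / 4 - eta))) +
      2 * (h%:R * expR (- (2 * (L / 4 - eta))) * G) +
      p%:R ^+ 2 * expR (- (L / 4 - eta)))) =
   mu * (4 * h%:R ^+ 2) * expR (- (4 * (L / 4 - eta))) +
   mu * (4 * (2 * (h%:R * expR (- (2 * (L / 4 - eta))) * G))) +
   mu * (4 * (p%:R ^+ 2 * expR (- (L / 4 - eta)))) by ring.
rewrite T1; apply: (@le_trans _ _ (expR (4 * eta) * expR (lam - L) + K2 / w + K3 / w)).
  by rewrite lerD// lerD.
have e4 : 0 <= expR (4 * eta) by exact: expR_ge0.
have := mulr_ge0 e4 w1p; have := mulr_ge0 K20 EL; have := mulr_ge0 K30 EL.
rewrite !mulrDl !mulrDr; lra.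
Qed.

Lemma leq_double_maxn p i j : (p <= i + i)%N || (p <= j + j)%N -> (p <= maxn i j * 2)%N.
Proof. by lia. Qed.

(** [Kd / lam] bounds the mesh error [dlt], [Ky / lam] the exponent of the far pairs, and [KB] the
    contribution of the near pairs relative to [expR (L - lam) + lam^-1]. *)
Lemma second_moment_terms_le {R : realType} (C Kg c1 c2 lam L rho a mu dlt ep M G Kd Ky KB : R) :
  0 < C -> 0 < Kg -> 0 < c1 -> 0 < c2 -> c2 <= 1 / 2 ->
  1 <= lam -> 0 < L -> L <= lam -> rho = expR lam ->
  0 < a -> a <= expR (- lam) -> mu = L / C * a ^+ 2 ->
  dlt = mu * (9 + 16 * (2 * Kg / a)) -> ep = 4 * Kg * expR (- (c2 * lam)) ->
  M = rho / 4 * expR (- (L + dlt)) -> 0 <= G ->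
  (1 <= L -> a * G <= a + 1 / (c1 * L) + 2 * expR (c2 / 2 * lam) * expR (- (c2 * L))) ->
  (L < 1 -> a * G <= 2 * expR (c2 / 2 * lam)) ->
  Kd = (36 + 128 * Kg) / C ->
  Ky = 2 * Kd + 8 / C + 2 * (4 * Kg * (4 / c2 ^+ 2)) ->
  KB = 3 * (4 + 1 / c1 ^+ 2 + 16 / c2 ^+ 2) + 64 * expR 1 ->
  M^-1 + (expR (2 * dlt + 2 * mu + 2 * (ep * L)) - 1) +
    mu * expR (dlt + 2 * mu) * (4 * G ^+ 2) / M <=
  (4 * expR Kd + Ky * expR Ky + 16 / C * expR Ky * expR Kd * KB) * (expR (L - lam) + lam^-1).
Proof.
move=> C0 Kg0 c10 c20 c212 lam1 L0 Llam rhoE a0 a_exp muE dltE epE ME G0 aG1 aG2 KdE KyE KBE.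
have lam0 : 0 < lam by exact: lt_le_trans lam1.
have L0' := ltW L0.
have lamV : 0 < lam^-1 by rewrite invr_gt0.
have lam_decay c : 0 < c -> lam * expR (- (c * lam)) <= 4 / c ^+ 2 / lam.
  by move=> cc; exact: mul_expR_decay.
have le_lamV (x : R) : 0 <= x -> x / lam <= x.
  by move=> x0; rewrite ler_pdivrMr// ler_peMr.
have e1 : expR (- lam) <= 1 by rewrite expR_le1 oppr_le0 ltW.
have a1 : a <= 1 by exact: le_trans e1.
have aa : a ^+ 2 <= a by rewrite expr2 ler_piMl// ltW.
have LC0 : 0 < L / C by exact: divr_gt0.
have LC : L / C <= lam / C by rewrite ler_pM2r ?invr_gt0.
have LCa : L / C * a <= 4 / C / lam.
  apply: (@le_trans _ _ (lam / C * expR (- lam))).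
    by apply: ler_pM => //; exact: ltW.
  rewrite mulrAC [leRHS]mulrAC ler_pM2r ?invr_gt0//.
  by have := lam_decay 1 ltr01; rewrite mul1r expr1n divr1.
have mu0 : 0 <= mu by rewrite muE mulr_ge0 ?sqr_ge0// ltW.
have muL : mu <= 4 / C / lam.
  by apply: le_trans LCa; rewrite muE ler_pM2l.
have dltL : dlt <= Kd / lam.
  have -> : dlt = 9 * mu + 32 * Kg * (L / C * a) by rewrite dltE muE; field; rewrite !gt_eqF.
  have -> : Kd / lam = 9 * (4 / C / lam) + 32 * Kg * (4 / C / lam).
    by rewrite KdE; field; rewrite !gt_eqF.
  by rewrite lerD// ler_pM2l// mulr_gt0.
have dlt0 : 0 <= dlt.
  by rewrite dltE mulr_ge0// addr_ge0// mulr_ge0// divr_ge0 ?mulr_ge0// ltW.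
have Kd0 : 0 < Kd by rewrite KdE divr_gt0// addr_gt0// mulr_gt0.
have ep0 : 0 <= ep by rewrite epE mulr_ge0 ?expR_ge0// mulr_ge0// ltW.
have epL : ep * L <= 4 * Kg * (4 / c2 ^+ 2) / lam.
  apply: (@le_trans _ _ (ep * lam)); first by rewrite ler_wpM2l.
  rewrite epE (_ : _ * lam = 4 * Kg * (lam * expR (- (c2 * lam)))); last by ring.
  by rewrite -[leRHS]mulrA ler_pM2l ?mulr_gt0// lam_decay.
set y := 2 * dlt + 2 * mu + 2 * (ep * L).
have yL : y <= Ky / lam.
  have -> : Ky / lam = 2 * (Kd / lam) + 2 * (4 / C / lam) + 2 * (4 * Kg * (4 / c2 ^+ 2) / lam).
    by rewrite KyE; field; rewrite !gt_eqF.
  by rewrite /y lerD ?lerD// ler_pM2l.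
have y0 : 0 <= y by rewrite /y !addr_ge0 ?mulr_ge0// ltW.
have Ky0 : 0 <= Ky.
  by have := le_trans y0 yL; rewrite pmulr_lge0.
have yK : y <= Ky by exact: le_trans (le_lamV _ Ky0).
have ey : expR y <= expR Ky by rewrite ler_expR.
have ey1 : expR y - 1 <= Ky * expR Ky * lam^-1.
  apply: (@le_trans _ _ (y * expR y)).
    rewrite lerBlDr -lerBlDl -[X in X - _]mul1r -mulrBl.
    have : (1 - y) * expR y <= expR (- y) * expR y.
      by rewrite ler_pM2r ?expR_gt0//; exact: expR_ge1Dx.
    by rewrite -expRD addNr expR0.
  by rewrite mulrAC; apply: ler_pM; rewrite ?expR_ge0.
have EL1 : expR (L - lam) <= 1 by rewrite expR_le1 subr_le0.
have EL0 : 0 <= expR (L - lam) by exact: expR_ge0.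
have MV : M^-1 = 4 * expR dlt * expR (L - lam).
  rewrite ME rhoE invfM -expRN opprK invfM invrK -expRN -!mulrA mulrCA; congr (_ * _).
  by rewrite -!expRD; congr expR; ring.
have ed : expR dlt <= expR Kd.
  by rewrite ler_expR; apply: (le_trans dltL); apply: le_lamV; exact: ltW.
have MV1 : M^-1 <= 4 * expR Kd * expR (L - lam).
  by rewrite MV ler_wpM2r// ler_pM2l.
have KB0 : 0 <= KB.
  rewrite KBE addr_ge0 ?mulr_ge0 ?expR_ge0//.
  by rewrite !addr_ge0// divr_ge0// sqr_ge0.
have main : L * (a * G) ^+ 2 * expR (L - lam) <= KB * (expR (L - lam) + lam^-1).
  have aG0 : 0 <= a * G by rewrite mulr_ge0// ltW.
  have sqle (z t : R) : 0 <= z -> z <= t -> z ^+ 2 <= t ^+ 2.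
    by move=> z0 zt; rewrite lerXn2r ?nnegrE// (le_trans z0).
  have s2 : expR (c2 / 2 * lam) ^+ 2 = expR (c2 * lam).
    by rewrite -expRM_natl; congr expR; field.
  (* For [L < 1] the lune gives no useful gain and [a * G] grows like [expR (c2 / 2 * lam)]; the
     factor [expR (L - lam) <= expR (1 - lam)] absorbs it. *)
  have [L1|L1] := ltP L 1.
    apply: (@le_trans _ _ (64 * expR 1 * lam^-1)); last first.
      apply: ler_pM; rewrite ?mulr_ge0 ?expR_ge0 ?(ltW lamV)//.
        by rewrite KBE lerDr mulr_ge0// !addr_ge0// divr_ge0// sqr_ge0.
      by rewrite lerDr.
    apply: (@le_trans _ _ (lam * (4 * expR (c2 * lam)) * expR (1 - lam))).
      apply: ler_pM => //; first by rewrite mulr_ge0 ?sqr_ge0.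
        apply: ler_pM => //; first exact: sqr_ge0.
        apply: (@le_trans _ _ ((2 * expR (c2 / 2 * lam)) ^+ 2)).
          exact: sqle aG0 (aG2 L1).
        by rewrite exprMn s2; lra.
      by rewrite ler_expR lerD2r ltW.
    rewrite (_ : _ * _ * _ = 4 * expR 1 * (lam * (expR (c2 * lam) * expR (- lam)))); last first.
      by rewrite expRD; ring.
    have h : lam * (expR (c2 * lam) * expR (- lam)) <= 4 / (1 / 2) ^+ 2 / lam.
      apply: (le_trans _ (lam_decay (1 / 2) (divr_gt0 ltr01 (ltr0n _ 2)))).
      rewrite ler_pM2l// -expRD ler_expR; have := ler_wpM2r (ltW lam0) c212; lra.
    rewrite (_ : 64 * expR 1 * lam^-1 = 4 * expR 1 * (4 / (1 / 2) ^+ 2 / lam)); last by field; rewrite gt_eqF.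
    by rewrite ler_pM2l// mulr_gt0// expR_gt0.
  have c1L : 0 < c1 * L by exact: mulr_gt0.
  set u := 1 / (c1 * L) in aG1; set v := 2 * _ * _ in aG1.
  have u0 : 0 <= u by rewrite divr_ge0// ltW.
  have v0 : 0 <= v by rewrite !mulr_ge0 ?expR_ge0.
  have sq : (a * G) ^+ 2 <= 3 * (a ^+ 2 + u ^+ 2 + v ^+ 2).
    apply: (@le_trans _ _ ((a + u + v) ^+ 2)).
      exact: sqle aG0 (aG1 L1).
    have := sqr_ge0 (a - u); have := sqr_ge0 (a - v); have := sqr_ge0 (u - v).
    rewrite !expr2; lra.
  have b1 : L * a ^+ 2 * expR (L - lam) <= 4 * lam^-1.
    apply: (@le_trans _ _ (lam * expR (- (1 * lam)) * 1)).
      apply: ler_pM => //; first by rewrite mulr_ge0 ?sqr_ge0.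
      apply: ler_pM => //; first exact: sqr_ge0.
      by rewrite mul1r; exact: le_trans a_exp.
    by rewrite mulr1; have := lam_decay 1 ltr01; rewrite expr1n divr1.
  have b2 : L * u ^+ 2 * expR (L - lam) <= 1 / c1 ^+ 2 * expR (L - lam).
    rewrite ler_wpM2r// (_ : L * u ^+ 2 = 1 / c1 ^+ 2 / L); last by rewrite /u; field; rewrite !gt_eqF.
    by rewrite ler_pdivrMr// ler_peMr// divr_ge0// sqr_ge0.
  have b3 : L * v ^+ 2 * expR (L - lam) <= 16 / c2 ^+ 2 * lam^-1.
    apply: (@le_trans _ _ (4 * (lam * expR (- (c2 * lam))))); last first.
      rewrite (_ : 16 / c2 ^+ 2 * lam^-1 = 4 * (4 / c2 ^+ 2 / lam)); last by field; rewrite !gt_eqF.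
      by rewrite ler_pM2l// lam_decay.
    have -> : L * v ^+ 2 * expR (L - lam) = 4 * (L * expR (c2 * lam - 2 * (c2 * L) + (L - lam))).
      have e2 : expR (- (c2 * L)) ^+ 2 = expR (- (2 * (c2 * L))).
        by rewrite -expRM_natl; congr expR; ring.
      by rewrite /v !exprMn s2 e2 !expRD; ring.
    rewrite ler_pM2l//; apply: ler_pM => //.
    rewrite ler_expR.
    (* The exponent is at most [- (c2 * lam)] exactly when [(1 - 2 * c2) * (lam - L)] is
       nonnegative. *)
    have h1 : 0 <= 1 - 2 * c2 by move: c212; lra.
    have h2 : 0 <= lam - L by rewrite subr_ge0.
    by have := mulr_ge0 h1 h2; lra.
  apply: (@le_trans _ _ (3 * (4 * lam^-1 + 1 / c1 ^+ 2 * expR (L - lam) + 16 / c2 ^+ 2 * lam^-1))).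
    apply: (@le_trans _ _ (L * (3 * (a ^+ 2 + u ^+ 2 + v ^+ 2)) * expR (L - lam))).
      by rewrite ler_wpM2r// ler_wpM2l// ltW.
    rewrite (_ : _ * _ * _ = 3 * (L * a ^+ 2 * expR (L - lam) + L * u ^+ 2 * expR (L - lam) +
      L * v ^+ 2 * expR (L - lam))); last by ring.
    by rewrite ler_pM2l// lerD// lerD.
  have q1 : 0 <= 1 / c1 ^+ 2 by rewrite divr_ge0// sqr_ge0.
  have q2 : 0 <= 16 / c2 ^+ 2 by rewrite divr_ge0// sqr_ge0.
  have q3 : 0 <= 64 * expR 1 :> R by rewrite mulr_ge0// expR_ge0.
  rewrite KBE; move: q1 q2 q3 EL0 (ltW lamV).
  move: (1 / c1 ^+ 2) (16 / c2 ^+ 2) (64 * expR 1) (expR (L - lam)) (lam^-1) => z1 z2 z3 E V.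
  by move=> z10 z20 z30 E0 V0; nra.
have last : mu * expR (dlt + 2 * mu) * (4 * G ^+ 2) / M <=
    16 / C * expR Ky * expR Kd * KB * (expR (L - lam) + lam^-1).
  have ey2 : expR (dlt + 2 * mu) <= expR Ky.
    rewrite ler_expR; apply: le_trans yK; rewrite /y.
    have := mulr_ge0 ep0 (ltW L0); move: dlt0; lra.
  have -> : mu * expR (dlt + 2 * mu) * (4 * G ^+ 2) / M =
      16 / C * expR (dlt + 2 * mu) * expR dlt * (L * (a * G) ^+ 2 * expR (L - lam)).
    by rewrite MV muE; ring.
  rewrite -[leRHS]mulrA; apply: ler_pM => //.
  - by rewrite !mulr_ge0 ?expR_ge0 ?invr_ge0// ltW.
  - by rewrite mulr_ge0// mulr_ge0 ?sqr_ge0// ltW.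
  - apply: ler_pM; rewrite ?expR_ge0// ?mulr_ge0 ?expR_ge0 ?invr_ge0 ?(ltW C0)//.
    by rewrite ler_pM2l// divr_gt0.
have p1 : 0 <= 4 * expR Kd * lam^-1 by rewrite mulr_ge0 ?mulr_ge0 ?expR_ge0// ltW.
have p2 : 0 <= Ky * expR Ky * expR (L - lam) by rewrite !mulr_ge0 ?expR_ge0.
apply: (le_trans (lerD (lerD MV1 ey1) last)).
move: p1 p2; move: (4 * expR Kd) (Ky * expR Ky) (16 / C * expR Ky * expR Kd * KB) => A1 A2 A3.
by move: (expR (L - lam)) (lam^-1) => E V p1 p2; lra.
Qed.

(** * Choice of mesh and scales for both halves *)

Section Asymptotics.
Context {R : realType}.
Variables (g : R -> R) (C : R).
Hypothesis g01 : forall x : R, 0 <= x -> 0 <= g x <= 1.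
Hypothesis g_noninc : forall x y : R, 0 <= x -> x <= y -> g y <= g x.
Hypothesis C_gt0 : 0 < C.
Hypothesis C_int : (\int[leb2]_z (g (norm2 z))%:E = C%:E)%E.
Variable s0 : R.
Hypothesis s0_ge4 : 4 <= s0.
Hypothesis s0_gee : expR 1 <= s0.
Hypothesis g_decay : forall x, s0 <= x -> g x <= (x ^+ 2 * ln x ^+ 2)^-1.

Let Kg : R := (1 + s0) ^+ 2 + 4.

Let Kg_gt0 : 0 < Kg. Proof. by rewrite /Kg; have := sqr_ge0 (1 + s0); lra. Qed.

Let ln2_gt0 : 0 < ln 2 :> R. Proof. by rewrite ln_gt0// ltr1n. Qed.

(** A quarter of the upper Riemann sum. The first error is [a ^+ 2] times the four axis sums of
    [rect_shift], each at most [2 * Kg / a]; the second is a quarter of the tail beyond [s]. *)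
Lemma rect_mass_ge (a s : R) p : 0 < a -> a <= 1 -> s0 <= s -> s <= a * p%:R ->
  C / 4 - 8 * Kg * a - 8 / ln 2 / ln s <= a ^+ 2 * rect (gam g a) p p.
Proof.
move=> a0 a1 s0s sp; have s04 := s0_ge4.
have tail : (\int[leb2]_(z in outside (a * p%:R)) (g (norm2 z))%:E <= (32 / ln 2 / ln s)%:E)%E.
  apply: le_trans (tail_mass_le g01 g_noninc s0_ge4 g_decay (le_trans s0s sp)) _.
  rewrite lee_fin ler_wpM2l//; first by rewrite divr_ge0// ltW.
  rewrite lef_pV2 ?posrE ?ln_gt0 ?ler_ln ?posrE//; lra.
have H1 := upper_lattice_sum g01 g_noninc C_int a0 tail.
have H2 := rect_shift (fun i j => proj1 (andP (gam01 g01 i j a0)))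
  (fun i j => gam_mono g_noninc a0 (leqnSn i) (leqnn j))
  (fun i j => gam_mono g_noninc a0 (leqnn i) (leqnSn j)) p
  (fun n => gam_axis_l g01 g_noninc s0_ge4 s0_gee g_decay n a0 a1)
  (fun n => gam_axis_r g01 g_noninc s0_ge4 s0_gee g_decay n a0 a1).
have a20 : 0 <= 4 * a ^+ 2 by rewrite mulr_ge0// sqr_ge0.
have H3 := ler_wpM2l a20 H2.
have E : 4 * a ^+ 2 * (rect (gam g a) p p + 4 * (2 * Kg / a)) =
    4 * (a ^+ 2 * rect (gam g a) p p) + 32 * Kg * a.
  by field; rewrite gt_eqF.
rewrite -/Kg E in H3; lra.
Qed.

(** Once both errors of [rect_mass_ge] are at most [C / 16], the lattice sum is positive, so some
    term is. A positive argument is needed because it sets the width of the core around a node. *)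
Lemma exists_positive : exists2 x, 0 < x & 0 < g x.
Proof.
have [l [l1 lC]] : exists l : R, ln s0 <= l /\ 8 / ln 2 / l <= C / 16.
  exists (Num.max (ln s0) (128 / (C * ln 2))); split; first by rewrite le_max lexx.
  have p0 : 0 < 128 / (C * ln 2) by rewrite divr_gt0// mulr_gt0.
  have m0 : 0 < Num.max (ln s0) (128 / (C * ln 2)) by rewrite lt_max p0 orbT.
  rewrite ler_pdivrMr//; apply: (@le_trans _ _ (C / 16 * (128 / (C * ln 2)))); last first.
    by rewrite ler_pM2l ?divr_gt0// le_max lexx orbT.
  by rewrite le_eqVlt; apply/orP; left; apply/eqP; field; rewrite !gt_eqF.
have s04 := s0_ge4.
pose a := Num.min 1 (C / (128 * Kg)).
have a0 : 0 < a by rewrite lt_min ltr01 divr_gt0// mulr_gt0.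
have a1 : a <= 1 by rewrite ge_min lexx.
have aC : 8 * Kg * a <= C / 16.
  apply: (@le_trans _ _ (8 * Kg * (C / (128 * Kg)))).
    by rewrite ler_pM2l ?mulr_gt0// ge_min lexx orbT.
  by rewrite le_eqVlt; apply/orP; left; apply/eqP; field; rewrite !gt_eqF.
pose p := (Num.truncn (expR l / a)).+1.
have sp : expR l <= a * p%:R.
  rewrite mulrC -ler_pdivrMr//; apply: ltW.
  by have /andP[] := Num.Theory.truncn_itv (divr_ge0 (expR_ge0 l) (ltW a0)).
have sl : s0 <= expR l by rewrite -[leLHS]lnK ?posrE ?ler_expR//; lra.
have := rect_mass_ge a0 a1 sl sp; rewrite expRK => H.
have r0 : 0 < rect (gam g a) p p.
  have : 0 < a ^+ 2 * rect (gam g a) p p by move: C_gt0; lra.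
  by rewrite pmulr_rgt0// exprn_gt0.
apply: contrapT => nex; move: r0; apply/negP; rewrite -leNgt.
apply: sumr_le0 => i _; apply: sumr_le0 => j _; rewrite leNgt; apply/negP => gij.
apply: nex; exists (a * hyp i.+2 j.+2) => //; rewrite mulr_gt0//.
by apply: lt_le_trans (hyp_ge _ _); rewrite ltr0n leq_max.
Qed.

Variable x1 : R.
Hypothesis x1_gt0 : 0 < x1.
Hypothesis gx1_gt0 : 0 < g x1.
Let al := g x1.

Lemma few_isolated_nodes : exists A lam0 : R, forall d (T : measurableType d)
    (P : probability T R) (N : network R T) (rho r q L : R),
  0 < rho -> lam0 <= ln rho -> ln rho <= L -> L <= 2 * ln rho ->
  q = Num.sqrt (L / (C * rho)) -> q <= r ->
  random_connection_network P N rho (fun x => g (x / r)) ->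
  (P (has_isolated_node N) <= (A * (expR (ln rho - L) + (Num.sqrt (ln rho))^-1))%:E)%E.
Proof.
(* [c1 * L * a] bounds from below the mass [ka] gained per cell of depth next to a side, and
   [c2 * L] the gain over the whole core. *)
pose c1 := x1 * al / (4 * C).
pose c2 := c1 * x1 / 8.
have c1_gt0 : 0 < c1 by rewrite /c1 divr_gt0 ?mulr_gt0.
have c2_gt0 : 0 < c2 by rewrite /c2 divr_gt0// mulr_gt0.
(* The strips have width [expR (dl * lam)]: [dl <= c2 / 2] lets the gain [expR (- (c2 * L))] beat
   the width of a side strip, and [dl <= 1 / 16] lets [expR (- (L / 4))] beat the area of a
   corner. *)
have [dl [dl_gt0 dl_c2 dl_16]] : exists dl, [/\ 0 < dl, dl <= c2 / 2 & dl <= 1 / 16].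
  exists (Num.min (c2 / 2) (1 / 16)); split; last by rewrite ge_min lexx orbT.
    by rewrite lt_min; apply/andP; split; exact: divr_gt0.
  by rewrite ge_min lexx.
(* Bounds [L / C] times the errors of [rect_mass_ge] at [s = expR (dl * lam)], by [L <= 2 * lam] and
   [a * lam <= 1]: the tail is of order [1 / lam], so the missing mass stays bounded. *)
pose eta := 16 / C * (Kg + 1 / (ln 2 * dl)).
have eta_ge0 : 0 <= eta.
  rewrite /eta; apply: mulr_ge0; first by rewrite divr_ge0// ltW.
  by apply: addr_ge0; [exact: ltW|rewrite divr_ge0// mulr_ge0// ltW].
pose K2 := 4 * Num.sqrt (2 / C) * expR (2 * eta) * (4 + 1 / c1 + 2 * (4 / (c2 / 2) ^+ 2)).
pose K3 := 32 / C * expR eta * (4 / (1 / 8) ^+ 2).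
pose A := 8 / C + expR (8 / C) * (expR (4 * eta) + K2 + K3).
have s04 := s0_ge4.
have [t1 t2 t3 t4] : [/\ 0 < 8 / x1, 0 < s0 / dl, 0 < x1 / dl & 0 < 512 / C].
  have s00 : 0 < s0 by apply: lt_le_trans s04; rewrite ltr0n.
  by split; apply: divr_gt0; rewrite ?ltr0n.
exists A, (1 + 8 / x1 + s0 / dl + x1 / dl + 512 / C) => d T P N rho r q L rho0 lam0_le lamL L2 qE qr rcn.
set lam := ln rho in lam0_le lamL L2 *.
have [lam1 lam_x1 lam_s0 lam_x1d lam_C] : [/\ 1 <= lam, 8 / x1 <= lam, s0 / dl <= lam,
    x1 / dl <= lam & 512 / C <= lam].
  by exact: (le_summands lam0_le (ltW t1) (ltW t2) (ltW t3) (ltW t4)).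
have lam_gt0 : 0 < lam by exact: lt_le_trans lam1.
have rhoE : rho = expR lam by rewrite lnK ?posrE.
have L0 : 0 < L by exact: lt_le_trans lamL.
have q2 : q ^+ 2 = L / (C * rho) by rewrite qE sqr_sqrtr// ltW// divr_gt0// mulr_gt0.
have q0 : 0 < q by rewrite qE sqrtr_gt0 divr_gt0// mulr_gt0.
have [h h0 hrho] := fine_mesh rho0 q0.
have m0 : (0 < h + h)%N by rewrite addn_gt0 h0.
have := has_isolated_node_bound g01 g_noninc rho0 (lt_le_trans q0 qr) rcn m0 q0 qr.
set a := _^-1 / q; set mu := rho / _.
move=> /le_trans; apply; rewrite lee_fin.
have hR : 0 < h%:R :> R by rewrite ltr0n.
have mR : ((h + h)%:R : R) = 2 * h%:R by rewrite natrD; ring.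
have a0 : 0 < a by rewrite /a divr_gt0// invr_gt0 ltr0n.
have aq : 2 * h%:R * q * a = 1 by rewrite /a mR; field; rewrite !gt_eqF.
have arho : a * rho <= 1.
  rewrite -aq mulrC ler_wpM2r ?(ltW a0)//; apply: (le_trans hrho).
  by rewrite -mulrA ler_peMl ?mulr_ge0// ?ltW//; lra.
have inv_lam c : 0 < c -> expR (- (c * lam)) <= 4 / c ^+ 2 / lam.
  move=> cc; apply: le_trans (mul_expR_decay cc lam_gt0).
  by rewrite ler_peMl// expR_ge0.
have a_exp : a <= expR (- lam) by rewrite expRN -rhoE -[X in _ <= X]mul1r ler_pdivlMr.
have a_lam : a * lam <= 1.
  apply: le_trans arho; rewrite ler_pM2l// rhoE; apply: le_trans (expR_ge1Dx _); lra.
have a1 : a <= 1 by apply: le_trans a_lam; rewrite ler_peMr// ltW.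
have ax1 : a <= x1 / 8.
  rewrite -(ler_pM2r lam_gt0); apply: (le_trans a_lam).
  rewrite -(ler_pM2l (divr_gt0 (_ : 0 < 8) x1_gt0))// mulr1; apply: (le_trans lam_x1).
  by rewrite le_eqVlt; apply/orP; left; apply/eqP; field; rewrite gt_eqF.
have [n0 [n00 n0lo n0hi Hn0]] := core_width x1_gt0 a0 ax1.
pose s := expR (dl * lam).
have s_dl : dl * lam <= s by apply: le_trans (expR_ge1Dx _); lra.
have ss0 : s0 <= s by apply: le_trans s_dl; rewrite mulrC -ler_pdivrMr.
have sx1 : x1 <= s by apply: le_trans s_dl; rewrite mulrC -ler_pdivrMr.
have [p [ps ps']] := round_up a0 (le_trans (ltW x1_gt0) sx1).
have ap : a * p%:R <= 2 * s.
  apply: (le_trans ps'); rewrite mulrDl !mul1r lerD2l; apply: (le_trans ax1).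
  by apply: le_trans sx1; rewrite ler_pdivrMr// ler_peMr ?(ltW x1_gt0)// ler1n.
have LC : L / C <= 2 / C * lam by rewrite mulrAC ler_pM2r ?invr_gt0.
have muE : mu = L / C * a ^+ 2.
  have -> : a ^+ 2 = (4 * h%:R ^+ 2)^-1 / (L / (C * rho)).
    by rewrite -q2 /a mR; field; rewrite !gt_eqF.
  by rewrite /mu mR; field; rewrite !gt_eqF.
have mu0 : 0 < mu by rewrite /mu divr_gt0// exprn_gt0// ltr0n.
have mrho : mu * (4 * h%:R ^+ 2) = rho by rewrite /mu mR; field; rewrite !gt_eqF.
clearbody a mu.
have n0p : (n0 <= p)%N.
  rewrite -(ler_nat R) -(ler_pM2l a0); apply: (le_trans n0hi); apply: le_trans ps.
  by apply: le_trans sx1; rewrite ler_pdivrMr// ler_peMr ?(ltW x1_gt0)// ler1n.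
have ph : (p <= h)%N.
  rewrite -(ler_nat R) -(ler_pM2l a0); apply: (le_trans ap).
  have H : 4 * s * q <= 1.
    by apply: (mesh_fits C_gt0 lam1 lam_C dl_16 L0 L2 q0); rewrite q2 rhoE.
  have aq2 : 2 * (a * h%:R * q) = 1 by rewrite -[RHS]aq; ring.
  rewrite -(ler_pM2r q0) -(@ler_pM2l _ 2)// aq2; apply: le_trans H.
  by rewrite le_eqVlt; apply/orP; left; apply/eqP; ring.
pose La := L / 4 - eta.
have HLa : La <= mu * rect (gam g a) p p.
  have H := rect_mass_ge a0 a1 ss0 ps.
  have LC0 : 0 <= L / C by rewrite divr_ge0 ?ltW.
  have {}H := ler_wpM2l LC0 H.
  rewrite muE -mulrA; apply: le_trans H.
  rewrite /s expRK.
  have H1 : L / C * (8 * Kg * a + 8 / ln 2 / (dl * lam)) <= eta.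
    apply: (@le_trans _ _ (2 / C * lam * (8 * Kg * a + 8 / ln 2 / (dl * lam)))).
      rewrite ler_wpM2r// addr_ge0 ?mulr_ge0 ?invr_ge0 ?mulr_ge0 ?(ltW Kg_gt0) ?(ltW a0)//;
      by rewrite ltW.
    rewrite (_ : _ * lam * _ = 16 / C * (Kg * (a * lam) + 1 / (ln 2 * dl))); last first.
      by field; rewrite !gt_eqF.
    rewrite /eta ler_pM2l ?divr_gt0// lerD2r -[leRHS]mulr1 ler_pM2l//.
  have E : L / C * (C / 4) = L / 4 by field; rewrite gt_eqF.
  by rewrite /La -E -addrA -opprD mulrBr lerD2l lerN2.
pose ka := 2 * (mu * (n0%:R * al)).
have kaE : ka = 2 * (L / C) * al * a * (a * n0%:R) by rewrite /ka muE; ring.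
have ka_lo : c1 * L * a <= ka.
  rewrite kaE (_ : c1 * L * a = 2 * (L / C) * al * a * (x1 / 8)); last first.
    by rewrite /c1; field; rewrite gt_eqF.
  by rewrite ler_pM2l// mulr_gt0// mulr_gt0// mulr_gt0// divr_gt0.
have ka_gt0 : 0 < ka by apply: lt_le_trans ka_lo; rewrite mulr_gt0// mulr_gt0.
have kan0 : c2 * L <= ka * n0%:R.
  apply: (@le_trans _ _ (c1 * L * a * n0%:R)); last by rewrite ler_pM2r// ltr0n.
  rewrite -mulrA (_ : c2 * L = c1 * L * (x1 / 8)); last by rewrite /c2; field.
  by rewrite ler_pM2l// mulr_gt0.
have Hal := fun i j => gam_ge_core (i := i) (j := j) g_noninc a0 Hn0.
have := isolation_sum_le (fun i j => proj1 (andP (gam01 g01 i j a0)))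
  (fun i j => gam_mono g_noninc a0 (leqnSn i) (leqnn j))
  (fun i j => gam_mono g_noninc a0 (leqnn i) (leqnSn j))
  mu0 gx1_gt0 n00 n0p ph Hal HLa (erefl ka).
set G := 1 + _ + _ => HS.
have muh : mu * (2 * h%:R) = q * rho * a.
  have -> : mu * (2 * h%:R) = L / C * a * (2 * h%:R * q * a) / q.
    by rewrite muE; field; rewrite !gt_eqF.
  have -> : L / C = q ^+ 2 * rho by rewrite q2; field; rewrite !gt_eqF.
  by rewrite aq; field; rewrite gt_eqF.
have aG : a * G <= a + 1 / (c1 * L) + 2 * s * expR (- (c2 * L)).
  rewrite /G !mulrDr mulr1; apply: lerD; first apply: lerD => //.
    rewrite ler_pdivrMr//; apply: (@le_trans _ _ (1 / (c1 * L) * (c1 * L * a))).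
      by rewrite (_ : 1 / (c1 * L) * (c1 * L * a) = a)//; field; rewrite !gt_eqF.
    by rewrite ler_pM2l// divr_gt0// mulr_gt0.
  rewrite mulrA; apply: ler_pM; rewrite ?expR_ge0 ?mulr_ge0 ?(ltW a0)//.
  by rewrite ler_expR lerN2.
have G0 : 0 <= G by rewrite /G !addr_ge0 ?invr_ge0 ?mulr_ge0 ?expR_ge0// ltW.
apply: (@le_trans _ _ (rho * mu + mu * expR mu *
  (4 * (h%:R ^+ 2 * expR (- (4 * La)) + 2 * (h%:R * expR (- (2 * La)) * G) + p%:R ^+ 2 * expR (- La))))).
  by rewrite lerD2l ler_wpM2l// mulr_ge0 ?expR_ge0// ltW.
exact: (isolation_terms_le eta C_gt0 c1_gt0 c2_gt0 dl_c2 dl_16 lam1 lamL L2 rhoE q0 q2 a0 a_exp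
  muE mrho muh ap G0 aG).
Qed.

Lemma many_isolated_nodes : exists A lam0 : R, forall d (T : measurableType d)
    (P : probability T R) (N : network R T) (rho r L : R),
  0 < rho -> lam0 <= ln rho -> 0 < L -> L <= ln rho ->
  r = Num.sqrt (L / (C * rho)) ->
  random_connection_network P N rho (fun x => g (x / r)) ->
  (P (~` has_isolated_node N) <= (A * (expR (L - ln rho) + (ln rho)^-1))%:E)%E.
Proof.
(* Comes from [ka = mu * (n0%:R * (al / 4))], [mu = L / C * a ^+ 2] and [x1 / 8 <= a * n0%:R]. *)
pose c1 := x1 * al / (32 * C).
have c1_gt0 : 0 < c1 by apply: divr_gt0; apply: mulr_gt0 => //; rewrite ltr0n.
have [c2 [c2_gt0 c2_12 c2_c1]] : exists c2, [/\ 0 < c2, c2 <= 1 / 2 & c2 <= c1 * x1 / 8].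
  exists (Num.min (1 / 2) (c1 * x1 / 8)); split; last by rewrite ge_min lexx orbT.
    by rewrite lt_min; apply/andP; split; apply: divr_gt0 => //; apply: mulr_gt0.
  by rewrite ge_min lexx.
pose x2 := 2 * Kg / al.
have x2_gt0 : 0 < x2 by apply: divr_gt0 => //; apply: mulr_gt0.
have gx2 x : x2 <= x -> g x <= al / 2.
  move=> x2x; have x0 : 0 < x by exact: lt_le_trans x2x.
  apply: (le_trans (radial_decay g01 s0_ge4 s0_gee g_decay (ltW x0))).
  rewrite -/Kg ler_pdivrMr ?exprn_gt0 ?addr_gt0//.
  have h : 2 * Kg <= x * al by rewrite -ler_pdivrMr.
  have h2 : x <= (1 + x) ^+ 2 by rewrite expr2; nra.
  have := ler_wpM2l (ltW (gx1_gt0 : 0 < al)) h2; move: h; lra.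
(* [r * B <= 1] makes the core and the range [I] of the lune fit in [h] cells. *)
pose B := x1 + 4 * (x2 + 1).
have B_gt0 : 0 < B by rewrite /B addr_gt0// mulr_gt0// addr_gt0.
pose Kd := (36 + 128 * Kg) / C.
pose Ky := 2 * Kd + 8 / C + 2 * (4 * Kg * (4 / c2 ^+ 2)).
pose KB := 3 * (4 + 1 / c1 ^+ 2 + 16 / c2 ^+ 2) + 64 * expR 1.
exists (4 * expR Kd + Ky * expR Ky + 16 / C * expR Ky * expR Kd * KB).
have s04 := s0_ge4.
have [t1 t2 t3] : [/\ 0 < 8 / x1, 0 < x1 / (c2 / 2) & 0 < 4 / C * B ^+ 2].
  split; [exact: divr_gt0|by rewrite divr_gt0// divr_gt0|].
  by rewrite mulr_gt0 ?exprn_gt0// divr_gt0.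
(* The last [0] fills the fourth slot of [le_summands]. *)
exists (1 + 8 / x1 + x1 / (c2 / 2) + 4 / C * B ^+ 2 + 0) => d T P N rho r L rho0 lam0_le L0 Llam rE rcn.
set lam := ln rho in lam0_le Llam *.
have [lam1 lam_x1 lam_x1d lam_B _] := le_summands lam0_le (ltW t1) (ltW t2) (ltW t3) (lexx 0).
have lam_gt0 : 0 < lam by exact: lt_le_trans lam1.
have rhoE : rho = expR lam by rewrite lnK ?posrE.
have r2 : r ^+ 2 = L / (C * rho) by rewrite rE sqr_sqrtr// ltW// divr_gt0// mulr_gt0.
have r0 : 0 < r by rewrite rE sqrtr_gt0 divr_gt0// mulr_gt0.
have [h h0 hrho] := fine_mesh rho0 r0.
have rB : r * B <= 1.
  rewrite -(@ler_pXn2r _ 2) ?nnegrE ?mulr_ge0 ?(ltW r0) ?(ltW B_gt0)// expr1n exprMn r2.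
  have q1 : L / (C * rho) <= 4 / C / lam.
    rewrite [leLHS](_ : _ = L * expR (- lam) / C); last first.
      by rewrite rhoE expRN; field; rewrite !gt_eqF// expR_gt0.
    rewrite [leRHS]mulrAC ler_pM2r ?invr_gt0//.
    have := mul_expR_decay ltr01 lam_gt0; rewrite expr1n divr1 mul1r => /(le_trans _); apply.
    by rewrite ler_pM2r ?expR_gt0.
  apply: (le_trans (ler_wpM2r (sqr_ge0 B) q1)).
  by rewrite mulrAC ler_pdivrMr// mul1r.
have hR : 0 < h%:R :> R by rewrite ltr0n.
pose m := (h + h + h + h)%N.
pose a := m%:R^-1 / r; pose mu := rho / m%:R ^+ 2.
have := @no_isolated_node_bound R g g01 g_noninc d T P N rho r rho0 r0 rcn h.
cbv zeta; rewrite -/m -/a -/mu => bound.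
have mR : (m%:R : R) = 4 * h%:R by rewrite !natrD; ring.
have a0 : 0 < a by rewrite /a mR divr_gt0// invr_gt0 mulr_gt0.
have ar : 4 * h%:R * r * a = 1 by rewrite /a mR; field; rewrite !gt_eqF.
have arho : a * rho <= 1.
  rewrite -ar mulrC ler_wpM2r ?(ltW a0)//; apply: (le_trans hrho).
  by rewrite -mulrA ler_peMl ?ler1n// mulr_ge0// ltW.
have muE : mu = L / C * a ^+ 2.
  have -> : a ^+ 2 = (16 * h%:R ^+ 2)^-1 / (L / (C * rho)).
    by rewrite -r2 /a mR; field; rewrite !gt_eqF.
  by rewrite /mu mR; field; rewrite !gt_eqF.
have mu0 : 0 < mu by rewrite /mu mR divr_gt0// exprn_gt0// mulr_gt0.
have mrho : mu * (16 * h%:R ^+ 2) = rho by rewrite /mu mR; field; rewrite !gt_eqF.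
clearbody a mu.
have a_exp : a <= expR (- lam) by rewrite expRN -rhoE -[X in _ <= X]mul1r ler_pdivlMr.
have a_lam : a * lam <= 1.
  apply: le_trans arho; rewrite ler_pM2l// rhoE; apply: le_trans (expR_ge1Dx _).
  by rewrite lerDr.
have a1 : a <= 1 by apply: le_trans a_lam; rewrite ler_peMr// ltW.
have ax1 : a <= x1 / 8.
  rewrite -(ler_pM2r lam_gt0); apply: (le_trans a_lam).
  rewrite -(ler_pM2l (divr_gt0 (_ : 0 < 8) x1_gt0))// mulr1; apply: (le_trans lam_x1).
  by rewrite le_eqVlt; apply/orP; left; apply/eqP; field; rewrite gt_eqF.
have [n0 [n00 n0lo n0hi Hn0]] := core_width x1_gt0 a0 ax1.
pose s := expR (c2 / 2 * lam).
have s1 : 1 <= s by rewrite -[leLHS]expR0 ler_expR mulr_ge0// ltW// divr_gt0.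
have [p [ps ps']] := round_up a0 (le_trans ler01 s1).
have ap : a * p%:R <= 2 * s.
  by apply: (le_trans ps'); rewrite [2 * s]mulrDl !mul1r lerD2l (le_trans a1).
have ah : x1 + 4 * (x2 + 1) <= 4 * (a * h%:R).
  have E : r * (4 * (a * h%:R)) = 1 by rewrite -[RHS]ar; ring.
  by rewrite -(ler_pM2l r0) E; exact: rB.
have [I [Ix2 Ix2']] := round_up a0 (ltW x2_gt0).
have nh : (n0 <= h)%N.
  rewrite -(ler_nat R) -(ler_pM2l a0); apply: (le_trans n0hi).
  by rewrite ler_pdivrMr// mulrC; apply: le_trans ah; rewrite lerDl mulr_ge0// addr_ge0// ltW.
have Ih : (I <= h)%N.
  rewrite -(ler_nat R) -(ler_pM2l a0) -(@ler_pM2l _ 4)//; apply: le_trans ah.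
  apply: (@le_trans _ _ (4 * (x2 + 1))); last by rewrite lerDr ltW.
  by rewrite ler_pM2l//; apply: (le_trans Ix2'); rewrite lerD2l.
have HL : mu * (4 * \sum_(i < m) \sum_(j < m) gam g a i.+1 j.+1) <= L.
  have := lower_lattice_sum g01 g_noninc C_int m a0.
  set S := \sum_(i < m) _ => H.
  rewrite muE (_ : _ * _ = L / C * (4 * a ^+ 2 * S)); last by ring.
  apply: (@le_trans _ _ (L / C * C)); last by rewrite divfK// gt_eqF.
  by rewrite ler_pM2l// divr_gt0.
have Xi n := gam_axis_l g01 g_noninc s0_ge4 s0_gee g_decay n a0 a1.
have Xj n := gam_axis_r g01 g_noninc s0_ge4 s0_gee g_decay n a0 a1.
rewrite -/Kg in Xi Xj.
have Hal i j : (i < n0)%N -> (j < n0)%N -> al <= gam g a i.+1 j.+1.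
  move=> i0 j0; apply: le_trans (gam_ge_core g_noninc a0 Hn0 i0 j0) _.
  by apply: gam_mono.
have far (t : R) k i j : 0 <= t -> t <= a * k%:R -> (k <= i)%N || (k <= j)%N ->
    t <= a * hyp i.+1 j.+1.
  move=> t0 tk kij; apply: (le_trans tk); rewrite ler_pM2l//.
  by apply: le_trans (hyp_ge _ _); rewrite ler_nat leq_max; apply/orP; case/orP: kij => k1; [left|right]; exact: leqW.
have HI i j : (I <= i)%N || (I <= j)%N -> gam g a i.+1 j.+1 <= al / 2.
  by move=> Iij; apply: gx2; exact: (far x2 I i j (ltW x2_gt0) Ix2 Iij).
(* Far cells are [s] radii apart, so each third cell is at least [s / 2] from one of them, where
   [g <= 4 * Kg / s ^+ 2]. *)
pose ep := 4 * Kg * expR (- (c2 * lam)).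
have ep0 : 0 <= ep by rewrite mulr_ge0 ?expR_ge0// mulr_ge0// ltW.
have Hep i j : (p <= i + i)%N || (p <= j + j)%N -> gam g a i.+1 j.+1 <= ep.
  move=> pij.
  have sh : s / 2 <= a * hyp i.+1 j.+1.
    rewrite ler_pdivrMr//; apply: (le_trans ps); rewrite -mulrA ler_pM2l//.
    apply: (@le_trans _ _ ((maxn i j)%:R * 2)).
      by rewrite -natrM ler_nat; exact: leq_double_maxn.
    rewrite ler_pM2r//; apply: le_trans (hyp_ge _ _).
    by rewrite ler_nat geq_max !leq_max !leqnSn orbT.
  have s20 : 0 <= s / 2 by rewrite divr_ge0// expR_ge0.
  apply: (le_trans (g_noninc s20 sh)).
  apply: (le_trans (radial_decay g01 s0_ge4 s0_gee g_decay s20)); rewrite -/Kg.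
  rewrite ler_pdivrMr; last by rewrite exprn_gt0// ltr_pwDl.
  have sE : expR (- (c2 * lam)) * s ^+ 2 = 1.
    rewrite /s -expRM_natl -expRD -[RHS]expR0; congr expR; by field.
  have h1 : s ^+ 2 / 4 <= (1 + s / 2) ^+ 2 by move: s1; rewrite !expr2; nra.
  have e0 : 0 <= 4 * Kg * expR (- (c2 * lam)) by [].
  rewrite /ep; apply: le_trans (ler_wpM2l e0 h1).
  rewrite (_ : _ * (_ / 4) = Kg * (expR (- (c2 * lam)) * s ^+ 2)); last by field.
  by rewrite sE mulr1.
pose ka := mu * (n0%:R * (al / 4)).
have kaE : ka = L / C * a * (a * n0%:R) * (al / 4) by rewrite /ka muE; ring.
have ka_lo : c1 * L * a <= ka.
  rewrite kaE (_ : c1 * L * a = L / C * a * (x1 / 8) * (al / 4)); last first.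
    by rewrite /c1; field; rewrite gt_eqF.
  rewrite ler_pM2r ?divr_gt0// ler_pM2l//.
  by apply: mulr_gt0 => //; exact: divr_gt0.
have c1L : 0 < c1 * L by exact: mulr_gt0.
have ka_gt0 : 0 < ka by apply: lt_le_trans ka_lo; exact: mulr_gt0.
have kan0 : c2 * L <= ka * n0%:R.
  apply: (@le_trans _ _ (c1 * L * a * n0%:R)); last by rewrite ler_pM2r// ltr0n.
  apply: (@le_trans _ _ (c1 * x1 / 8 * L)); first by rewrite ler_pM2r.
  rewrite -[leRHS]mulrA (_ : c1 * x1 / 8 * L = c1 * L * (x1 / 8)); last by field.
  by rewrite ler_pM2l.
(* When [L] is small, [ka^-1] is too large to be of use, and the terms are simply counted. *)
pose G := if 1 <= L then 1 + ka^-1 + p%:R * expR (- (ka * n0%:R)) else p%:R.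
have HG : \sum_(u < p) expR (- (ka * (minn u n0)%:R)) <= G.
  rewrite /G; case: ifP => _; first exact: min_geometric_sum_le.
  rewrite -[X in _ <= X%:R]card_ord -sumr_const; apply: ler_sum => u _.
  by rewrite expR_le1 oppr_le0 mulr_ge0// ltW.
have G0 : 0 <= G by apply: le_trans HG; apply: sumr_ge0 => u _; exact: expR_ge0.
have aG1 : 1 <= L -> a * G <= a + 1 / (c1 * L) + 2 * s * expR (- (c2 * L)).
  move=> L1; rewrite /G L1 !mulrDr mulr1; apply: lerD; first apply: lerD => //.
    rewrite ler_pdivrMr//; apply: (@le_trans _ _ (1 / (c1 * L) * (c1 * L * a))).
      by rewrite (_ : 1 / (c1 * L) * (c1 * L * a) = a)//; field; rewrite !gt_eqF.
    by rewrite ler_pM2l// divr_gt0.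
  rewrite mulrA; apply: ler_pM; rewrite ?expR_ge0 ?mulr_ge0 ?(ltW a0)//.
  by rewrite ler_expR lerN2.
have aG2 : L < 1 -> a * G <= 2 * s by move=> L1; rewrite /G (leNgt 1 L) L1.
pose dlt := mu * (9 + 16 * (2 * Kg / a)).
pose M := 4 * (h%:R ^+ 2 * (mu * expR (- (L + dlt)))).
have ME : M = rho / 4 * expR (- (L + dlt)) by rewrite -mrho /M; field.
have := bound n0 I p al ep (2 * Kg / a) L ka dlt M G h0 nh Ih ep0 HL Xi Xj Hal HI Hep
  erefl HG erefl erefl.
move=> /le_trans; apply; rewrite lee_fin.
exact: (second_moment_terms_le C_gt0 Kg_gt0 c1_gt0 c2_gt0 c2_12 lam1 L0 Llam rhoE a0 a_exp muE erefl
  erefl ME G0 aG1 aG2 erefl erefl erefl).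
Qed.

End Asymptotics.

(** * Passage to the limit *)

Lemma cvg_ln_pinfty (R : realType) : ln x @[x --> +oo%R] --> (+oo%R : set_system R).
Proof.
apply/cvgryPge => A; near=> x.
have xA : expR A <= x by near: x; apply: nbhs_pinfty_ge; exact: num_real.
by rewrite -[A]expRK ler_ln ?posrE ?expR_gt0// (lt_le_trans _ xA) ?expR_gt0.
Unshelve. all: by end_near. Qed.

Lemma cvg_error_term (R : realType) (K : R) (w v : R -> R) :
  w x @[x --> +oo%R] --> +oo%R -> v x @[x --> +oo%R] --> +oo%R ->
  K * (expR (- w x) + (v x)^-1) @[x --> +oo%R] --> (0 : R).
Proof.
move=> wy vy; rewrite -(mulr0 K); apply: cvgMr; rewrite -(addr0 0); apply: cvgD.
  exact: (cvg_comp _ _ wy (@cvgr_expR R)).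
apply/gtr0_cvgV0 => //.
by have /cvgryPgt := vy; apply.
Qed.

Lemma almost_surely_of_error (R : realType) (d : R -> measure_display)
    (T : forall rho, measurableType (d rho)) (P : forall rho, probability (T rho) R)
    (A : forall rho, set (T rho)) (e : R -> R) :
  (\forall rho \near +oo%R, measurable (A rho)) ->
  (\forall rho \near +oo%R, (P rho (~` A rho) <= (e rho)%:E)%E) ->
  e rho @[rho --> +oo%R] --> (0 : R) -> asymptotically_almost_surely P A.
Proof.
move=> mA Pe e0; rewrite /asymptotically_almost_surely.
apply: (@squeeze_cvge _ _ _ _ (fun rho => (1 - e rho)%:E) _ (fun=> 1%E)); last exact: cvg_cst.
- near=> rho; apply/andP; split; last first.
    by apply: probability_le1; near: rho.
  have mAr : measurable (A rho) by near: rho.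
  have := probability_setC (P rho) (measurableC mAr); rewrite setCK => ->.
  rewrite EFinB leeB//; near: rho; exact: Pe.
- apply: cvg_EFin; first exact: nearW.
  by rewrite -[X in _ --> X]subr0; apply: cvgB => //; exact: cvg_cst.
Unshelve. all: by end_near. Qed.

(** The little-o with constant 1. The threshold 4 yields [2 * ln 2 <= ln s] in [tail_mass_le], and
    [expR 1] yields [1 <= ln x] in [radial_decay]. *)
Lemma littleo_decay (R : realType) (g : R -> R) :
  g =o_+oo (fun x => (x ^+ 2 * ln x ^+ 2)^-1) ->
  exists s0, [/\ 4 <= s0, expR 1 <= s0 & forall x, s0 <= x -> g x <= (x ^+ 2 * ln x ^+ 2)^-1].
Proof.
move/eqoP => /(_ 1 ltr01) [s [_ Hs]].
exists (Num.max (Num.max 4 (expR 1)) (s + 1)); split.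
- by rewrite !le_max lexx.
- by rewrite !le_max lexx orbT.
move=> x; rewrite !ge_max => /andP[_ sx].
have xs : s < x by apply: lt_le_trans sx; rewrite ltrDl.
have := Hs x xs; rewrite mul1r => /(le_trans (ler_norm _)); rewrite ger0_norm//.
by rewrite invr_ge0 mulr_ge0// sqr_ge0.
Qed.

Theorem theorem5 (R : realType) (g : R -> R) (C : R)
    (g01 : forall x : R, 0 <= x -> 0 <= g x <= 1)
    (g_noninc : forall x y : R, 0 <= x -> x <= y -> g y <= g x)
    (C_gt0 : 0 < C)
    (C_int : (\int[leb2]_z (g (norm2 z))%:E = C%:E)%E)
    (g_littleo : g =o_+oo (fun x => (x ^+ 2 * ln x ^+ 2)^-1))
    (b : R -> R)
    (b_pos : \forall rho \near +oo%R, 0 < ln rho + b rho)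
    (r : R -> R)
    (rE : forall rho, r rho = Num.sqrt ((ln rho + b rho) / (C * rho)))
    (d : R -> measure_display) (T : forall rho, measurableType (d rho))
    (P : forall rho, probability (T rho) R)
    (G : forall rho, network R (T rho))
    (G_rcn : forall rho : R, 0 < rho -> 0 < ln rho + b rho ->
      random_connection_network (P rho) (G rho) rho
        (fun x => g (x / r rho))) :
  (b rho @[rho --> +oo] --> +oo ->
    asymptotically_almost_surely P
      (fun rho => ~` has_isolated_node (G rho))) /\
  (b rho @[rho --> +oo] --> -oo ->
    asymptotically_almost_surely P
      (fun rho => has_isolated_node (G rho))).
Proof.
have [s0 [s0_ge4 s0_gee g_decay]] := littleo_decay g_littleo.
have [x1 x1_gt0 gx1_gt0] := exists_positive g01 g_noninc C_gt0 C_int s0_ge4 s0_gee g_decay.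
have rho_gt0 : \forall rho \near +oo%R, 0 < rho :> R by exact: nbhs_pinfty_gt.
have ln_ge (l : R) : \forall rho \near +oo%R, l <= ln rho.
  by have /cvgryPge := @cvg_ln_pinfty R; apply.
have mG : \forall rho \near +oo%R, measurable (has_isolated_node (G rho)).
  near=> rho; apply: measurable_has_isolated_node.
  have rho0 : 0 < rho by near: rho.
  have b0 : 0 < ln rho + b rho by near: rho.
  by have [] := G_rcn rho rho0 b0.
split=> b_lim.
- have [A [lam0 bound]] := few_isolated_nodes g01 g_noninc C_gt0 C_int s0_ge4 s0_gee g_decay
    x1_gt0 gx1_gt0.
  have b_ge (l : R) : \forall rho \near +oo%R, l <= b rho by move/cvgryPge : b_lim; apply.
  (* The minimum still tends to infinity and secures [L <= 2 * ln rho], on which [eta] and the side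
     and corner estimates rely. *)
  pose w rho := Num.min (b rho) (ln rho).
  apply: (almost_surely_of_error
    (e := fun rho => A * (expR (- w rho) + (Num.sqrt (ln rho))^-1))).
  + by near=> rho; apply: measurableC; near: rho.
  + near=> rho; rewrite setCK.
    have rho0 : 0 < rho by near: rho.
    have bp : 0 < ln rho + b rho by near: rho.
    have b0 : 0 <= b rho by near: rho; exact: b_ge.
    have ln0 : lam0 <= ln rho by near: rho; exact: ln_ge.
    have ln1 : 0 <= ln rho by near: rho; exact: ln_ge.
    have -> : - w rho = ln rho - (ln rho + w rho) by ring.
    apply: (bound _ _ _ _ rho (r rho) (Num.sqrt ((ln rho + w rho) / (C * rho)))) => //.
    * by rewrite lerDl le_min b0.
    * by rewrite mulr_natl mulr2n lerD2l ge_min lexx orbT.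
    * rewrite rE ler_wsqrtr// ler_pM2r ?invr_gt0 ?mulr_gt0//.
      by rewrite lerD2l ge_min lexx.
    * exact: G_rcn.
  + apply: cvg_error_term; apply/cvgryPge => l; near=> rho.
    * by rewrite le_min; apply/andP; split; near: rho.
    * apply: (le_trans (ler_norm l)); rewrite -sqrtr_sqr ler_wsqrtr//.
      by near: rho; exact: ln_ge.
- have [A [lam0 bound]] := many_isolated_nodes g01 g_noninc C_gt0 C_int s0_ge4 s0_gee g_decay
    x1_gt0 gx1_gt0.
  apply: (almost_surely_of_error
    (e := fun rho => A * (expR (- (- b rho)) + (ln rho)^-1))) => //.
  + near=> rho.
    have rho0 : 0 < rho by near: rho.
    have bp : 0 < ln rho + b rho by near: rho.
    have b0 : b rho <= 0 by near: rho; move/cvgrNyPle : b_lim; apply.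
    have ln0 : lam0 <= ln rho by near: rho; exact: ln_ge.
    have -> : - (- b rho) = ln rho + b rho - ln rho by ring.
    apply: (bound _ _ _ _ rho (r rho) (ln rho + b rho)) => //.
    * by rewrite gerDl.
    * exact: G_rcn.
  + apply: cvg_error_term; last exact: cvg_ln_pinfty.
    apply/cvgryPge => l; near=> rho; rewrite lerNr.
    by near: rho; move/cvgrNyPle : b_lim; apply.
Unshelve. all: by end_near. Qed.
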